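(* Let $f:(\mathbb C^2,0)\to(\mathbb C,0)$ define the germ of a non-smooth unibranch plane curve singularity. Let $\mu$ be the minimal log resolution of $f$. Then the set of remarkable numbers of $f$ is the set of quotients $\alpha_i=\nu_i/N_i$, where $i\in S$ is such that $E_i$ meets exactly three other $E_j$ with $j\in S\setminus\{i\}$.
   Context: Unibranch means that the power series of $f$ at $0$ is irreducible; non-smooth means that the curve germ $f^{-1}(0)$ is singular at $0$. The minimal log resolution $\mu:Y\to X$ ($X$ a small neighbourhood of $0$ in which $0$ is the only singular point of the curve) is obtained by repeatedly blowing up, starting at $0$, the points where the total transform of $f^{-1}(0)$ is not a simple normal crossings divisor, until the total transform is a simple normal crossings divisor. Write $\mu^*(\mathrm{div}(f))=\sum_{i\in S}N_iE_i$ with $N_i\in\mathbb Z_{>0}$ and $E_i$ distinct prime divisors (the exceptional curves and the strict transform of the curve), and $K_\mu=\sum_{i\in S}(\nu_i-1)E_i$ for the relative canonical divisor. Remarkable numbers. For $\emptyset\ne I\subset S$ with $E_I:=\bigcap_{i\in I}E_i\ne\emptyset$ put $N_I=\gcd_{i\in I}N_i$, $\alpha_I=\min_{i\in I}\nu_i/N_i$. A number $\alpha$ is remarkable for $f$ if there is $\emptyset\ne I\subset S$ with $E_I\ne\emptyset$ and $\alpha_I=\alpha$ such that for every $\emptyset\ne J\subset S$ with $E_J\ne\emptyset$ and $\alpha_J<\alpha_I$, $N_J$ does not divide $N_I$. (This set does not depend on the log resolution used to compute it.) *)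

(* Defs.v *)
From mathcomp Require Import all_boot all_order all_algebra.
From mathcomp Require Import finmap complex.
From mathcomp Require Import boolp classical_sets cardinality reals.

Set Implicit Arguments.
Unset Strict Implicit.
Unset Printing Implicit Defensive.
Import Order.TTheory GRing.Theory Num.Theory.
Local Open Scope classical_set_scope.
Local Open Scope ring_scope.

Section PowerSeries.
Variable R : realType.
Local Notation C := R[i].

(* [g i j] is the coefficient of x^i y^j. *)
Definition series := nat -> nat -> C.

Definition ps_monom (a b : nat) : series :=
  fun i j => ((i == a) && (j == b))%:R.

Definition ps_one : series := ps_monom 0 0.
Definition ps_x : series := ps_monom 1 0.
Definition ps_y : series := ps_monom 0 1.

Definition ps_mul (g h : series) : series := fun i j =>
  \sum_(k < i.+1) \sum_(l < j.+1) g k l * h (i - k)%N (j - l)%N.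

Definition ps_exp (g : series) (n : nat) : series := iter n (ps_mul g) ps_one.

Definition ps_dvd (g h : series) : Prop := exists u, h = ps_mul g u.

Definition ps_unit (g : series) : Prop := exists h, ps_mul g h = ps_one.

Definition ps_irreducible (g : series) : Prop :=
  ~ ps_unit g /\ forall h k, g = ps_mul h k -> ps_unit h \/ ps_unit k.

(* Absolute convergence at (r, r), hence on the polydisc of radius r. *)
Definition ps_convergent (g : series) : Prop :=
  exists2 r : R, 0 < r & exists M : R, forall n : nat,
    \sum_(i < n) \sum_(j < n) `|g i j| * real_complex R (r ^+ (i + j)) <= real_complex R M.

(* The differential of [g] at the origin. *)
Definition ps_diff (g : series) : 'rV[C]_2 :=
  \row_(k < 2) if k == ord0 then g 1%N 0%N else g 0%N 1%N.

Definition ps_vanishes (g : series) : Prop := g 0%N 0%N = 0.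

(* The order of [h] along the curve g = 0, for [g] irreducible. *)
Definition ps_ord (g h : series) : nat :=
  xget 0%N [set n | ps_dvd (ps_exp g n) h /\ ~ ps_dvd (ps_exp g n.+1) h].

(* A germ f : (C^2, 0) -> (C, 0) is given by its power series at 0. *)
Definition holomorphic_germ (f : series) : Prop :=
  ps_convergent f /\ ps_vanishes f.

Definition unibranch (f : series) : Prop := ps_irreducible f.

Definition smooth_germ (f : series) : Prop := ps_diff f != 0.

End PowerSeries.

Section Resolution.
Variable R : realType.
Local Notation C := R[i].
Local Notation series := (series R).

(* Points of the exceptional line P^1 of a blow-up of the origin:            *)
(* [Some t] is the direction y = t x, [None] is the direction x = 0.         *)
Definition direction : Type := option C.

(* A point over 0 obtained by successive point blow-ups: [:: t1; ...; tn] is *)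
(* the point of direction t_n on the exceptional curve of the blow-up of     *)
(* [:: t1; ...; t_(n-1)].  Local coordinates (x', y') centred at the new     *)
(* point are given by                                                        *)
(*   (x, y) = (x', x' (y' + t)) for [Some t],   (x, y) = (x' y', y') for     *)
(*   [None].                                                                 *)
Definition near_point : Type := seq direction.

Definition pullback (t : direction) (g : series) : series :=
  match t with
  | Some t => fun k l =>
      \sum_(j < k.+1) g (k - j)%N j * t ^+ (j - l) *+ 'C(j, l)
  | None => fun k l => if (k <= l)%N then g k (l - k)%N else 0
  end.

(* The exceptional curve of a blow-up in the chart centred at [t]; it is     *)
(* also the Jacobian determinant of that chart.                              *)
Definition exc_eq (t : direction) : series :=
  if t is Some _ then ps_x R else ps_y R.

Definition strict1 (t : direction) (g : series) : series :=
  xget (ps_one R) [set h | ~ ps_dvd (exc_eq t) h /\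
    exists n, pullback t g = ps_mul (ps_exp (exc_eq t) n) h].

Definition total_transform (g : series) (p : near_point) : series :=
  foldl (fun h t => pullback t h) g p.

Definition strict_transform (g : series) (p : near_point) : series :=
  foldl (fun h t => strict1 t h) g p.

(* The Jacobian determinant, at [p], of the composition of the blow-ups.     *)
Definition jacobian (p : near_point) : series :=
  foldl (fun h t => ps_mul (pullback t h) (exc_eq t)) (ps_one R) p.

(* [Some q] is (the strict transform of) the exceptional curve of the        *)
(* blow-up of [q]; [None] is the strict transform of the unibranch curve     *)
(* f = 0.                                                                    *)
Definition divisor : Type := option near_point.

(* The exceptional curve of the blow-up of [q], seen at [p]; it is 1 when    *)
(* [p] does not lie over a point of that curve.                              *)
Fixpoint exc_local (q p : near_point) : series :=
  match q, p with
  | [::], t :: r => strict_transform (exc_eq t) r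
  | s :: q', t :: p' => if s == t then exc_local q' p' else ps_one R
  | _, [::] => ps_one R
  end.

Section Curve.
Variable f : series.

Definition local_eq (i : divisor) (p : near_point) : series :=
  if i is Some q then exc_local q p else strict_transform f p.

Definition passes (i : divisor) (p : near_point) : Prop :=
  ps_vanishes (local_eq i p).

(* The total transform of f = 0 has simple normal crossings at [p]: its      *)
(* components through [p] have linearly independent differentials there.     *)
(* Each component is locally irreducible, f being unibranch.                 *)
Definition snc_at (p : near_point) : Prop :=
  forall s : seq divisor, uniq s -> (forall i, i \in s -> passes i p) ->
    free [seq ps_diff (local_eq i p) | i <- s].

(* The points blown up in the minimal log resolution Y. *)
Definition center (p : near_point) : Prop :=
  forall q, prefix q p -> ~ snc_at q.

(* The points of Y over 0. *)
Definition resolution_point (p : near_point) : Prop :=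
  snc_at p /\ forall q, prefix q p -> q != p -> center q.

Definition components : set divisor :=
  [set i | if i is Some q then center q else True].

(* A point of E_i with a local chart, used to read off multiplicities        *)
(* along E_i: they do not depend on the chosen point.                        *)
Definition chart_on (i : divisor) : near_point :=
  if i is Some q then rcons q (Some 0) else [::].

Definition N_comp (i : divisor) : nat :=
  ps_ord (local_eq i (chart_on i)) (total_transform f (chart_on i)).

Definition nu_comp (i : divisor) : nat :=
  (ps_ord (local_eq i (chart_on i)) (jacobian (chart_on i))).+1.

Definition alpha_comp (i : divisor) : rat := (nu_comp i)%:R / (N_comp i)%:R.

(* E_I is nonempty.  Points of Y over 0 suffice: away from them the only     *)
(* component is the strict transform, which also has a point over 0.         *)
Definition meet_nonempty (I : {fset divisor}) : Prop :=
  exists2 p, resolution_point p & forall i, i \in I -> passes i p.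

Definition stratum (I : {fset divisor}) : Prop :=
  [/\ I != fset0, (forall i, i \in I -> components i) & meet_nonempty I].

Definition N_set (I : {fset divisor}) : nat := \big[gcdn/0%N]_(i <- I) N_comp i.

(* The minimum over a nonempty [I]. *)
Definition alpha_set (I : {fset divisor}) : rat :=
  let s := [seq alpha_comp i | i <- I] in \big[Num.min/head 0 s]_(a <- s) a.

Definition remarkable (a : rat) : Prop :=
  exists I, [/\ stratum I, alpha_set I = a &
    forall J, stratum J -> alpha_set J < alpha_set I -> ~~ (N_set J %| N_set I)%N].

Definition neighbours (i : divisor) : set divisor :=
  [set j | [/\ components j, j != i & meet_nonempty [fset i; j]%fset]].

End Curve.
End Resolution.

(* Main.v *)
Require Import Defs.
From mathcomp Require Import all_boot all_order all_algebra.
From mathcomp Require Import finmap complex.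
From mathcomp Require Import boolp classical_sets cardinality reals.
From HB Require Import structures.
From mathcomp Require Import ring zify.

Set Implicit Arguments.
Unset Strict Implicit.
Unset Printing Implicit Defensive.
Import Order.TTheory GRing.Theory Num.Theory.
Local Open Scope ring_scope.

(** The strict transform of a unibranch germ meets the exceptional curve of each
    blow-up in a single point, so the points to examine form one sequence
    p_0, p_1, ..., and the exceptional curves through p_n are coordinate axes of
    the chart at p_n.  Both this and the irreducibility of the strict transform
    at p_(n+1) come from one descent statement, [pushdown]: a local factorization
    of the strict transform on the exceptional line can be normalized by
    Weierstrass preparation so that both factors satisfy the degree bounds that
    characterize pull-backs, and then it descends to a factorization of the
    germ itself.

    The intersection numbers (a, b) of the strict transform with the two axes
    undergo the Euclidean algorithm.  At a point lying on two exceptional curves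
    E_A and E_B the new curve has N = N_A + N_B + min(a, b) and nu = nu_A + nu_B;
    at a point lying on one exceptional curve E_A it has
    nu = nu_A + 1 and N = N_A + (multiplicity of the strict transform).  When
    a = b the new curve separates from both old ones.  The process stops because
    a would otherwise be constant, at least 2, along an infinite sequence of
    points on one exceptional curve each; the Tschirnhaus transformation shows that
    f is then the a-th power of a smooth germ, up to a unit ([no_free_chain]).

    [run] records this process with the edges of the dual graph, each directed
    from the older curve to the younger.  Every exceptional curve has exactly one
    younger neighbour (the strict transform for the last one) and at most two
    older ones, so it meets three others exactly when two curves separate from
    it at once: this is the rupture step a = b.

    The arithmetic is in [run_inv].  Between rupture curves the graph consists of
    chains, and the gcd of the multiplicities N of adjacent curves is constant on
    a chain.  The quotient nu / N is smallest at the first rupture curve and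
    strictly increases along every path starting there.  Let v be a rupture curve
    with younger neighbour s.  For the first one no stratum has a smaller
    quotient; for a later one, every stratum with a quotient smaller than that of
    v lies on curves whose N are all multiples of the gcd e of the chain arriving
    at v, while gcd(N_v, N_s) is a proper divisor of e.  So I = {v, s} shows that
    the quotient of v is remarkable.  Conversely, if the curve w of smallest
    quotient in I is not a rupture curve, the chain through w has an edge J
    between w and a curve of smaller quotient, and the gcd of that chain, which
    is N_J, divides N_I ([remarkable_cells]). *)

(** * Formal power series over a commutative ring *)

Definition ps (A : Type) : Type := nat -> A.

HB.instance Definition _ A := gen_eqMixin (ps A).
HB.instance Definition _ A := gen_choiceMixin (ps A).

Lemma psP A (f g : ps A) : f =1 g -> f = g.
Proof. by move=> fg; apply/funext. Qed.

Section PsRing.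
Variable A : comNzRingType.
Implicit Types f g h : ps A.

Definition psadd f g : ps A := fun n => f n + g n.
Definition psopp f : ps A := fun n => - f n.
Definition ps0 : ps A := fun=> 0.
Definition ps1 : ps A := fun n => (n == 0)%:R.
Definition psmul f g : ps A := fun n => \sum_(k < n.+1) f k * g (n - k)%N.

(** The coefficients of a product of series are those of products of truncations,
    so that the ring axioms reduce to those of polynomials. *)
Lemma psmul_trunc m n f g : (n < m)%N ->
  psmul f g n = ((\poly_(i < m) f i) * (\poly_(i < m) g i))`_n.
Proof.
move=> nm; rewrite coefM; apply: eq_bigr => k _; rewrite !coef_poly.
by rewrite (leq_trans (ltn_ord k)) // (leq_ltn_trans (leq_subr _ _) nm).
Qed.

Lemma coef_mul_trunc m n (p q p' q' : {poly A}) :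
  (n < m)%N -> (forall i, (i < m)%N -> p`_i = p'`_i) ->
  (forall i, (i < m)%N -> q`_i = q'`_i) -> (p * q)`_n = (p' * q')`_n.
Proof.
move=> nm pp qq; rewrite !coefM; apply: eq_bigr => k _.
by rewrite pp ?qq // ?(leq_ltn_trans (leq_subr _ _) nm) // (leq_trans (ltn_ord k)).
Qed.

Lemma psaddA : associative psadd.
Proof. by move=> f g h; apply: psP => n; rewrite /psadd addrA. Qed.
Lemma psaddC : commutative psadd.
Proof. by move=> f g; apply: psP => n; rewrite /psadd addrC. Qed.
Lemma psadd0 : left_id ps0 psadd.
Proof. by move=> f; apply: psP => n; rewrite /psadd add0r. Qed.
Lemma psaddN : left_inverse ps0 psopp psadd.
Proof. by move=> f; apply: psP => n; rewrite /psadd addNr. Qed.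
Lemma psmulC : commutative psmul.
Proof.
by move=> f g; apply: psP => n; rewrite !(@psmul_trunc n.+1) // mulrC.
Qed.
Lemma psmulA : associative psmul.
Proof.
move=> f g h; apply: psP => n; rewrite !(@psmul_trunc n.+1) //.
pose T (u : ps A) := \poly_(i < n.+1) u i.
have TM u v i : (i < n.+1)%N -> (T (psmul u v))`_i = (T u * T v)`_i.
  by move=> lin; rewrite coef_poly lin (@psmul_trunc n.+1).
rewrite -!/(T _) (@coef_mul_trunc n.+1 n (T f) (T (psmul g h)) (T f) (T g * T h)) //;
  last exact: TM.
by rewrite mulrA; apply: (@coef_mul_trunc n.+1) => // i lin; rewrite TM.
Qed.
Lemma psmul1 : left_id ps1 psmul.
Proof.
move=> f; apply: psP => n; rewrite /psmul big_ord_recl /= subn0 mul1r big1 ?addr0 //.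
by move=> k _; rewrite /ps1 /= mul0r.
Qed.
Lemma psmulDl : left_distributive psmul psadd.
Proof.
move=> f g h; apply: psP => n; rewrite /psmul /psadd -big_split /=.
by apply: eq_bigr => k _; rewrite mulrDl.
Qed.
Lemma ps1_neq0 : ps1 != ps0.
Proof.
by apply/eqP => /(congr1 (fun f => f 0%N)) /eqP; rewrite /ps1 /ps0 /= oner_eq0.
Qed.
End PsRing.

HB.instance Definition _ (A : comNzRingType) :=
  GRing.isZmodule.Build (ps A) (@psaddA A) (@psaddC A) (@psadd0 A) (@psaddN A).
HB.instance Definition _ (A : comNzRingType) :=
  GRing.Zmodule_isComNzRing.Build (ps A) (@psmulA A) (@psmulC A) (@psmul1 A)
    (@psmulDl A) (@ps1_neq0 A).

Section PsTheory.
Variable A : comNzRingType.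
Implicit Types f g h : ps A.

Lemma ps_coefM f g n : (f * g) n = \sum_(k < n.+1) f k * g (n - k)%N.
Proof. by []. Qed.
Lemma ps_coefD f g n : (f + g) n = f n + g n.
Proof. by []. Qed.
Lemma ps_coefN f n : (- f) n = - f n.
Proof. by []. Qed.
Lemma ps_coef0 n : (0 : ps A) n = 0.
Proof. by []. Qed.
Lemma ps_coef1 n : (1 : ps A) n = (n == 0)%:R.
Proof. by []. Qed.
Lemma psM0E f g : (f * g) 0%N = f 0%N * g 0%N.
Proof. by rewrite ps_coefM big_ord1. Qed.
Lemma ps_sumE (I : Type) (r : seq I) (P : pred I) (F : I -> ps A) n :
  (\sum_(i <- r | P i) F i) n = \sum_(i <- r | P i) F i n.
Proof. by elim/big_rec2: _ => [|i y1 y2 _ <-]. Qed.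

Definition psX : ps A := fun n => (n == 1%N)%:R.
Definition ps_const (a : A) : ps A := fun n => if n == 0%N then a else 0.
Definition shift n f : ps A := fun k => f (n + k)%N.

Lemma psXnE m n : (psX ^+ m) n = (n == m)%:R.
Proof.
elim: m n => [//|m IH] [|n]; rewrite exprS ps_coefM.
  by rewrite big_ord1 /psX /= mul0r.
rewrite big_ord_recl /psX /= mul0r add0r big_ord_recl /= mul1r.
by rewrite big1 ?addr0 ?subSS ?subn0 ?IH // => k _; rewrite /= mul0r.
Qed.

Lemma psXnM m f n : (psX ^+ m * f) n = if (n < m)%N then 0 else f (n - m)%N.
Proof.
rewrite ps_coefM; case: ltnP => nm.
  rewrite big1 // => k _; rewrite psXnE.
  by rewrite ltn_eqF ?mul0r // (leq_trans (ltn_ord k)).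
have lm : (m < n.+1)%N by [].
rewrite (bigD1 (Ordinal lm)) //= psXnE eqxx mul1r big1 ?addr0 // => k.
by rewrite -val_eqE /= psXnE => /negPf->; rewrite mul0r.
Qed.

Lemma psXM f n : (psX * f) n = if n is n'.+1 then f n' else 0.
Proof. by rewrite -[psX]expr1 psXnM; case: n => //= n; rewrite subn1. Qed.

Lemma psXn_inj m : injective (fun f => psX ^+ m * f).
Proof.
move=> f g fg; apply: psP => n; have := congr1 (fun h => h (m + n)%N) fg.
by rewrite /= !psXnM ltnNge leq_addr /= addKn.
Qed.


Lemma ps_shift m f : (forall k, (k < m)%N -> f k = 0) -> f = psX ^+ m * shift m f.
Proof.
move=> f0; apply: psP => n; rewrite psXnM; case: ltnP => [/f0//|mn].
by rewrite /shift subnKC.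
Qed.

Lemma ps_neq0P f : f <> 0 -> exists2 m, f m != 0 & forall k, (k < m)%N -> f k = 0.
Proof.
move=> f0; have /existsNP[n /eqP germ_at] : ~ forall n, f n = 0 by move=> H; apply: f0;
  apply: psP.
have ex : exists n, f n != 0 by exists n.
exists (ex_minn ex); first by case: ex_minnP.
by case: ex_minnP => m _ H k; case: (eqVneq (f k) 0) => // /H; rewrite leqNgt => /negbTE->.
Qed.

Lemma psXn_uniq m n f g : psX ^+ m * f = psX ^+ n * g -> f 0%N <> 0 -> g 0%N <> 0 ->
  m = n /\ f = g.
Proof.
move=> E f0 g0; case: (ltngtP m n) => mn.
- by have := congr1 (fun h => h m) E; rewrite !psXnM ltnn subnn mn.
- by have := congr1 (fun h => h n) E; rewrite !psXnM ltnn subnn mn => /esym.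
- by split=> //; subst n; apply: psXn_inj E.
Qed.

(** Stated as a property, because the domains it is applied to are used only
    through their commutative ring structure. *)
Definition nozerodiv (B : comNzRingType) := forall a b : B, a * b = 0 -> a = 0 \/ b = 0.

Lemma ps_nozerodiv : nozerodiv A -> nozerodiv (ps A).
Proof.
move=> nz f g fg; case: (pselect (f = 0)) => [|f0]; first by left.
case: (pselect (g = 0)) => [|g0]; first by right.
have [m fm mf] := ps_neq0P f0; have [n gn ng] := ps_neq0P g0.
move: fg; rewrite (ps_shift mf) (ps_shift ng).
rewrite mulrACA -exprD -(mulr0 (psX ^+ (m + n))) => /psXn_inj.
move/(congr1 (fun h => h 0%N)); rewrite /= psM0E ps_coef0 /shift !addn0.
by move=> /nz[] /eqP; rewrite ?(negbTE fm) ?(negbTE gn).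
Qed.

(** Inverses and Weierstrass units are constructed one coefficient at a time: [Phi n]
    computes the n-th term from the earlier ones. *)
Lemma strong_rec (T : Type) (x0 : T) (Phi : nat -> (nat -> T) -> T) :
  (forall n s s', (forall k, (k < n)%N -> s k = s' k) -> Phi n s = Phi n s') ->
  exists s : nat -> T, forall n, s n = Phi n s.
Proof.
move=> ext; pose fix L n : seq T := if n is n'.+1 then
  rcons (L n') (Phi n' (nth x0 (L n'))) else [::].
have LS n : L n.+1 = rcons (L n) (Phi n (nth x0 (L n))) by [].
have sL n : size (L n) = n by elim: n => // n IH; rewrite LS size_rcons IH.
have nL n k : (k < n)%N -> nth x0 (L n) k = nth x0 (L k.+1) k.
  elim: n => // n IH; rewrite ltnS leq_eqVlt => /orP[/eqP->//|kn].
  by rewrite LS nth_rcons sL kn IH.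
exists (fun n => nth x0 (L n.+1) n) => n.
by rewrite LS nth_rcons sL ltnn eqxx; apply: ext => k kn; rewrite nL.
Qed.

Lemma ps_inv f a : f 0%N * a = 1 -> exists g, f * g = 1.
Proof.
move=> fa.
pose Phi n (s : nat -> A) := a * ((n == 0)%:R - \sum_(k < n) f k.+1 * s (n - k.+1)%N).
have [n s s' ss|g gE] := @strong_rec A 0 Phi.
  rewrite /Phi; congr (_ * (_ - _)); apply: eq_bigr => k _; rewrite ss //.
  by have := ltn_ord k; lia.
exists g; apply: psP => n; rewrite ps_coefM big_ord_recl /= subn0 {1}gE /Phi mulrA fa mul1r.
by rewrite /bump /= subrK.
Qed.

Lemma ps_unit0 f g : f * g = 1 -> f 0%N * g 0%N = 1.
Proof. by move/(congr1 (fun h => h 0%N)); rewrite psM0E. Qed.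

Definition ofpoly (p : {poly A}) : ps A := fun n => p`_n.
Lemma ofpoly_is_zmod : zmod_morphism ofpoly.
Proof. by move=> p q; apply: psP => n; rewrite /ofpoly coefB. Qed.
Lemma ofpoly_is_monoid : monoid_morphism ofpoly.
Proof.
split=> [|p q]; apply: psP => n; rewrite /ofpoly ?coef1 ?ps_coef1 //.
by rewrite coefM.
Qed.
End PsTheory.
HB.instance Definition _ (A : comNzRingType) :=
  GRing.isZmodMorphism.Build _ _ (@ofpoly A) (@ofpoly_is_zmod A).
HB.instance Definition _ (A : comNzRingType) :=
  GRing.isMonoidMorphism.Build _ _ (@ofpoly A) (@ofpoly_is_monoid A).

(** * Affine substitutions in polynomials *)

Section PolyShift.
Variable A : comNzRingType.
Implicit Types (p q : {poly A}) (c x : A).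

Lemma comp_poly0l q : 0 \Po q = 0.
Proof. by rewrite -(polyC0 A) comp_polyC. Qed.

Lemma coef_taylor p n c l : (size p <= n)%N ->
  (p \Po ('X + c%:P))`_l = \sum_(j < n) p`_j * c ^+ (j - l) *+ 'C(j, l).
Proof.
move=> pn; rewrite coef_comp_poly (big_ord_widen n (fun j => p`_j * (('X + c%:P) ^+ j)`_l)) //.
rewrite big_mkcond; apply: eq_bigr => j _ /=.
case: ltnP => jp; last by rewrite nth_default // !mul0r mul0rn.
rewrite -mulrnAr; congr (_ * _).
rewrite addrC exprDn coef_sum.
case: (leqP l j) => lj; last first.
  rewrite bin_small // big1 // => i _.
  rewrite coefMn -rmorphXn coefCM coefXn.
  by rewrite gtn_eqF ?mulr0 ?mul0rn // (leq_trans (ltn_ord i)).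
have lj' : (l < j.+1)%N by [].
rewrite (bigD1 (Ordinal lj')) //= coefMn -rmorphXn coefCM coefXn eqxx mulr1 big1 ?addr0 //.
move=> i; rewrite -val_eqE /= => il.
by rewrite coefMn -rmorphXn coefCM coefXn eq_sym (negPf il) mulr0 mul0rn.
Qed.

Lemma coef_taylor_top p n c : (size p <= n.+1)%N -> (p \Po ('X + c%:P))`_n = p`_n.
Proof.
move=> sp; rewrite (coef_taylor _ _ sp) big_ord_recr /= subnn expr0 mulr1 binn.
by rewrite big1 ?add0r // => j _; rewrite bin_small.
Qed.

(** The coefficient below the leading one is the one that a translation moves
    linearly. *)
Lemma coef_taylor_subtop p n c : (size p <= n.+2)%N ->
  (p \Po ('X + c%:P))`_n = p`_n + (p`_n.+1 * c) *+ n.+1.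
Proof.
move=> sp; rewrite (coef_taylor _ _ sp) !big_ord_recr /= subnn expr0 mulr1 binn.
rewrite subSnn expr1 binSn big1 ?add0r // => j _.
by rewrite bin_small.
Qed.

Lemma size_taylor p n c : (size p <= n.+1)%N -> (size (p \Po ('X + c%:P)) <= n.+1)%N.
Proof.
move=> sp; apply: (leq_trans (size_comp_poly_leq _ _)).
by rewrite size_XaddC muln1 ltnS; case: (size p) sp.
Qed.

Lemma coef_comp_scaleX p x j : (p \Po (x *: 'X))`_j = p`_j * x ^+ j.
Proof.
rewrite coef_comp_poly; under eq_bigr do rewrite exprZn coefZ coefXn.
case: (ltnP j (size p)) => jp; last first.
  rewrite nth_default // mul0r big1 // => i _.
  by rewrite gtn_eqF ?mulr0 // (leq_trans (ltn_ord i)).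
rewrite (bigD1 (Ordinal jp)) //= eqxx mulr1 big1 ?addr0 // => i.
by rewrite -val_eqE eq_sym /= => /negbTE->; rewrite !mulr0.
Qed.

Lemma size_comp_scaleX p x : (size (p \Po (x *: 'X)) <= size p)%N.
Proof.
by apply/leq_sizeP => j jp; rewrite coef_comp_scaleX nth_default // mul0r.
Qed.

Lemma comp_scale_shift p x c :
  p \Po (x *: ('X + c%:P)) = (p \Po ('X + (x * c)%:P)) \Po (x *: 'X).
Proof.
rewrite -comp_polyA; congr (_ \Po _).
by rewrite comp_polyD comp_polyX comp_polyC scalerDr -mul_polyC -[x *: c%:P]mul_polyC polyCM mul_polyC.
Qed.
Lemma comp_scale_shift' p x c :
  p \Po (x *: ('X + c%:P)) = (p \Po (x *: 'X)) \Po ('X + c%:P).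
Proof. by rewrite -comp_polyA comp_polyZ comp_polyX. Qed.

End PolyShift.

(** * The ring of power series in two variables and its blow-ups *)

HB.instance Definition _ (R : realType) := GRing.ComNzRing.copy (series R) (ps (ps R[i])).

Section Series.
Variable R : realType.
Local Notation C := R[i].
Local Notation S := (series R).
Implicit Types (f g h : S).

Lemma serP f g : (forall i j, f i j = g i j) -> f = g.
Proof. by move=> fg; apply: (@psP (ps C)) => i; apply: psP => j. Qed.

(** The coefficient of x^i, as a power series in y; the type is what selects
    the ring structure. *)
Definition row_of f i : ps C := f i.

Lemma serME f g i : row_of (f * g) i = \sum_(k < i.+1) row_of f k * row_of g (i - k)%N.
Proof. exact: (@ps_coefM (ps C)). Qed.

Lemma ser_coefM f g i j :
  (f * g) i j = \sum_(k < i.+1) \sum_(l < j.+1) f k l * g (i - k)%N (j - l)%N.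
Proof.
rewrite -[LHS]/(row_of (f * g) i j) serME ps_sumE; apply: eq_bigr => k _.
exact: ps_coefM.
Qed.

Lemma ps_mulE f g : ps_mul f g = f * g.
Proof. by apply: serP => i j; rewrite ser_coefM. Qed.

Lemma ps_oneE : ps_one R = 1.
Proof. by apply: serP => -[|i] [|j]. Qed.

Lemma ps_expE f n : ps_exp f n = f ^+ n.
Proof.
by elim: n => [|n IH]; [exact: ps_oneE | rewrite exprS -IH -ps_mulE].
Qed.

Lemma ps_dvdE f g : ps_dvd f g <-> exists u, g = f * u.
Proof. by split=> -[u ->]; exists u; rewrite ps_mulE. Qed.

Lemma ser00M f g : (f * g) 0%N 0%N = f 0%N 0%N * g 0%N 0%N.
Proof. by rewrite ser_coefM !big_ord1. Qed.


Definition sunit f := f 0%N 0%N != 0.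

Lemma ps_unit_inv (A : fieldType) (u : ps A) : u 0%N != 0 -> exists v, u * v = 1.
Proof. by move=> u0; apply: (@ps_inv A u (u 0%N)^-1); rewrite mulfV. Qed.

Lemma sunit_inv f : sunit f -> exists2 g, f * g = 1 & sunit g.
Proof.
move=> f0; have [v fv] := @ps_unit_inv C (f 0%N) f0.
have [g fg] : exists g : S, f * g = 1 by exact: (@ps_inv (ps C) f v fv).
exists g => //; have := congr1 (fun h : S => h 0%N 0%N) fg.
rewrite ser00M /sunit; case: eqP => // ->; rewrite mulr0 => /eqP.
by rewrite eq_sym oner_eq0.
Qed.

Lemma ps_unitP f : ps_unit f <-> sunit f.
Proof.
split=> [[g]|/sunit_inv[g fg _]]; last by exists g; rewrite ps_mulE ps_oneE.
rewrite ps_mulE ps_oneE /sunit; case: eqP => // f0 /(congr1 (fun h : S => h 0%N 0%N)).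
by rewrite ser00M f0 mul0r => /eqP; rewrite eq_sym oner_eq0.
Qed.

Lemma sunitM f g : sunit (f * g) = sunit f && sunit g.
Proof. by rewrite /sunit ser00M mulf_eq0 negb_or. Qed.
Lemma sunit1 : sunit 1.
Proof. exact: oner_neq0. Qed.
Lemma sunitX f n : sunit f -> sunit (f ^+ n).
Proof. by move=> uf; elim: n => [|n IH]; rewrite ?expr0 ?sunit1 // exprS sunitM uf. Qed.

Lemma psC_nozerodiv : nozerodiv (ps C).
Proof.
by apply: ps_nozerodiv => a b /eqP; rewrite mulf_eq0 => /orP[]/eqP->; [left|right].
Qed.
Lemma ser_nozerodiv f g : f * g = 0 -> f = 0 \/ g = 0.
Proof. exact: (ps_nozerodiv psC_nozerodiv). Qed.

Definition irr f := ~~ sunit f /\ forall h k, f = h * k -> sunit h || sunit k.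
Lemma irrP f : ps_irreducible f <-> irr f.
Proof.
split=> -[nu fac]; split.
- by apply/negP => /ps_unitP.
- move=> h k; rewrite -ps_mulE => /fac[] /ps_unitP ->; rewrite ?orbT //.
- by move/ps_unitP; apply/negP.
- by move=> h k; rewrite ps_mulE => /fac /orP[] /ps_unitP; [left|right].
Qed.
Lemma irr_neq0 f : irr f -> f <> 0.
Proof.
move=> [nu fac] f0; have : f = 0 * 0 by rewrite mulr0.
by move/fac; rewrite orbb -f0; apply/negP.
Qed.

(** Exchanging x and y reduces every statement on the direction [None] to the
    direction [Some 0]. *)
Definition swap f : S := fun i j => f j i.
Lemma swapK : involutive swap. Proof. by []. Qed.
Lemma swap_inj : injective swap. Proof. exact: can_inj swapK. Qed.
Lemma swapM f g : swap (f * g) = swap f * swap g.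
Proof.
apply: serP => i j; rewrite /swap !ser_coefM exchange_big /=.
by [].
Qed.
Lemma swap1 : swap 1 = 1.
Proof. by apply: serP => -[|i] [|j]. Qed.
Lemma swapX f n : swap (f ^+ n) = swap f ^+ n.
Proof. by elim: n => [|n IH]; rewrite ?swap1 // !exprS swapM IH. Qed.
Lemma sunit_swap f : sunit (swap f) = sunit f. Proof. by []. Qed.
Lemma irr_swap f : irr f -> irr (swap f).
Proof.
move=> [nu fac]; split=> // h k /(congr1 swap); rewrite swapK swapM => /fac.
by [].
Qed.

Definition sx : S := ps_x R.
Definition sy : S := ps_y R.
Lemma swap_sx : swap sx = sy.
Proof. by apply: serP => -[|[|i]] [|[|j]]. Qed.
Lemma swap_sy : swap sy = sx.
Proof. by rewrite -swap_sx swapK. Qed.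
Lemma sxE : sx = psX (ps C).
Proof. by apply: serP => -[|[|i]] [|[|j]]. Qed.

Lemma sxnM m f i j : (sx ^+ m * f) i j = if (i < m)%N then 0 else f (i - m)%N j.
Proof.
rewrite sxE; have := congr1 (fun r : ps C => r j) (@psXnM (ps C) m f i).
by case: ifP.
Qed.
Lemma synM m f i j : (sy ^+ m * f) i j = if (j < m)%N then 0 else f i (j - m)%N.
Proof.
have -> : sy ^+ m * f = swap (sx ^+ m * swap f) by rewrite swapM swapX swap_sx swapK.
by rewrite /swap sxnM.
Qed.
Lemma sxn_inj m : injective (fun f => sx ^+ m * f).
Proof. by rewrite sxE; exact: (@psXn_inj (ps C) m). Qed.

(** Not divisible by x. *)
Definition xfree f := row_of f 0 <> 0.
Definition yfree f := xfree (swap f).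
Lemma xfreeP f : xfree f <-> exists j, f 0%N j != 0.
Proof.
split=> [/ps_neq0P[j fj _]|[j fj] f0]; first by exists j.
by move: fj; have := congr1 (fun r : ps C => r j) f0; rewrite /row_of /= => ->; rewrite eqxx.
Qed.
Lemma xfreeM f g : xfree f -> xfree g -> xfree (f * g).
Proof.
rewrite /xfree serME big_ord1 /= => f0 g0 /psC_nozerodiv; case; auto.
Qed.
Lemma sunit_xfree f : sunit f -> xfree f.
Proof. by move=> uf; apply/xfreeP; exists 0%N. Qed.
Lemma sunit_yfree f : sunit f -> yfree f.
Proof. by rewrite -sunit_swap; apply: sunit_xfree. Qed.
Lemma xfree_y n : xfree (sy ^+ n).
Proof. by apply/xfreeP; exists n; rewrite -[sy ^+ n]mulr1 synM ltnn subnn oner_neq0. Qed.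
Lemma yfree_x n : yfree (sx ^+ n).
Proof. by rewrite /yfree swapX swap_sx; apply: xfree_y. Qed.
Lemma xdvdP f : (exists u, f = sx * u) <-> ~ xfree f.
Proof.
split=> [[u ->] /xfreeP[j]|/contrapT f0]; first by rewrite -[sx]expr1 sxnM eqxx.
exists (fun i => f i.+1); apply: serP => -[|i] j; rewrite -[sx in RHS]expr1 sxnM //=.
  by have := congr1 (fun r : ps C => r j) f0.
by rewrite subn1.
Qed.
Lemma ydvdP f : (exists u, f = sy * u) <-> ~ yfree f.
Proof.
rewrite /yfree -xdvdP; split=> -[u fu]; exists (swap u).
  by rewrite fu swapM swap_sy.
by apply: swap_inj; rewrite fu swapM swap_sy swapK.
Qed.
Lemma xn_uniq m n f g : sx ^+ m * f = sx ^+ n * g -> xfree f -> xfree g -> m = n /\ f = g.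
Proof. rewrite sxE; exact: (@psXn_uniq (ps C)). Qed.
Lemma yn_uniq m n f g : sy ^+ m * f = sy ^+ n * g -> yfree f -> yfree g -> m = n /\ f = g.
Proof.
move=> /(congr1 swap); rewrite !swapM !swapX swap_sy => /xn_uniq E fy gy.
by have [-> /swap_inj] := E fy gy.
Qed.

(** The homogeneous part of degree d, dehomogenized by x = 1.  It turns the
    blow-up into the substitution of y + t for y, degree by degree. *)
Definition hom_part f d : {poly C} := \poly_(j < d.+1) f (d - j)%N j.

Lemma coef_hom_part f d j : (hom_part f d)`_j = if (j <= d)%N then f (d - j)%N j else 0.
Proof. by rewrite coef_poly ltnS. Qed.
Lemma size_hom_part f d : (size (hom_part f d) <= d.+1)%N.
Proof. exact: size_poly. Qed.
Lemma hom_part_inj f g : hom_part f =1 hom_part g -> f = g.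
Proof.
move=> fg; apply: serP => i j; have := congr1 (fun p : {poly C} => p`_j) (fg (i + j)%N).
by rewrite !coef_hom_part leq_addl addnK.
Qed.

(** Taking homogeneous parts is graded-multiplicative; this is what makes the
    blow-up of series a ring morphism. *)
Lemma hom_partM f g d : hom_part (f * g) d = \sum_(k < d.+1) hom_part f k * hom_part g (d - k)%N.
Proof.
apply/polyP => j; rewrite coef_hom_part coef_sum.
under [RHS]eq_bigr do rewrite coefM.
rewrite exchange_big /=; case: leqP => jd; last first.
  rewrite big1 // => l _; rewrite big1 // => k _; rewrite !coef_hom_part.
  case: leqP => lk; last by rewrite mul0r.
  by rewrite ifF ?mulr0 //; have := ltn_ord l; have := ltn_ord k; lia.
rewrite ser_coefM exchange_big /=; apply: eq_bigr => -[l /= lj] _.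
rewrite -(big_mkord xpredT (fun k => f k l * g (d - j - k)%N (j - l)%N)).
rewrite -(big_mkord xpredT (fun k => (hom_part f k)`_l * (hom_part g (d - k)%N)`_(j - l))).
rewrite (@big_cat_nat _ _ _ l 0 d.+1) //=; last by lia.
rewrite [X in _ = X + _]big_nat_cond [X in _ = X + _]big1 ?add0r; last first.
  by move=> k /andP[kl _]; rewrite coef_hom_part ifF ?mul0r //; lia.
rewrite (@big_cat_nat _ _ _ (d - j + l).+1 l d.+1) //=; [|lia..].
rewrite [X in _ = _ + X]big_nat_cond [X in _ = _ + X]big1 ?addr0; last first.
  by move=> k /andP[kl _]; rewrite [X in _ * X]coef_hom_part ifF ?mulr0 //; lia.
rewrite -[index_iota l _]/(index_iota (0 + l) _) big_addn.
have -> : ((d - j + l).+1 - l = (d - j).+1)%N by lia.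
apply: eq_big_nat => k kd; rewrite !coef_hom_part !ifT; [|lia..].
by congr (f _ _ * g _ _); lia.
Qed.


(** The row of degree k in x of a pull-back only involves the homogeneous part of
    degree k. *)
Lemma pullbackE t f k : pullback (Some t) f k = ofpoly (hom_part f k \Po ('X + t%:P)).
Proof.
apply: psP => l; rewrite /ofpoly (@coef_taylor _ _ k.+1) ?size_hom_part //=.
apply: eq_bigr => -[j /= jk] _.
by rewrite coef_hom_part -ltnS jk.
Qed.

Lemma pullbackN f : pullback None f = swap (pullback (Some 0) (swap f)).
Proof.
apply: serP => k l; rewrite /swap /pullback; case: leqP => kl; last first.
  rewrite big1 // => -[j /= jk] _; rewrite bin_small ?mulr0n //; lia.
have kl' : (k < l.+1)%N by [].
rewrite (bigD1 (Ordinal kl')) //= subnn expr0 mulr1 binn big1 ?addr0 // => -[j /= jl].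
rewrite -val_eqE /= => jk; case: (ltngtP j k) jk => // jk _.
  by rewrite bin_small.
by rewrite expr0n subn_eq0 leqNgt jk /= mulr0 mul0rn.
Qed.

Lemma pullbackM t f g : pullback t (f * g) = pullback t f * pullback t g.
Proof.
wlog: t f g / exists c, t = Some c.
  case: t => [c|]; first by move=> H; apply: H; exists c.
  by move=> H; rewrite !pullbackN swapM (H (Some 0)) ?swapM; last by exists 0.
case=> c -> {t}; apply: (@psP (ps C)) => d.
rewrite -[RHS]/(row_of _ d) serME /row_of pullbackE hom_partM raddf_sum raddf_sum.
by apply: eq_bigr => k _; rewrite !pullbackE -rmorphM -comp_polyM.
Qed.
Lemma pullback1 t : pullback t (1 : S) = 1.
Proof.
have H c : pullback (Some c) (1 : S) = 1.
  apply: (@psP (ps C)) => d; rewrite pullbackE.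
  have -> : hom_part (1 : S) d = ((d == 0)%:R)%:P.
    apply/polyP => j; rewrite coef_hom_part coefC; case: d j => [|d] [|j] //=.
    by case: (d.+1 - j.+1)%N; case: leqP.
  by rewrite comp_polyC; case: d => [|d] /=; rewrite ?rmorph1 ?rmorph0.
by case: t => [c|]; [exact: H | rewrite pullbackN swap1 H swap1].
Qed.
Lemma pullbackX t f n : pullback t (f ^+ n) = pullback t f ^+ n.
Proof. by elim: n => [|n IH]; rewrite ?pullback1 // !exprS pullbackM IH. Qed.
Lemma pullback_inj (t : direction R) : injective (pullback t).
Proof.
have H (c : C) : injective (pullback (Some c)).
  move=> f g fg; apply: hom_part_inj => d; have := congr1 (fun h : S => row_of h d) fg.
  rewrite /row_of !pullbackE => E.
  have : hom_part f d \Po ('X + c%:P) = hom_part g d \Po ('X + c%:P).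
    by apply/polyP => l; exact: (congr1 (fun r : ps C => r l) E).
  by move/(congr1 (fun p => p \Po ('X - c%:P))); rewrite !comp_polyXaddC_K.
case: t => [c|]; first exact: H.
by move=> f g; rewrite !pullbackN => /swap_inj /H /swap_inj.
Qed.
Lemma pullback00 t f : pullback t f 0%N 0%N = f 0%N 0%N.
Proof. by case: t => [c|//]; rewrite /= big_ord1 subnn expr0 mulr1 bin0. Qed.
Lemma sunit_pullback t f : sunit (pullback t f) = sunit f.
Proof. by rewrite /sunit pullback00. Qed.

End Series.

(** * Descent of local factorizations *)

Section Weierstrass.
Variable R : realType.
Local Notation C := R[i].
Local Notation S := (series R).
Implicit Types (f g h F W K : S).

Lemma row0M f g : row_of (f * g) 0 = row_of f 0 * row_of g 0.
Proof. by rewrite serME big_ord1. Qed.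

(** Weierstrass preparation, by induction on the degree in x: once the rows of u
    below i are known, the row i of u can be chosen to cancel the part of degree at
    least p in y of the row i of h u. *)
Lemma weierstrass h p : h 0%N p != 0 -> (forall j, (j < p)%N -> h 0%N j = 0) ->
  exists2 u, sunit u &
    row_of (h * u) 0 = psX C ^+ p /\
    forall i j, (0 < i)%N -> (p <= j)%N -> (h * u) i j = 0.
Proof.
move=> hp0 hlt; have E0 : row_of h 0 = psX C ^+ p * shift p (row_of h 0) := ps_shift hlt.
set v := shift p (row_of h 0) in E0.
have [|w vw] := @ps_unit_inv C v; first by rewrite /v /shift addn0.
(* The row 0 of u is the inverse of v; each later row cancels the tail of the
   convolution of the rows of h and the earlier rows of u. *)
pose Phi n (s : nat -> ps C) : ps C := if n is 0 then w else
  - w * shift p (\sum_(k < n) row_of h k.+1 * s (n - k.+1)%N).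
have [n s s' ss|u uE] := @strong_rec (ps C) 0 Phi.
  case: n ss => // n ss; congr (_ * shift _ _); apply: eq_bigr => k _.
  by rewrite ss // ltn_subrL.
have u0 : u 0%N = w by rewrite uE.
exists (u : S).
  by rewrite /sunit u0; have := ps_unit0 vw; case: eqP => // ->; rewrite mulr0 => /esym/eqP;
    rewrite oner_eq0.
split; first by rewrite row0M {1}E0 /row_of u0 -mulrA vw mulr1.
move=> [//|i] j _ pj; rewrite -[LHS]/(row_of (h * u) i.+1 j) serME big_ord_recl subn0.
set r := (X in _ + X).
have -> : r = \sum_(k < i.+1) row_of h k.+1 * u (i.+1 - k.+1)%N by [].
have -> : row_of u i.+1 = - w * shift p r by rewrite /row_of uE.
have -> : row_of h 0 * (- w * shift p r) = - (psX C ^+ p * shift p r).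
  by rewrite E0 mulNr mulrN mulrA -(mulrA _ v) vw mulr1.
rewrite ps_coefD ps_coefN psXnM ltnNge pj /=.
by rewrite /shift subnKC // addNr.
Qed.

(** The rows of x^(-a) times a pull-back of a series of multiplicity at least a are
    polynomials in y of degree at most a + i; [blow_up_of] is the converse. *)
Definition deg_bound a F := forall i j, (a + i < j)%N -> F i j = 0.

Lemma blow_up_of t p W : deg_bound p W ->
  exists H, pullback (Some t) H = sx R ^+ p * W /\ ((0 < p)%N -> ~~ sunit H).
Proof.
move=> dW; pose q d := \poly_(l < d.+1) W (d - p)%N l \Po ('X + (- t)%:P).
pose H : S := fun i j => if (i + j < p)%N then 0 else (q (i + j)%N)`_j.
have sq d : (size (q d) <= d.+1)%N.
  by rewrite /q size_comp_poly2 ?size_XaddC // size_poly.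
have hpH d : hom_part H d = if (d < p)%N then 0 else q d.
  apply/polyP => j; rewrite coef_hom_part; case: (leqP j d) => jd.
    by rewrite /H subnK //; case: (d < p)%N; rewrite ?coef0.
  by case: (d < p)%N; rewrite ?coef0 // nth_default // (leq_trans (sq d)).
exists H; split; last by move=> p0; rewrite /sunit /H p0 eqxx.
apply: serP => d j; rewrite pullbackE hpH sxnM; case: ltnP => pd.
  by rewrite comp_poly0l /ofpoly coef0.
have -> : 'X + t%:P = 'X - (- t)%:P by rewrite rmorphN opprK.
rewrite /q comp_polyXaddC_K /ofpoly coef_poly; case: ltnP => // dj.
by rewrite dW //; lia.
Qed.

(** The factor h is normalized to a Weierstrass polynomial W of degree p in y, which
    satisfies the degree bound p.  Division by W, whose row 0 is y^p, preserves
    polynomial rows and lowers the bound by p, so the other factor K satisfies the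
    bound a - p.  Both factors are then pull-backs, and f itself factors. *)
Lemma pushdown f t a F h k p : irr f -> pullback (Some t) f = sx R ^+ a * F ->
  deg_bound a F -> xfree F -> F = h * k ->
  h 0%N p != 0 -> (forall j, (j < p)%N -> h 0%N j = 0) -> p = 0%N \/ p = a.
Proof.
move=> [nf fac] fF dF xF Fhk hp0 hlt.
have [u uu [W0 Wi]] := weierstrass hp0 hlt.
have [u' uu' su'] := sunit_inv uu.
set W := h * u in W0 Wi; pose K := u' * k.
have FWK : F = W * K by rewrite /K mulrA -(mulrA h) uu' mulr1.
have [q Kq Klt] : exists2 m, K 0%N m != 0 & forall j, (j < m)%N -> K 0%N j = 0.
  apply: ps_neq0P => K0; apply: xF; rewrite FWK row0M.
  by rewrite [row_of K 0]K0 mulr0.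
have pqa : (p + q <= a)%N.
  rewrite leqNgt; apply/negP => apq; move: Kq.
  have : F 0%N (p + q)%N = 0 by rewrite dF // addn0.
  rewrite -[F 0%N _]/(row_of F 0 _) FWK row0M W0 psXnM ltnNge leq_addr /= addKn.
  by rewrite /row_of => ->; rewrite eqxx.
(* In the coefficient of y^(j + p) of the row i of F = W K, the rows of W after the
   first only contribute coefficients of K that vanish by induction. *)
have dK : deg_bound (a - p) K.
  move=> i; elim/ltn_ind: i => i IH j aij.
  have : row_of F i (j + p)%N = 0 by rewrite /row_of dF //; lia.
  rewrite FWK serME big_ord_recl subn0 ps_coefD ps_sumE W0 psXnM ifF ?addnK; last by lia.
  rewrite big1 ?addr0 // => -[l /= li] _; rewrite ps_coefM big1 // => -[s /= sj] _.
  rewrite /bump /= add1n; case: (ltnP s p) => sp; last by rewrite /row_of Wi ?mul0r.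
  by rewrite [X in _ * X]IH ?mulr0 //; lia.
have dW : deg_bound p W.
  move=> [|i] j pj; last by rewrite Wi //; lia.
  by rewrite -[LHS]/(row_of W 0 j) W0 psXnE gtn_eqF //; lia.
have [H [HW nH]] := blow_up_of t dW; have [H' [HK nH']] := blow_up_of t dK.
have fHH : f = H * H'.
  apply: (@pullback_inj _ (Some t)); rewrite pullbackM HW HK fF FWK [RHS]mulrACA -exprD.
  by congr (_ ^+ _ * _); lia.
have := fac _ _ fHH; case: (posnP p) => [->|p0]; first by left.
rewrite (negbTE (nH p0)) /= => uH'; right; case: (ltnP p a) => pa; last by lia.
by move: uH'; rewrite (negbTE (nH' _)) // subn_gt0.
Qed.

Definition has_mult f m := (forall i j, (i + j < m)%N -> f i j = 0) /\ hom_part f m != 0.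

Lemma has_mult_ex f : f <> 0 -> exists m, has_mult f m.
Proof.
move=> f0; pose H : ps {poly C} := hom_part f.
have [E|m Hm lt] := @ps_neq0P _ H.
  by apply: f0; apply: hom_part_inj => d; have ->
    : hom_part f d = 0 := congr1 (fun h : ps {poly C} => h d) E; apply/polyP=> j;
      rewrite coef_hom_part if_same coef0.
exists m; split=> // i j /lt /(congr1 (fun p : {poly C} => p`_j)).
by rewrite /H coef_hom_part leq_addl addnK coef0.
Qed.


Lemma has_mult_swap f m : has_mult f m -> has_mult (swap f) m.
Proof.
move=> [lt fm]; split=> [i j ij|]; first by rewrite /swap lt // addnC.
apply: contraNneq fm => E; apply/eqP/polyP => j; rewrite coef0 coef_hom_part.
case: leqP => // jm; have := congr1 (fun p : {poly C} => p`_(m - j)) E.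
by rewrite coef0 coef_hom_part leq_subr /swap subKn.
Qed.

Lemma has_mult_gt0 f m : has_mult f m -> ~~ sunit f -> (0 < m)%N.
Proof.
case: m => // -[_]; rewrite /sunit negbK; move=> E /eqP f0; case/eqP: E.
by apply/polyP => -[|j]; rewrite coef_hom_part //= coef0 ?f0.
Qed.

(** The pull-back in direction t divided by x^m, to be used when m is the
    multiplicity of f. *)
Definition strict_at t m f : S := fun i => pullback (Some t) f (m + i)%N.

Lemma pullback_strict_at t m f : has_mult f m ->
  pullback (Some t) f = sx R ^+ m * strict_at t m f.
Proof.
move=> [lt _]; apply: serP => i j; rewrite sxnM; case: ltnP => im; last
  by rewrite /strict_at subnKC.
rewrite pullbackE; have -> : hom_part f i = 0.
  by apply/polyP => l; rewrite coef_hom_part coef0; case: leqP => // li; rewrite lt ?subnK.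
by rewrite comp_poly0l /ofpoly coef0.
Qed.

Lemma deg_bound_strict_at t m f : deg_bound m (strict_at t m f).
Proof.
move=> i j mij; rewrite /strict_at pullbackE /ofpoly nth_default //.
by rewrite size_comp_poly2 ?size_XaddC // (leq_trans (size_hom_part _ _)).
Qed.

Lemma row0_strict_at t m f : row_of (strict_at t m f) 0 = ofpoly (hom_part f m \Po ('X + t%:P)).
Proof. by rewrite /row_of /strict_at addn0 pullbackE. Qed.

Lemma xfree_strict_at t m f : has_mult f m -> xfree (strict_at t m f).
Proof.
move=> [_ fm]; rewrite /xfree row0_strict_at => E; case/negP: fm.
rewrite -(@comp_poly2_eq0 _ _ ('X + t%:P)) ?size_XaddC //.
by apply/eqP/polyP => j; rewrite coef0; exact: (congr1 (fun r : ps C => r j) E).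
Qed.

(** Descent is used twice: for the trivial factorization, which forces the initial
    form of f to be a pure power, and for an arbitrary one, which gives the
    irreducibility of the strict transform. *)
Lemma strict_vanish f t m : irr f -> has_mult f m -> strict_at t m f 0%N 0%N = 0 ->
  irr (strict_at t m f) /\ hom_part f m = (f 0%N m) *: ('X - t%:P) ^+ m /\ f 0%N m != 0.
Proof.
move=> ir mu v0; set F := strict_at t m f.
have m0 := has_mult_gt0 mu (proj1 ir).
have fF := pullback_strict_at t mu; have dF := @deg_bound_strict_at t m f;
  have xF := @xfree_strict_at t m f mu.
have [p Fp Flt] := ps_neq0P xF.
have pm : p = m.
  case: (@pushdown f t m F F 1 p) => //; first by rewrite mulr1.
  by move=> p0; move: Fp; rewrite p0 /row_of v0 eqxx.
subst p; split; [split|].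
- by rewrite /sunit /F v0 eqxx.
- move=> h k Fhk.
  have [|q hq hlt] := @ps_neq0P _ (row_of h 0).
    by move=> h0; apply: xF; rewrite -/F Fhk row0M h0 mul0r.
  have [|r kr klt] := @ps_neq0P _ (row_of k 0).
    by move=> k0; apply: xF; rewrite -/F Fhk row0M k0 mulr0.
  case: (@pushdown f t m F h k q) => // [q0|qm].
    by rewrite /sunit; move: hq; rewrite q0 /row_of => ->.
  apply/orP; right; suff r0 : r = 0%N by rewrite r0 in kr.
  apply/eqP; rewrite -leqn0 leqNgt; apply/negP => r0; case/negP: kr.
  have := @dF 0%N (q + r)%N; rewrite addn0 -/F => E.
  have FE : F 0%N (q + r)%N = row_of h 0 q * row_of k 0 r.
    rewrite -[F 0%N _]/(row_of F 0 _) Fhk row0M {1}(ps_shift hlt) {1}(ps_shift klt).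
    by rewrite mulrACA -exprD psXnM ltnn subnn psM0E /shift !addn0.
  have /eqP := E ltac:(lia); rewrite FE mulf_eq0 => /orP[] // h0.
  by rewrite h0 in hq.
- have cF : hom_part f m \Po ('X + t%:P) = (row_of F 0 m) *: 'X^m.
    apply/polyP => j; rewrite coefZ coefXn.
    have -> : (hom_part f m \Po ('X + t%:P))`_j = row_of F 0 j by rewrite row0_strict_at.
    case: (ltngtP j m) => [jm|jm|->]; last by rewrite mulr1.
      by rewrite /F Flt ?mulr0.
    by rewrite /F /row_of dF ?addn0 ?mulr0.
  have cE : hom_part f m = row_of F 0 m *: ('X - t%:P) ^+ m.
    have := congr1 (fun p => p \Po ('X - t%:P)) cF.
    by rewrite comp_polyXaddC_K comp_polyZ comp_Xn_poly.
  have lc : f 0%N m = row_of F 0 m.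
    have := congr1 (fun p : {poly C} => p`_m) cE.
    rewrite coef_hom_part leqnn subnn => ->; rewrite coefZ.
    suff -> : (('X - t%:P) ^+ m)`_m = 1 by rewrite mulr1.
    have := monic_exp m (monicXsubC t); rewrite monicE lead_coefE.
    by rewrite size_exp_XsubC => /eqP.
  by rewrite lc.
Qed.
End Weierstrass.

(** * The unique tangent of an irreducible germ *)

Section Strict.
Variable R : realType.
Local Notation C := R[i].
Local Notation S := (series R).
Implicit Types (f g h : S) (t : direction R).

(** Not divisible by the equation of the exceptional curve in the chart t. *)
Definition excfree t f := if t is Some _ then xfree f else yfree f.

Lemma exc_dvdP t f : ps_dvd (exc_eq t) f <-> ~ excfree t f.
Proof. by rewrite ps_dvdE; case: t => [c|] /=; [exact: xdvdP|exact: ydvdP]. Qed.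

Lemma excfreeP t f : ~ ps_dvd (exc_eq t) f <-> excfree t f.
Proof. by rewrite exc_dvdP; split=> [/contrapT|? ?]. Qed.

Lemma exc_uniq t m n f g : exc_eq t ^+ m * f = exc_eq t ^+ n * g ->
  excfree t f -> excfree t g -> m = n /\ f = g.
Proof. by case: t => [c|]; [exact: xn_uniq|exact: yn_uniq]. Qed.


Lemma sunit_excfree t f : sunit f -> excfree t f.
Proof. by case: t => [c|]; [exact: sunit_xfree|exact: sunit_yfree]. Qed.

Lemma strict1E t g h n : excfree t h -> pullback t g = exc_eq t ^+ n * h -> strict1 t g = h.
Proof.
move=> fh gh; rewrite /strict1; apply: xget_subset1.
  by split; [exact/excfreeP | exists n; rewrite ps_expE ps_mulE].
move=> k k' [/excfreeP fk [i gk]] [/excfreeP fk' [i' gk']].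
rewrite ps_expE ps_mulE in gk; rewrite ps_expE ps_mulE in gk'.
by have [] := exc_uniq (etrans (esym gk) gk') fk fk'.
Qed.

Definition strict_dir t m f : S :=
  if t is Some c then strict_at c m f else swap (strict_at 0 m (swap f)).

Lemma pullback_strict_dir t m f : has_mult f m ->
  pullback t f = exc_eq t ^+ m * strict_dir t m f.
Proof.
case: t => [c|] mu; first exact: pullback_strict_at.
by rewrite pullbackN (pullback_strict_at 0 (has_mult_swap mu)) swapM swapX swap_sx.
Qed.
Lemma excfree_strict_dir t m f : has_mult f m -> excfree t (strict_dir t m f).
Proof.
case: t => [c|] mu; first exact: xfree_strict_at.
by rewrite /= /yfree swapK; apply: xfree_strict_at; apply: has_mult_swap.
Qed.
Lemma strict1_dir t m f : has_mult f m -> strict1 t f = strict_dir t m f.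
Proof. by move=> mu; apply: strict1E (pullback_strict_dir t mu); apply: excfree_strict_dir. Qed.

Lemma strict1_sunit t f : sunit f -> strict1 t f = pullback t f.
Proof.
move=> uf; apply: (@strict1E _ _ _ 0); last by rewrite expr0 mul1r.
by apply: sunit_excfree; rewrite sunit_pullback.
Qed.
Lemma strict11 t : strict1 t (1 : S) = 1.
Proof. by rewrite strict1_sunit ?sunit1 // pullback1. Qed.

Lemma pullback_x_Some c : pullback (Some c) (sx R) = sx R.
Proof.
apply: (@psP (ps C)) => d; rewrite pullbackE.
have -> : hom_part (sx R) d = ((d == 1)%:R)%:P.
  apply/polyP => j; rewrite coef_hom_part coefC /sx /ps_x /ps_monom.
  case: j => [|j]; first by rewrite leq0n subn0 andbT.
  by rewrite andbF if_same.
rewrite comp_polyC; apply: psP => j; rewrite /ofpoly coefC /sx /ps_x /ps_monom.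
by case: j => [|j]; rewrite ?andbT ?andbF.
Qed.

Lemma hom_part_y d : hom_part (sy R) d = if d == 1%N then 'X else 0.
Proof.
apply/polyP => j; rewrite coef_hom_part /sy /ps_y /ps_monom.
case: d => [|[|d]] /=; rewrite ?coef0 ?coefX; case: j => [|[|j]] //=.
by rewrite andbF if_same.
Qed.

(** The old axis y = 0 survives only in the direction 0: elsewhere its strict
    transform is a unit. *)
Lemma pullback_y_Some c : exists w, pullback (Some c) (sy R) = sx R * w /\
  (if c == 0 then w = sy R else sunit w).
Proof.
exists (fun i j => if i == 0%N then ('X + c%:P : {poly C})`_j else 0); split.
  apply: (@psP (ps C)) => d; rewrite pullbackE hom_part_y.
  apply: psP => j; rewrite -[sx R]expr1 sxnM /ofpoly.
  case: d => [|[|d]] /=; rewrite ?comp_poly0l ?coef0 //.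
  by rewrite comp_polyX.
case: eqP => [->|/eqP c0]; last by rewrite /sunit /= coefD coefX coefC add0r.
by apply: serP => -[|i] [|[|j]]; rewrite /= ?addr0 ?coefX.
Qed.

Lemma pullback_x_None : pullback None (sx R) = sx R * sy R.
Proof.
have [w [E]] := pullback_y_Some 0; rewrite eqxx => w0.
by rewrite pullbackN swap_sx E w0 swapM swap_sx swap_sy mulrC.
Qed.
Lemma pullback_y_None : pullback None (sy R) = sy R.
Proof. by rewrite pullbackN swap_sy pullback_x_Some swap_sx. Qed.

(** The intersection number at the origin of g = 0 with the axis x = 0. *)
Definition meets_x g a := (forall j, (j < a)%N -> g 0%N j = 0) /\ g 0%N a != 0.
Definition meets_y g b := meets_x (swap g) b.

Lemma meets_x_uniq g a b : meets_x g a -> meets_x g b -> a = b.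
Proof.
move=> [la na] [lb nb]; case: (ltngtP a b) => // ab.
  by rewrite lb ?eqxx in na.
by rewrite la ?eqxx in nb.
Qed.
Lemma meets_y_uniq g a b : meets_y g a -> meets_y g b -> a = b.
Proof. exact: meets_x_uniq. Qed.

Lemma strict_at00 c m f : strict_at c m f 0%N 0%N = (hom_part f m).[c].
Proof.
rewrite -[LHS]/(row_of (strict_at c m f) 0 0) row0_strict_at /ofpoly -horner_coef0 horner_comp.
by rewrite hornerD hornerX hornerC add0r.
Qed.

(** One step of the Euclidean algorithm on the intersection numbers with the
    axes: m is the multiplicity of f and t its tangent direction. *)
Definition tangent_data f m t :=
  let f1 := strict1 t f in
  match t with
  | Some c => [/\ meets_x f m, meets_x f1 m &
      if c == 0 then forall b, meets_y f b -> (m < b)%N /\ meets_y f1 (b - m) else meets_y f m]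
  | None => [/\ meets_y f m, meets_y f1 m & forall a, meets_x f a -> (m < a)%N /\
    meets_x f1 (a - m)]
  end.

Lemma tangent_Some f m c : irr f -> has_mult f m -> strict_at c m f 0%N 0%N = 0 ->
  [/\ irr (strict_at c m f), f 0%N m != 0, forall c', strict_at c' m f 0%N 0%N = 0 -> c' = c &
      tangent_data f m (Some c)].
Proof.
move=> ir mu v0; have [ir1 [hE n0]] := strict_vanish ir mu v0.
split=> //.
  move=> c'; rewrite strict_at00 hE hornerZ horner_exp hornerXsubC => /eqP.
  by rewrite mulf_eq0 (negbTE n0) expf_eq0 subr_eq0 => /andP[_ /eqP].
rewrite /tangent_data (strict1_dir _ mu) /=; split.
- split=> // j jm; have [lt _] := mu; exact: lt.
- have R0 j : strict_at c m f 0%N j = (f 0%N m *: 'X^m)`_j.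
    rewrite -[LHS]/(row_of (strict_at c m f) 0 j) row0_strict_at hE /ofpoly.
    rewrite comp_polyZ rmorphXn /= comp_polyB comp_polyX comp_polyC addrK.
    by [].
  split=> [j jm|]; rewrite R0 coefZ coefXn ?eqxx ?mulr1 //.
  by rewrite ltn_eqF ?mulr0.
- have fm0 : (hom_part f m)`_0 = f m 0%N by rewrite coef_hom_part subn0.
  case: (eqVneq c 0) => [c0|c0]; last first.
    split=> [j jm|]; rewrite /swap; first by have [lt _] := mu; apply: lt; rewrite addn0.
    rewrite -fm0 hE coefZ mulf_neq0 // -horner_coef0 horner_exp hornerXsubC.
    by rewrite expf_neq0 // sub0r oppr_eq0.
  move=> b [lb nb]; have f1 i : strict_at c m f i 0%N = f (m + i)%N 0%N.
    rewrite /strict_at pullbackE /ofpoly c0 addr0 comp_polyXr coef_hom_part //.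
    by rewrite leq0n subn0.
  have mb : (m < b)%N.
    rewrite ltnNge; apply/negP => bm; move: nb; rewrite /swap.
    move: bm; rewrite leq_eqVlt => /orP[/eqP->|bm].
      by have := f1 0%N; rewrite addn0 v0 => <-; rewrite eqxx.
    by have [lt _] := mu; rewrite lt ?addn0 // eqxx.
  split=> //; split=> [j jb|]; rewrite /swap f1; last by rewrite subnKC // ltnW.
  by apply: lb; lia.
Qed.

(** If no finite direction is a root of the initial form, this form is a
    constant multiple of x^m and the direction is x = 0. *)
Lemma tangent_ex f m : irr f -> has_mult f m ->
  exists t, [/\ irr (strict1 t f), tangent_data f m t &
    forall t', strict1 t' f 0%N 0%N = 0 <-> t' = t].
Proof.
move=> ir mu; have mus := has_mult_swap mu.
have None00 : strict1 None f 0%N 0%N = f 0%N m.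
  rewrite (strict1_dir _ mu) /= /swap strict_at00 -/(swap f) horner_coef0 coef_hom_part subn0.
  by [].
case: (pselect (exists c, strict_at c m f 0%N 0%N = 0)) => [[c v0]|nv].
  have [ir1 n0 uq td] := tangent_Some ir mu v0.
  exists (Some c); split=> //; first by rewrite (strict1_dir _ mu).
  move=> [c'|]; rewrite ?None00; last by split=> // E; rewrite E eqxx in n0.
  rewrite (strict1_dir _ mu) /=; split=> [/uq->//|[->]//].
have v0 : strict_at 0 m (swap f) 0%N 0%N = 0.
  rewrite strict_at00 horner_coef0 coef_hom_part subn0 leq0n /swap.
  have : size (hom_part f m) == 1%N.
    apply/negPn/negP => /closed_rootP[c /eqP rc]; apply: nv; exists c.
    by rewrite strict_at00.
  move/eqP => s1; have : (hom_part f m)`_m = 0.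
    by rewrite nth_default // s1 (has_mult_gt0 mu (proj1 ir)).
  by rewrite coef_hom_part leqnn subnn.
have [ir1 n0 uq [td1 td2]] := tangent_Some (irr_swap ir) mus v0.
rewrite eqxx => td3.
have sE : strict1 (Some 0) (swap f) = swap (strict1 None f).
  by rewrite (strict1_dir _ mu) (strict1_dir _ mus).
exists None; split=> //.
- by rewrite (strict1_dir _ mu); apply: irr_swap.
- by split=> //; [rewrite sE in td2 | rewrite sE in td3].
- move=> [c|]; last by split=> // _; rewrite (strict1_dir _ mu).
  by rewrite (strict1_dir _ mu) /=; split=> // E; case: nv; exists c.
Qed.

End Strict.


(** * Finiteness of the chains of free points *)

Section Tschirnhaus.
Variable R : realType.
Local Notation C := R[i].
Local Notation S := (series R).
Local Notation A := (ps C).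
Implicit Types (p q : {poly A}) (c : C).

(** A polynomial in y with coefficients in C[[x]]. *)
Definition ypoly p : S := fun i j => p`_j i.
Lemma ypolyE p : ypoly p = swap (ofpoly p : S). Proof. by []. Qed.
Lemma ypolyM p q : ypoly (p * q) = ypoly p * ypoly q.
Proof. by rewrite !ypolyE rmorphM -swapM. Qed.
Lemma ypolyD p q : ypoly (p + q) = ypoly p + ypoly q.
Proof. by apply: serP => i j; rewrite /ypoly coefD. Qed.
Lemma ypoly1 : ypoly 1 = 1.
Proof. by rewrite ypolyE rmorph1; exact: swap1. Qed.
Lemma ypolyXn p n : ypoly (p ^+ n) = ypoly p ^+ n.
Proof. by elim: n => [|n IH]; rewrite ?ypoly1 // !exprS ypolyM IH. Qed.
Lemma ypoly_scale n p : ypoly ((psX C ^+ n) *: p) = sx R ^+ n * ypoly p.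
Proof.
by apply: serP => i j; rewrite sxnM /ypoly coefZ psXnM; case: ltnP.
Qed.
Lemma coef_bool (b : bool) i : (b%:R : A) i = (b && (i == 0%N))%:R.
Proof. by case: b; [exact: ps_coef1|]. Qed.
Lemma ypolyX : ypoly 'X = sy R.
Proof.
apply: serP => i j; rewrite /ypoly coefX coef_bool /sy /ps_y /ps_monom.
by rewrite andbC.
Qed.

Lemma pullbackD t (f g : S) : pullback t (f + g) = pullback t f + pullback t g.
Proof.
have H c (f' g' : S) : pullback (Some c) (f' + g') = pullback (Some c) f' + pullback (Some c) g'.
  apply: serP => k l;
    rewrite -[RHS]/(pullback (Some c) f' k l + pullback (Some c) g' k l) /= -big_split /=.
  by apply: eq_bigr => j _; rewrite -mulrnDl -mulrDl.
case: t => [c|]; first exact: H.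
by rewrite !pullbackN -[swap (f + g)]/(swap f + swap g) H.
Qed.

Lemma pullback_ypoly c p : pullback (Some c) (ypoly p) = ypoly (p \Po (psX C *: ('X + (ps_const c)%:P))).
Proof.
set q := _ *: _.
have pc a : pullback (Some c) (ypoly a%:P) = ypoly a%:P.
  apply: (@psP (ps C)) => d; rewrite pullbackE.
  have -> : hom_part (ypoly a%:P) d = (a d)%:P.
    apply/polyP => j; rewrite coef_hom_part coefC /ypoly coefC.
    by case: j => [|j]; rewrite ?subn0 //= if_same.
  by rewrite comp_polyC; apply: psP => j; rewrite /ofpoly /ypoly !coefC; case: ifP.
have py : pullback (Some c) (sy R) = ypoly q.
  apply: (@psP (ps C)) => d; rewrite pullbackE hom_part_y.
  apply: psP => j; rewrite /ypoly /q /ofpoly coefZ psXM coefD coefX coefC.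
  case: d => [|[|d]] /=; rewrite ?comp_poly0l ?coef0 //.
    rewrite comp_polyX coefD coefX coefC ps_coefD.
    by case: j => [|[|j]]; rewrite ?ps_coefN.
  by rewrite ps_coefD; case: j => [|[|j]]; rewrite /= /ps_const ?ps_coef0 ?ps_coef1 /= ?addr0.
elim/poly_ind: p => [|p a IH].
  by rewrite comp_poly0l -(polyC0 A) pc.
by rewrite comp_poly_MXaddC !ypolyD pullbackD pc !ypolyM pullbackM IH ypolyX py.
Qed.

(** The substitution multiplies the leading coefficient of a Weierstrass polynomial
    of degree a by x^a, so dividing the pull-back by x^a makes it monic again. *)
Lemma wpoly_step (g g' u : S) (p : {poly A}) c a :
  pullback (Some c) g = sx R ^+ a * g' -> sunit u -> g * u = ypoly p ->
  (size p <= a.+1)%N -> p`_a = 1 ->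
  exists p' u', [/\ sunit u', g' * u' = ypoly p', (size p' <= a.+1)%N, p'`_a = 1 &
    p \Po (psX C *: ('X + (ps_const c)%:P)) = psX C ^+ a *: p'].
Proof.
move=> gg uu gu sp pa; set q := p \Po _.
have sq : (size q <= a.+1)%N.
  by rewrite /q comp_scale_shift' size_taylor // (leq_trans (size_comp_scaleX _ _)).
have qa : q`_a = psX C ^+ a.
  rewrite /q comp_scale_shift' coef_taylor_top ?coef_comp_scaleX ?pa ?mul1r //.
  exact: leq_trans (size_comp_scaleX _ _) sp.
have E : ypoly q = sx R ^+ a * (g' * pullback (Some c) u).
  by rewrite mulrA -gg -pullbackM gu pullback_ypoly.
pose p' : {poly A} := \poly_(j < a.+1) shift a q`_j.
have qp' : q = psX C ^+ a *: p'.
  apply/polyP => j; rewrite coefZ coef_poly; case: ltnP => ja; last first.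
    by rewrite mulr0 nth_default // (leq_trans sq).
  apply: ps_shift => k ka.
  by have := congr1 (fun f : S => f k j) E; rewrite sxnM ka.
exists p', (pullback (Some c) u); split=> //.
- by rewrite sunit_pullback.
- by apply: (@sxn_inj _ a); rewrite -E qp' ypoly_scale.
- exact: size_poly.
- by have := qa; rewrite qp' coefZ -{2}[psX C ^+ a]mulr1 => /psXn_inj.
Qed.

(** The translation of y that kills the coefficient of y^(a-1) in a monic
    polynomial of degree a. *)
Definition tschirnhaus a p : A := - (p`_a.-1 * ps_const (a%:R^-1)).

Lemma tschirnhausE a p (r : A) : (0 < a)%N -> (size p <= a.+1)%N -> p`_a = 1 ->
  ((p \Po ('X + r%:P))`_a.-1 = 0) <-> r = tschirnhaus a p.
Proof.
case: a => // a _ sp pa; rewrite coef_taylor_subtop // pa mul1r /= /tschirnhaus /=.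
have inv : (a.+1%:R : A) * ps_const (a.+1%:R^-1) = 1.
  apply: psP => i; rewrite -[_%:R]/(1 *+ _) mulrnAl mul1r.
  have nE (f : A) n k : (f *+ n) k = f k *+ n.
    by elim: n => [|n IH]; rewrite ?mulr0n ?ps_coef0 // !mulrS ps_coefD IH.
  rewrite nE ps_coef1 /ps_const; case: eqP => _; last by rewrite mul0rn.
  by rewrite -[LHS]mulr_natl mulfV // pnatr_eq0.
split=> [E|->].
  have {E} E : r *+ a.+1 = - p`_a by apply/eqP; rewrite -addr_eq0 addrC E.
  by rewrite -[LHS]mulr1 -inv -mulNr -E mulrA mulr_natr.
by rewrite -mulr_natr mulNr -mulrA [ps_const _ * _]mulrC inv mulr1 subrr.
Qed.

(** Both transformations being affine in y, the blow-up carries the Tschirnhaus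
    translation of p to that of p': it is determined by the vanishing of one
    coefficient.  So the j-th coefficient is divided by x^(a-j). *)
Lemma tschirnhaus_step a c p p' : (0 < a)%N -> (size p <= a.+1)%N -> p`_a = 1 ->
  (size p' <= a.+1)%N -> p'`_a = 1 ->
  p \Po (psX C *: ('X + (ps_const c)%:P)) = psX C ^+ a *: p' ->
  forall j, (p \Po ('X + (tschirnhaus a p)%:P))`_j * psX C ^+ j =
            psX C ^+ a * (p' \Po ('X + (tschirnhaus a p')%:P))`_j.
Proof.
move=> a0 sp pa sp' pa' E; set s' := tschirnhaus a p'.
have E2 r : r = psX C * (s' + ps_const c) -> forall j,
    (p \Po ('X + r%:P))`_j * psX C ^+ j = psX C ^+ a * (p' \Po ('X + s'%:P))`_j.
  move=> rE j; rewrite -coef_comp_scaleX rE -comp_scale_shift -coefZ -comp_polyZ -E -comp_polyA.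
  by rewrite comp_polyZ comp_polyD comp_polyX comp_polyC polyCD addrA.
suff <- : psX C * (s' + ps_const c) = tschirnhaus a p by apply: E2.
apply/tschirnhausE => //; have /(tschirnhausE s' a0 sp' pa') s'0 : s' = tschirnhaus a p' by [].
apply: (@psXn_inj _ a.-1).
by have := E2 _ erefl a.-1; rewrite s'0 mulr0 mulrC => ->; rewrite mulr0.
Qed.

(** Each of n successive steps contributes a factor x^(a-j). *)
Lemma tschirnhaus_divisible (g : nat -> S) (t : nat -> C) a : (0 < a)%N ->
  (forall n, pullback (Some (t n)) (g n) = sx R ^+ a * g n.+1) ->
  forall n k u p, sunit u -> g k * u = ypoly p -> (size p <= a.+1)%N -> p`_a = 1 ->
  forall j, (j < a)%N -> exists d : A,
    (p \Po ('X + (tschirnhaus a p)%:P))`_j = psX C ^+ (n * (a - j)) * d.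
Proof.
move=> a0 step; elim=> [|n IH] k u p uu gu sp pa j ja.
  by eexists; rewrite mul0n expr0 mul1r.
have [p' [u' [uu' gu' sp' pa' E]]] := wpoly_step (step k) uu gu sp pa.
have [d dE] := IH k.+1 u' p' uu' gu' sp' pa' j ja.
exists d; apply: (@psXn_inj _ j); rewrite mulrC (tschirnhaus_step a0 sp pa sp' pa' E) dE.
by rewrite !mulrA -!exprD; congr (_ ^+ _ * _); lia.
Qed.

(** In the coordinate given by the Tschirnhaus translation all coefficients but the
    leading one are divisible by every power of x, hence zero, and the germ would be
    the a-th power of a smooth one up to a unit. *)
Lemma no_free_chain (g : nat -> S) (t : nat -> C) a : (1 < a)%N -> irr (g 0%N) ->
  meets_x (g 0%N) a ->
  (forall n, pullback (Some (t n)) (g n) = sx R ^+ a * g n.+1) -> False.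
Proof.
move=> a1 ir [lt na] step; have a0 := ltnW a1.
have [u uu [W0 Wi]] := weierstrass na lt.
pose p : {poly A} := \poly_(j < a.+1) ((fun i => (g 0%N * u) i j) : A).
have row0 j : (g 0%N * u) 0%N j = (j == a)%:R.
  by rewrite -[LHS]/(row_of (g 0%N * u) 0 j) W0 psXnE.
have sp : (size p <= a.+1)%N by exact: size_poly.
have pa : p`_a = 1.
  rewrite coef_poly ltnSn; apply: psP => -[|i]; first by rewrite row0 eqxx.
  by rewrite Wi // ps_coef1.
have gu : g 0%N * u = ypoly p.
  apply: serP => i j; rewrite /ypoly coef_poly; case: ltnP => // ja.
  case: i => [|i]; first by rewrite row0 gtn_eqF.
  by rewrite Wi // ltnW.
set s := tschirnhaus a p.
have pX : p \Po ('X + s%:P) = 'X^a.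
  apply/polyP => j; rewrite coefXn; case: (ltngtP j a) => ja.
  - apply: psP => k; have [d ->] := tschirnhaus_divisible a0 step k.+1 uu gu sp pa ja.
    by rewrite psXnM ifT //; nia.
  - by rewrite nth_default // (leq_trans (size_taylor _ sp)).
  - by rewrite ja coef_taylor_top.
have {pX} pE : p = ('X - s%:P) ^+ a.
  by rewrite -(comp_polyXaddC_K p s) pX comp_Xn_poly.
have [u' uu' su'] := sunit_inv uu.
have [nu fac] := ir; set l := ypoly ('X - s%:P).
have gE : g 0%N = l * (l ^+ a.-1 * u').
  by rewrite mulrA -exprS prednK // -ypolyXn -pE -gu -mulrA uu' mulr1.
have l0 : ~~ sunit l.
  by apply: contra nu => ul; rewrite gE !sunitM sunitX ?ul.
case/orP: (fac _ _ gE) => [|]; first by apply/negP.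
have -> : a.-1 = a.-2.+1 by lia.
by rewrite exprS !sunitM (negbTE l0).
Qed.
End Tschirnhaus.

(** * The Euclidean process and its graph *)

(** [Free A a]: the current point lies on the exceptional curve A only, where the
    strict transform has intersection number a.  [Sat A B a b]: it lies on A and
    on B, with intersection numbers a and b; after a rupture, A is the one on the side
    of the rupture curves. *)
Inductive state := Free of nat & nat | Sat of nat & nat & nat & nat.

Section Graph.
Implicit Types E : seq (nat * nat).

Definition preds (E : seq (nat * nat)) v := [seq e.1 | e <- E & e.2 == v].

Lemma predsP (E : seq (nat * nat)) v i : (i \in preds E v) = ((i, v) \in E).
Proof.
apply/mapP/idP => [[[i' v'] /=]|iv]; last by exists (i, v); rewrite // mem_filter eqxx.
by rewrite mem_filter /= => /andP[/eqP->] + ->.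
Qed.

Lemma preds_cons_ne E i k v : k <> v -> preds ((i, k) :: E) v = preds E v.
Proof. by move=> /eqP kv; rewrite /preds /= (negbTE kv). Qed.

Lemma preds_nil (E : seq (nat * nat)) v n : (forall i k, (i, k) \in E -> (k < n)%N) ->
  (n <= v)%N ->
  preds E v = [::].
Proof.
move=> H nv; case EE: (preds E v) => [//|i s].
have : i \in preds E v by rewrite EE inE eqxx.
by rewrite predsP => /H; lia.
Qed.

(** The exceptional curves through the current point. *)
Definition active st i := match st with
  | Free A _ => i = A | Sat A B _ _ => i = A \/ i = B end.

(** P holds for the curves through the current point. *)
Record core n (P : nat -> Prop) E : Prop := Core {
  edge_lt : forall i k, (i, k) \in E -> (i < k < n)%N;
  edge_fun : forall i k k', (i, k) \in E -> (i, k') \in E -> k = k';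
  active_open : forall i, P i -> (i < n)%N /\ forall k, (i, k) \notin E;
  inactive_closed : forall i, (i < n)%N -> ~ P i -> exists k, (i, k) \in E;
  preds_le2 : forall v, uniq (preds E v) /\ (size (preds E v) <= 2)%N }.

Lemma core_ext n (P Q : nat -> Prop) E : (forall i, P i <-> Q i) -> core n P E -> core n Q E.
Proof.
move=> PQ [H1 H2 H3 H4 H5]; split=> //; first by move=> i /PQ /H3.
by move=> i lin nQ; apply: H4 => // /PQ.
Qed.

Lemma core_new n P E : core n P E -> core n.+1 (fun i => P i \/ i = n) E.
Proof.
move=> [H1 H2 H3 H4 H5]; split=> //.
- by move=> i k /H1 /andP[-> /= /ltnW].
- move=> i [/H3[lin ?]|->]; first by split=> //; rewrite ltnS ltnW.
  by split=> // k; apply/negP => /H1; lia.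
- move=> i; rewrite ltnS leq_eqVlt => /orP[/eqP->|lin] nP; first by case: nP; right.
  by apply: H4 => // Pi; apply: nP; left.
Qed.

Lemma core_preds_new n P E : core n P E -> preds E n = [::].
Proof. by move=> [H1 _ _ _ _]; apply: (@preds_nil _ _ n) => // i k /H1 /andP[]. Qed.

Lemma core_edge n P E i : core n.+1 P E -> P i -> (i < n)%N -> (size (preds E n) <= 1)%N ->
  core n.+1 (fun j => P j /\ j <> i) ((i, n) :: E).
Proof.
move=> [H1 H2 H3 H4 H5] Pi lin sn; have [_ iE] := H3 _ Pi; split.
- by move=> j k; rewrite inE => /orP[/eqP[-> ->]|/H1//]; rewrite lin /=.
- move=> j k k'; rewrite !inE => /orP[/eqP[-> ->]|jk] /orP[/eqP|jk'].
  + by case.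
  + by rewrite (negbTE (iE _)) in jk'.
  + by move=> [ji _]; subst j; rewrite (negbTE (iE _)) in jk.
  + exact: H2 jk jk'.
- move=> j [/H3[jn jE] ji]; split=> // k; rewrite inE negb_or jE andbT.
  by apply/eqP => -[].
- move=> j jn nP; case: (eqVneq j i) => [->|/eqP ji]; first by exists n; rewrite inE eqxx.
  by have [|k jk] := H4 _ jn; [tauto | exists k; rewrite inE jk orbT].
- move=> v; case: (eqVneq n v) => [<-|/eqP nv]; last by rewrite preds_cons_ne.
  have [u _] := H5 n; rewrite /preds /= eqxx /= -/(preds E n); split=> //.
  by rewrite predsP iE.
Qed.

End Graph.

Section Run.
Variables N nu : nat -> nat.

(** The number of points blown up, the current point, and the list of the edges
    (i, k) of the dual graph that no later blow-up will subdivide: i passes through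
    p_k but not through p_(k+1).  The first curve has nu = 2; afterwards a curve that
    is missing at a free point counts as N = 0 and nu = 1. *)
Inductive run : nat -> state -> seq (nat * nat) -> Prop :=
| RunStart : (1 < N 0)%N -> nu 0 = 2%N -> run 1 (Free 0 (N 0)) [::]
| RunFree n A a E : run n (Free A a) E -> (1 < a)%N ->
    N n = (N A + a)%N -> nu n = (nu A + 1)%N ->
    run n.+1 (Free n a) ((A, n) :: E)
| RunTangent n A a b E : run n (Free A (a + b)) E -> (0 < a)%N -> (0 < b)%N ->
    N n = (N A + b)%N -> nu n = (nu A + 1)%N ->
    run n.+1 (Sat A n a b) E
| RunSatL n A B a b E : run n (Sat A B a (a + b)) E -> (0 < b)%N ->
    N n = (N A + N B + a)%N -> nu n = (nu A + nu B)%N ->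
    run n.+1 (Sat n B a b) ((A, n) :: E)
| RunSatR n A B a b E : run n (Sat A B (a + b) b) E -> (0 < a)%N ->
    N n = (N A + N B + b)%N -> nu n = (nu A + nu B)%N ->
    run n.+1 (Sat A n a b) ((B, n) :: E)
| RunRup n A B d E : run n (Sat A B d d) E ->
    N n = (N A + N B + d)%N -> nu n = (nu A + nu B)%N ->
    run n.+1 (Free n d) ((A, n) :: (B, n) :: E).

Definition alpha k : rat := (nu k)%:R / (N k)%:R.

Lemma alpha_lt i j : (0 < N i)%N -> (0 < N j)%N ->
  (alpha i < alpha j) = (nu i * N j < nu j * N i)%N.
Proof.
move=> Ni Nj; rewrite /alpha ltr_pdivrMr ?ltr0n // mulrAC ltr_pdivlMr ?ltr0n //.
by rewrite -!natrM ltr_nat.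
Qed.

Definition st_ok n st := match st with
  | Free A a => n = A.+1 /\ (0 < a)%N
  | Sat A B a b => [/\ A <> B, (0 < a)%N & (0 < b)%N] end.

Lemma run_shape n st E : run n st E -> core n (active st) E /\ st_ok n st.
Proof.
elim=> {n st E}.
- move=> N0 _; split; last by split=> //; apply: ltnW.
  split=> //= i; first by move=> ->.
  by rewrite ltnS leqn0 => /eqP.
- move=> n A a E _ [co [nA a0]] a1 _ _; split; last by [].
  have pn := core_preds_new co; subst n.
  apply: core_ext (core_edge (core_new co) _ _ _); rewrite ?pn //=; last by left.
  by move=> i /=; split; [tauto | move=> ->; split; [right|lia]].
- move=> n A a b E _ [co [nA a0']] a0 b0 _ _; subst n; split; last by split=> //; lia.
  exact: core_new co.
- move=> n A B a b E _ [co [AB a0 ab0]] b0 _ _.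
  have [An _] := active_open co (or_introl erefl);
    have [Bn _] := active_open co (or_intror erefl).
  split; last by split=> //; lia.
  have pn := core_preds_new co.
  apply: core_ext (core_edge (core_new co) _ An _); rewrite ?pn //=; last by left; left.
  move=> i; split; first by tauto.
  by move=> [->|->]; split; [right|lia|left; right|apply/nesym].
- move=> n A B a b E _ [co [AB a0 ab0]] b0 _ _.
  have [An _] := active_open co (or_introl erefl);
    have [Bn _] := active_open co (or_intror erefl).
  split; last by split=> //; lia.
  have pn := core_preds_new co.
  apply: core_ext (core_edge (core_new co) _ Bn _); rewrite ?pn //=; last by left; right.
  move=> i; split; first by tauto.
  by move=> [->|->]; split; [left; left| |right|lia].
- move=> n A B d E _ [co [AB d0 _]] _ _; split; last by [].
  have [An _] := active_open co (or_introl erefl);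
    have [Bn _] := active_open co (or_intror erefl).
  have pn := core_preds_new co.
  have co1 : core n.+1 (fun j => (active (Sat A B d d) j \/ j = n) /\ j <> B) ((B, n) :: E).
    by apply: core_edge (core_new co) _ Bn _; rewrite ?pn //=; left; right.
  apply: core_ext (core_edge co1 _ An _) => /=.
  + by move=> i; split; [tauto|move=> ->; do 2?split; [right|lia|lia]].
  + by split=> //; left; left.
  + by rewrite /preds /= eqxx /= -/(preds E n) pn.
Qed.

(** The property that makes v a rupture curve whose quotient is remarkable, c being
    the gcd of its outgoing edge: e is the gcd of the incoming main chain, or 0 for
    the first rupture curve. *)
Definition separated (E : seq (nat * nat)) v c := exists e, ~~ (e %| c)%N /\
  forall i s, (i, s) \in E -> (e %| N i)%N && (e %| N s)%N \/
     alpha v <= alpha i /\ alpha v <= alpha s.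

(** The property that excludes v as a curve of smallest quotient in a witness: the
    quotient decreases across an edge at v whose gcd divides N on all strata
    that contain v and no curve of smaller quotient.  That edge goes out of v on
    the chains leading to the first rupture curve and on the dead ends, and comes
    into v on the main chain from a rupture curve to the next one. *)
Definition dominated (E : seq (nat * nat)) v s :=
  (alpha s < alpha v /\ forall i, (i, v) \in E -> (gcdn (N v) (N s) %| N i)%N) \/
  ((exists i, (i, v) \in E) /\
   forall i, (i, v) \in E -> alpha i < alpha v /\ (gcdn (N i) (N v) %| N s)%N).

(** A rupture curve: two older curves separate from it. *)
Definition isrup (E : seq (nat * nat)) v := (1 < size (preds E v))%N.

Definition edge_ok E v s := if isrup E v then separated E v (gcdn (N v) (N s))
  else dominated E v s.

Definition edges_ok (E : seq (nat * nat)) := forall v s, (v, s) \in E -> edge_ok E v s.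

Lemma separated_cons E v c i s : separated E v c -> alpha v <= alpha i -> alpha v <= alpha s ->
  separated ((i, s) :: E) v c.
Proof.
move=> [e [ec H]] vi vs; exists e; split=> // j k; rewrite inE => /orP[/eqP[-> ->]|/H//].
by right.
Qed.

Lemma isrup_cons E i n v : v <> n -> isrup ((i, n) :: E) v = isrup E v.
Proof. by move=> vn; rewrite /isrup preds_cons_ne //; apply/nesym. Qed.

Lemma in_cons_ne (E : seq (nat * nat)) (i n v j : nat) : v <> n ->
  ((j, v) \in (i, n) :: E) = ((j, v) \in E).
Proof. by move=> vn; rewrite inE; case: eqP => // -[_ /vn]. Qed.

Lemma edge_ok_cons E i n v s : edge_ok E v s -> v <> n ->
  (isrup E v -> alpha v <= alpha i /\ alpha v <= alpha n) -> edge_ok ((i, n) :: E) v s.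
Proof.
rewrite /edge_ok => + vn; rewrite isrup_cons //; case: ifP =>
  [rv /separated_cons H /(_ isT)[]|_].
  exact: H.
move=> H _; case: H => [[H1 H2]|[[j jv] H2]]; [left|right]; split=> //.
- by move=> j; rewrite in_cons_ne //; apply: H2.
- by exists j; rewrite in_cons_ne.
- by move=> k; rewrite in_cons_ne //; apply: H2.
Qed.

Lemma edges_ok_cons E i n : edges_ok E -> edge_ok E i n -> i <> n ->
  (forall k, (n, k) \notin E) ->
  (forall v, isrup E v -> v <> n -> alpha v <= alpha i /\ alpha v <= alpha n) ->
  edges_ok ((i, n) :: E).
Proof.
move=> gE gi lin nE H v s; rewrite inE => /orP[/eqP[-> ->]|vs].
  by apply: edge_ok_cons => // r; apply: H.
have vn : v <> n by move=> vn; subst v; rewrite (negbTE (nE _)) in vs.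
by apply: edge_ok_cons => //; [exact: gE|move=> r; apply: H].
Qed.

Definition pos n := forall k, (k < n)%N -> (0 < N k)%N /\ (0 < nu k)%N.

(** What is needed on a curve A of the main chain before its younger neighbour
    is known; e is the gcd of the edge it is going to have. *)
Definition outgoing E A e := if isrup E A then separated E A e else
  (exists i, (i, A) \in E) /\
  forall i, (i, A) \in E -> alpha i < alpha A /\ gcdn (N i) (N A) = e.

Lemma outgoing_edge_ok E A e s : outgoing E A e -> gcdn (N A) (N s) = e -> edge_ok E A s.
Proof.
rewrite /outgoing /edge_ok; case: ifP => _ H gE; first by rewrite gE.
right; case: H => ex H; split=> // i /H[-> ->]; split=> //.
by rewrite -gE dvdn_gcdr.
Qed.

Lemma outgoing_cons E A e i n : outgoing E A e -> A <> n ->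
  alpha A <= alpha i -> alpha A <= alpha n -> outgoing ((i, n) :: E) A e.
Proof.
rewrite /outgoing => + An Ai AN; rewrite isrup_cons //; case: ifP => _; first
  by move/separated_cons; apply.
move=> [[j jA] H]; split; first by exists j; rewrite in_cons_ne.
by move=> k; rewrite in_cons_ne //; apply: H.
Qed.

(** Before the first rupture, where the k-th curve has N = k a and nu = k + 1; the
    equation is obtained by eliminating k. *)
Record early_free n A a E : Prop := EarlyFree {
  ef_N : (N A + a = a * nu A)%N;
  ef_a : (1 < a)%N;
  ef_min : forall k, (k < n)%N -> alpha A <= alpha k;
  ef_nr : forall v, ~~ isrup E v }.

(** After a rupture: the first inequality says that the quotient keeps increasing at
    the next blow-up. *)
Record late_free A a E : Prop := LateFree {
  lf_N : (a * nu A < N A)%N;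
  lf_link : outgoing E A a;
  lf_rup : forall v, isrup E v -> alpha v <= alpha A }.

(** Before the first rupture.  By the two inequalities the quotients of the new
    curves decrease from both ends of the chain, until the rupture curve. *)
Record early_sat n A B a b e E : Prop := EarlySat {
  es_P : (nu B * N A < nu A * (N B + a))%N;
  es_P' : (nu A * N B < nu B * (N A + b))%N;
  es_A : forall i, (i, A) \in E -> (e %| N i)%N;
  es_min : forall k, (k < n)%N -> alpha A <= alpha k \/ alpha B <= alpha k;
  es_nr : forall v, ~~ isrup E v }.

(** After a rupture.  The inequality says that the quotient increases on the side
    of A; it implies that it decreases from B.  Only curves
    of the dead end arriving from B, on which it is at least that of B, can
    have an N that is not divisible by e. *)
Record late_sat A B a b e E : Prop := LateSat {
  ls_P : (nu A * (N B + a) < nu B * N A)%N;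
  ls_d : (gcdn a b < e)%N;
  ls_link : outgoing E A e;
  ls_edge : forall i s, (i, s) \in E -> (e %| N i)%N && (e %| N s)%N \/
     alpha B <= alpha i /\ alpha B <= alpha s;
  ls_rup : forall v, isrup E v -> alpha v <= alpha A }.

(** In a satellite state gcd(N_A, N_B + a) and gcd(N_A + b, N_B) are the gcds of the
    edges on the two sides.  They are invariant under the Euclidean algorithm, as are
    gcd(a, b), a nu_A + b nu_B and a N_A + b N_B + a b.  At the rupture curve, where
    a = b = d, the last two become d nu and d N, so that the strict inequality
    is the one required by [late_free]. *)
Definition inv n st E := match st with
  | Free A a => (forall k, (k < n)%N -> (a %| N k)%N) /\
      (early_free n A a E \/ late_free A a E)
  | Sat A B a b => exists e,
     [/\ gcdn (N A) (N B + a) = e /\ (forall k, (k < n)%N -> (gcdn a b %| N k)%N),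
       forall i, (i, B) \in E -> (gcdn (N A + b) (N B) %| N i)%N,
       ~~ isrup E B,
       (gcdn a b * (a * nu A + b * nu B) < a * N A + b * N B + a * b)%N &
       early_sat n A B a b e E \/ late_sat A B a b e E]
  end.

Lemma ltnS_case (P : nat -> Prop) n : P n -> (forall k, (k < n)%N -> P k) ->
  forall k, (k < n.+1)%N -> P k.
Proof. by move=> Pn H k; rewrite ltnS leq_eqVlt => /orP[/eqP->|/H]. Qed.


Lemma new_preds n P E : core n P E ->
  [/\ forall i, (i, n) \notin E, forall k, (n, k) \notin E & ~~ isrup E n].
Proof.
move=> co; have pn := core_preds_new co; split.
- by move=> i; apply/negP => /(edge_lt co); rewrite ltnn andbF.
- by move=> k; apply/negP => /(edge_lt co) /andP[]; lia.
- by rewrite /isrup pn.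
Qed.

Lemma isrup_cons1 n P E i v : core n P E -> isrup ((i, n) :: E) v = isrup E v.
Proof.
move=> co; case: (eqVneq v n) => [->|/eqP vn]; last exact: isrup_cons.
by rewrite /isrup /preds /= eqxx /= -/(preds E n) (core_preds_new co).
Qed.

(** The inequality of [inv] when the first satellite point before any rupture appears:
    d = gcd(a, b) is at most (a + b) / 2. *)
Lemma free_bound_early d a b X : (d <= a)%N -> (d <= b)%N -> (a + b <= X)%N -> (0 < b)%N ->
  (d * (X + (a + b) + b) < a * X + b * (X + b) + a * b)%N.
Proof.
move=> da db abX b0.
have h1 : (d * (X + (a + b) + b) <= d * (X + X + b))%N by rewrite leq_mul2l; apply/orP;
  right; lia.
have h2 : ((d + d) * X <= (a + b) * X)%N by rewrite leq_mul2r; apply/orP; right; lia.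
have h3 : (d * b <= a * b)%N by rewrite leq_mul2r da orbT.
have h4 : (0 < b * b)%N by rewrite muln_gt0 b0.
by lia.
Qed.

Lemma free_bound_late d a b X Y : (d <= a)%N -> (Y < X + b)%N -> (0 < b)%N ->
  (d * Y < a * X + b * (X + b) + a * b)%N.
Proof.
move=> da YX b0.
have h1 : (d * Y <= a * (X + b))%N by apply: leq_mul => //; lia.
have h2 : (0 < b * (X + b))%N by rewrite muln_gt0 b0 /=; lia.
by lia.
Qed.

Lemma slope_weaken x y z w c d : (x * (y + c) < z * w)%N -> (x * y < z * (w + d))%N.
Proof.
move=> H; apply: leq_ltn_trans (leq_trans H _); first by rewrite leq_mul2l leq_addr orbT.
by rewrite leq_mul2l leq_addr orbT.
Qed.

(** The inequalities kept in [inv] for a satellite state are equivalent before and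
    after a step that leads to a satellite state again, so an argument on sizes is
    only needed when the kind of state changes. *)
Lemma run_inv n st E : run n st E -> [/\ pos n, edges_ok E & inv n st E].
Proof.
elim=> {n st E}.
- move=> N0 nu0; split=> //.
    by move=> k; rewrite ltnS leqn0 => /eqP->; rewrite nu0; split=> //; apply: ltnW.
  split; first by move=> k; rewrite ltnS leqn0 => /eqP->.
  left; split=> //; first by rewrite nu0; lia.
  by move=> k; rewrite ltnS leqn0 => /eqP->.
(* Free to free: N increases by a, a divisor of all N, so the gcd of the edge is a. *)
- move=> n A a E ru [ps_ gE [aN ph]] a1 Nn nun.
  have [co [nA _]] := run_shape ru; have An : (A < n)%N by lia.
  have [NA nuA] := ps_ _ An.
  have [En nE rn] := new_preds co.
  have pos' : pos n.+1 by apply: ltnS_case => //; lia.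
  have [Np _] := pos' n (ltnSn n).
  have aN' : forall k, (k < n.+1)%N -> (a %| N k)%N.
    by apply: ltnS_case => //; rewrite Nn dvdn_add ?aN.
  have gcdE : gcdn (N A) (N n) = a.
    by rewrite Nn gcdnDl; apply/gcdn_idPr/aN.
  have Anne : A <> n by lia.
  case: ph => [[hN _ hmin hnr]|[hN hl hr]].
    have al : alpha n < alpha A by rewrite alpha_lt // Nn nun; nia.
    split=> //.
      apply: edges_ok_cons => //; last by move=> v; rewrite (negbTE (hnr v)).
      rewrite /edge_ok (negbTE (hnr A)); left; split=> // i iA.
      by rewrite gcdE aN //; have := edge_lt co iA; lia.
    split=> //; left; split=> //; first by rewrite Nn nun; nia.
      by apply: ltnS_case => // k kn; apply: le_trans (ltW al) (hmin _ kn).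
    by move=> v; rewrite (isrup_cons1 _ _ co).
  have al : alpha A < alpha n by rewrite alpha_lt // Nn nun; nia.
  split=> //.
    apply: edges_ok_cons => //; first exact: outgoing_edge_ok hl gcdE.
    move=> v /hr vA _; split=> //; exact: le_trans vA (ltW al).
  split=> //; right; split.
  + by rewrite Nn nun; nia.
  + rewrite /outgoing (isrup_cons1 _ _ co) (negbTE rn); split.
      by exists A; rewrite inE eqxx.
    by move=> i; rewrite inE (negbTE (En i)) orbF => /eqP[->].
  + by move=> v; rewrite (isrup_cons1 _ _ co) => /hr vA; exact: le_trans vA (ltW al).
(* Tangent to A: the new curve is the beginning of a dead end, and its edge to A
   may still be subdivided. *)
- move=> n A a b E ru [ps_ gE [abN ph]] a0 b0 Nn nun.
  have [co [nA _]] := run_shape ru; have An : (A < n)%N by lia.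
  have [NA nuA] := ps_ _ An.
  have [En nE rn] := new_preds co.
  have pos' : pos n.+1 by apply: ltnS_case => //; lia.
  have [Np _] := pos' n (ltnSn n).
  have abA := abN _ An.
  have dab : (gcdn a b %| a + b)%N by rewrite dvdn_add ?dvdn_gcdl ?dvdn_gcdr.
  have dN : forall k, (k < n.+1)%N -> (gcdn a b %| N k)%N.
    apply: ltnS_case => [|k kn]; last exact: dvdn_trans dab (abN _ kn).
    by rewrite Nn dvdn_add ?dvdn_gcdr // (dvdn_trans dab).
  have gcdE : gcdn (N A) (N n + a) = (a + b)%N.
    by rewrite Nn -addnA [(b + a)%N]addnC gcdnDl; apply/gcdn_idPr.
  have da : (gcdn a b <= a)%N by rewrite dvdn_leq ?dvdn_gcdl.
  have db : (gcdn a b <= b)%N by rewrite dvdn_leq ?dvdn_gcdr.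
  have Bp i : (i, n) \in E -> (gcdn (N A + b) (N n) %| N i)%N by rewrite (negbTE (En i)).
  have ableA : (a + b <= N A)%N by rewrite dvdn_leq.
  split=> //; exists (a + b)%N; case: ph => [[hN _ hmin hnr]|[hN hl hr]].
    split=> //.
      rewrite Nn nun; set d := gcdn a b in da db *.
      have X : (a * nu A + b * (nu A + 1) = N A + (a + b) + b)%N by nia.
      by rewrite X; apply: free_bound_early.
    left; split=> //.
    + by rewrite Nn nun; nia.
    + by rewrite Nn nun; nia.
    + by move=> i iA; apply: abN; have := edge_lt co iA; lia.
    + apply: ltnS_case => [|k kn]; [by right|left; exact: hmin].
  split=> //.
    rewrite Nn nun; set d := gcdn a b in da db *.
    have X : (a * nu A + b * (nu A + 1) < N A + b)%N by nia.
    exact: free_bound_late.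
  right; split=> //.
  + by rewrite Nn nun; nia.
  + by lia.
  + by move=> i s is_; left; rewrite !abN //; have := edge_lt co is_; lia.
(* B has the larger intersection number: the new curve takes the place of A, whose
   edge is final. *)
- move=> n A B a b E ru [ps_ gE [e [[ge dN] gB rB KL ph]]] b0 Nn nun.
  have [co [AB a0 _]] := run_shape ru.
  have [An AE] := active_open co (or_introl erefl);
    have [Bn BE] := active_open co (or_intror erefl).
  have [NA nuA] := ps_ _ An; have [NB nuB] := ps_ _ Bn.
  have [En nE rn] := new_preds co.
  have pos' : pos n.+1 by apply: ltnS_case => //; lia.
  have [Np _] := pos' n (ltnSn n).
  rewrite gcdnDl in dN KL.
  have dN' : forall k, (k < n.+1)%N -> (gcdn a b %| N k)%N.
    by apply: ltnS_case => //; rewrite Nn !dvdn_add ?dN ?dvdn_gcdl.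
  have Nn' : (N n = N A + (N B + a))%N by rewrite Nn addnA.
  have gcdE : gcdn (N A) (N n) = e by rewrite Nn' gcdnDl ge.
  have gcdE' : gcdn (N n) (N B + a) = e by rewrite Nn' gcdnC gcdnDr gcdnC ge.
  have eA : (e %| N A)%N by rewrite -ge dvdn_gcdl.
  have en : (e %| N n)%N by rewrite -gcdE dvdn_gcdr.
  have Bp i : (i, B) \in (A, n) :: E -> (gcdn (N n + b) (N B) %| N i)%N.
    rewrite in_cons_ne; last by lia.
    suff -> : gcdn (N n + b) (N B) = gcdn (N A + (a + b)) (N B) by apply: gB.
    rewrite gcdnC [RHS]gcdnC Nn.
    have -> : (N A + N B + a + b = N B + (N A + (a + b)))%N by lia.
    by rewrite gcdnDl.
  have KL' : (gcdn a b * (a * nu n + b * nu B) < a * N n + b * N B + a * b)%N.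
    by rewrite Nn nun; apply: leq_ltn_trans (leq_trans KL _); nia.
  have rB' : ~~ isrup ((A, n) :: E) B by rewrite (isrup_cons1 _ _ co).
  have Anne : A <> n by lia.
  have nEn i : (i, n) \in (A, n) :: E -> i = A by rewrite inE (negbTE (En i)) orbF => /eqP[->].
  case: ph => [[hP hP' hA hmin hnr]|[hP hd hl he hr]].
    have al : alpha n < alpha A by rewrite alpha_lt // Nn nun; nia.
    split=> //.
      apply: edges_ok_cons => //; last by move=> v; rewrite (negbTE (hnr v)).
      by rewrite /edge_ok (negbTE (hnr A)); left; split=> // i iA; rewrite gcdE hA.
    exists e; split=> //; left; split=> //.
    + by rewrite Nn nun; nia.
    + by rewrite Nn nun; nia.
    + by move=> i /nEn->.
    + apply: ltnS_case => [|k /hmin[kA|kB]]; [by left|left|by right].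
      exact: le_trans (ltW al) kA.
    + by move=> v; rewrite (isrup_cons1 _ _ co).
  have al : alpha A < alpha n by rewrite alpha_lt // Nn nun; nia.
  split=> //.
    apply: edges_ok_cons => //; first exact: outgoing_edge_ok hl gcdE.
    move=> v /hr vA _; split=> //; exact: le_trans vA (ltW al).
  exists e; split=> //; right; split=> //.
  + by rewrite Nn nun; nia.
  + by rewrite gcdnDl in hd.
  + rewrite /outgoing (isrup_cons1 _ _ co) (negbTE rn); split.
      by exists A; rewrite inE eqxx.
    by move=> i /nEn->.
  + by move=> i s; rewrite inE => /orP[/eqP[-> ->]|/he//]; left; rewrite eA.
  + by move=> v; rewrite (isrup_cons1 _ _ co) => /hr vA; exact: le_trans vA (ltW al).
(* A has the larger intersection number: the new curve takes the place of B, whose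
   edge is final. *)
- move=> n A B a b E ru [ps_ gE [e [[ge dN] gB rB KL ph]]] a0 Nn nun.
  have [co [AB _ b0]] := run_shape ru.
  have [An AE] := active_open co (or_introl erefl);
    have [Bn BE] := active_open co (or_intror erefl).
  have [NA nuA] := ps_ _ An; have [NB nuB] := ps_ _ Bn.
  have [En nE rn] := new_preds co.
  have pos' : pos n.+1 by apply: ltnS_case => //; lia.
  have [Np _] := pos' n (ltnSn n).
  have gab : gcdn (a + b) b = gcdn a b by rewrite gcdnC gcdnDr gcdnC.
  rewrite gab in dN KL.
  have dN' : forall k, (k < n.+1)%N -> (gcdn a b %| N k)%N.
    by apply: ltnS_case => //; rewrite Nn !dvdn_add ?dN ?dvdn_gcdr.
  have Nn' : (N n = N B + (N A + b))%N by rewrite Nn; lia.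
  have gcdE : gcdn (N A) (N n + a) = e.
    by rewrite -ge Nn; have -> : (N A + N B + b + a = N A + (N B + (a + b)))%N by [lia];
      rewrite gcdnDl.
  have gcdB : gcdn (N B) (N n) = gcdn (N A + b) (N B) by rewrite Nn' gcdnDl gcdnC.
  have gcdD : gcdn (N A + b) (N n) = gcdn (N A + b) (N B) by rewrite Nn' gcdnDr.
  have Anne : A <> n by lia. have Bnne : B <> n by lia.
  have nEn i : (i, n) \in (B, n) :: E -> i = B by rewrite inE (negbTE (En i)) orbF => /eqP[->].
  have Bp i : (i, n) \in (B, n) :: E -> (gcdn (N A + b) (N n) %| N i)%N.
    by move=> /nEn->; rewrite gcdD dvdn_gcdr.
  have KL' : (gcdn a b * (a * nu A + b * nu n) < a * N A + b * N n + a * b)%N.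
    by rewrite Nn nun; apply: leq_ltn_trans (leq_trans KL _); nia.
  have rB' : ~~ isrup ((B, n) :: E) n by rewrite (isrup_cons1 _ _ co).
  have P' : (nu A * N B < nu B * (N A + b))%N by case: ph =>
    [[]//|[/slope_weaken + _ _ _ _]]; apply.
  have al : alpha n < alpha B by rewrite alpha_lt // Nn nun; nia.
  have gB' : edge_ok E B n.
    rewrite /edge_ok (negbTE rB); left; split=> // i iB.
    by rewrite gcdB gB.
  case: ph => [[hP hP' hA hmin hnr]|[hP hd hl he hr]].
    split=> //.
      by apply: edges_ok_cons => // v; rewrite (negbTE (hnr v)).
    exists e; split=> //; left; split=> //.
    + by rewrite Nn nun; nia.
    + by rewrite Nn nun; nia.
    + by move=> i; rewrite in_cons_ne //; apply: hA.
    + apply: ltnS_case => [|k /hmin[kA|kB]]; [by right|by left|right].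
      exact: le_trans (ltW al) kB.
    + by move=> v; rewrite (isrup_cons1 _ _ co).
  have alA : alpha A < alpha n by rewrite alpha_lt // Nn nun; nia.
  have alAB := lt_trans alA al.
  split=> //.
    apply: edges_ok_cons => // v /hr vA _.
    by split; [exact: le_trans vA (ltW alAB)|exact: le_trans vA (ltW alA)].
  exists e; split=> //; right; split=> //.
  + by rewrite Nn nun; nia.
  + by rewrite gab in hd.
  + by apply: outgoing_cons => //; exact: ltW.
  + move=> i s; rewrite inE => /orP[/eqP[-> ->]|/he[|[iB sB]]]; [right|by left|right].
      by split=> //; exact: ltW.
    by split; [exact: le_trans (ltW al) iB|exact: le_trans (ltW al) sB].
  + by move=> v; rewrite (isrup_cons1 _ _ co); apply: hr.
(* Equal intersection numbers: both edges are final and the new curve is a rupture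
   curve. *)
- move=> n A B d E ru [ps_ gE [e [[ge dN] gB rB KL ph]]] Nn nun.
  have [co [AB d0 _]] := run_shape ru.
  have [An AE] := active_open co (or_introl erefl);
    have [Bn BE] := active_open co (or_intror erefl).
  have [NA nuA] := ps_ _ An; have [NB nuB] := ps_ _ Bn.
  have [En nE rn] := new_preds co.
  have pos' : pos n.+1 by apply: ltnS_case => //; lia.
  have [Np _] := pos' n (ltnSn n).
  rewrite gcdnn in dN KL.
  have dN' : forall k, (k < n.+1)%N -> (d %| N k)%N.
    by apply: ltnS_case => //; rewrite Nn !dvdn_add ?dN.
  have KL' : (d * nu n < N n)%N by rewrite Nn nun; nia.
  have Anne : A <> n by lia. have Bnne : B <> n by lia.
  have Nn' : (N n = N A + (N B + d))%N by rewrite Nn addnA.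
  have gcdE : gcdn (N A) (N n) = e by rewrite Nn' gcdnDl ge.
  have gcdB : gcdn (N B) (N n) = gcdn (N A + d) (N B).
    by rewrite Nn; have -> : (N A + N B + d = N B + (N A + d))%N by [lia]; rewrite gcdnDl gcdnC.
  have eA : (e %| N A)%N by rewrite -ge dvdn_gcdl.
  have en : (e %| N n)%N by rewrite -gcdE dvdn_gcdr.
  have P' : (nu A * N B < nu B * (N A + d))%N by case: ph =>
    [[]//|[/slope_weaken + _ _ _ _]]; apply.
  have alB : alpha n < alpha B by rewrite alpha_lt // Nn nun; nia.
  have gB' : edge_ok E B n.
    rewrite /edge_ok (negbTE rB); left; split=> // i iB.
    by rewrite gcdB gB.
  have nE' k : (n, k) \notin (B, n) :: E.
    by rewrite inE negb_or nE andbT; apply/eqP => -[/esym].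
  have rn' : isrup ((A, n) :: (B, n) :: E) n.
    by rewrite /isrup /preds /= eqxx /= -/(preds E n) (core_preds_new co).
  have isr v : isrup ((A, n) :: (B, n) :: E) v -> v = n \/ isrup E v.
    case: (eqVneq v n) => [->|/eqP vn]; first by left.
    by rewrite isrup_cons // isrup_cons //; right.
  case: ph => [[hP hP' hA hmin hnr]|[hP hd hl he hr]].
    have alA : alpha n < alpha A by rewrite alpha_lt // Nn nun; nia.
    have gA' : edge_ok ((B, n) :: E) A n.
      apply: edge_ok_cons => //; last by rewrite (negbTE (hnr _)).
      by rewrite /edge_ok (negbTE (hnr A)); left; split=> // i iA; rewrite gcdE hA.
    have mn k : (k < n.+1)%N -> alpha n <= alpha k.
      move: k; apply: ltnS_case => // k /hmin[]; apply: le_trans; exact: ltW.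
    split=> //.
      apply: edges_ok_cons => //; last first.
        by move=> v + vn; rewrite isrup_cons // (negbTE (hnr v)).
      by apply: edges_ok_cons => // v; rewrite (negbTE (hnr v)).
    split=> //; right; split=> //.
      (* No curve has a smaller quotient than the first rupture curve, so any number
         that does not divide d serves as e. *)
      rewrite /outgoing rn'; exists 0%N; rewrite dvd0n; split; first by rewrite -lt0n.
      move=> i s is_; right.
      suff [iS sS] : (i < n.+1)%N /\ (s < n.+1)%N by split; exact: mn.
      move: is_; rewrite !inE => /or3P[/eqP[-> ->]|/eqP[-> ->]|/(edge_lt co)]; lia.
    by move=> v /isr[->//|]; rewrite (negbTE (hnr v)).
  have alA : alpha A < alpha n by rewrite alpha_lt // Nn nun; nia.
  have alAB := lt_trans alA alB.
  have hvB v : isrup E v -> alpha v <= alpha B /\ alpha v <= alpha n.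
    by move=> /hr vA; split; [exact: le_trans vA (ltW alAB)|exact: le_trans vA (ltW alA)].
  have gA' : edge_ok ((B, n) :: E) A n.
    apply: edge_ok_cons => //; last by move/hvB.
    exact: outgoing_edge_ok hl gcdE.
  split=> //.
    apply: edges_ok_cons => //; last first.
      move=> v + vn; rewrite isrup_cons // => /[dup] /hvB[_ vn'] /hr vA; split=> //.
    by apply: edges_ok_cons => // v /hvB.
  split=> //; right; split=> //.
    rewrite /outgoing rn'; exists e; split.
      by rewrite gcdnn in hd; apply/negP => /(dvdn_leq d0); rewrite leqNgt hd.
    move=> i s; rewrite !inE => /or3P[/eqP[-> ->]|/eqP[-> ->]|/he[|[iB sB]]].
    - by left; rewrite eA.
    - by right; split=> //; exact: ltW.
    - by left.
    - by right; split; [exact: le_trans (ltW alB) iB|exact: le_trans (ltW alB) sB].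
  move=> v /isr[->//|/hvB[]//].
Qed.

End Run.

(** * Remarkable numbers of the completed graph *)

Section Final.
Variables N nu : nat -> nat.
Variables (m A : nat) (E0 : seq (nat * nat)).
Hypothesis ru : run N nu m (Free A 1) E0.
Hypotheses (Nm : N m = 1%N) (num : nu m = 1%N).
Local Notation alpha := (alpha N nu).
Let E := (A, m) :: E0.

Lemma run_final : [/\ pos N nu m.+1, edges_ok N nu E, core m.+1 (fun j =>
  j = m) E & alpha A < alpha m].
Proof.
have [co [mA _]] := run_shape ru; have [ps_ gE [_ ph]] := run_inv ru.
have [Am mE rm] := new_preds co.
have lt : (A < m)%N by lia.
have pos' : pos N nu m.+1 by apply: ltnS_case => //; rewrite Nm num.
case: ph => [[]//|[hN hl hr]].
have al : alpha A < alpha m.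
  have [NA _] := ps_ _ lt; rewrite alpha_lt ?Nm // num; lia.
split=> //.
- apply: edges_ok_cons => //.
  + by apply: (outgoing_edge_ok hl); rewrite Nm gcdn1.
  + by lia.
  + by move=> v /hr vA _; split=> //; exact: le_trans vA (ltW al).
- have sz : (size (preds E0 m) <= 1)%N by rewrite (core_preds_new co).
  have := core_edge (core_new co) (or_introl (erefl A)) lt sz.
  apply: core_ext => j /=; split; first tauto.
  by move=> ->; split; [right|lia].
Qed.

(** Indices of a nonempty stratum: one curve, or two adjacent ones. *)
Definition cell i k := (i <= m)%N /\ (i = k \/ (i, k) \in E).

Lemma cell_edge i k : (i, k) \in E -> cell i k.
Proof.
have [_ _ co _] := run_final; move=> ik; split; last by right.
by have := edge_lt co ik; lia.
Qed.

Lemma succ_ex i : (i < m)%N -> exists s, (i, s) \in E.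
Proof.
have [_ _ co _] := run_final; move=> im; apply: (inactive_closed co); first by lia.
by move=> /= ?; lia.
Qed.

Lemma no_succ k : (m, k) \notin E.
Proof. by have [_ _ co _] := run_final; have [_] := active_open co (erefl m). Qed.

Lemma last_edge i : (i, m) \in E -> i = A.
Proof.
have [co _] := run_shape ru; have [H _ _] := new_preds co.
by rewrite inE (negbTE (H i)) orbF => /eqP[].
Qed.

Lemma rup_lt v : isrup E v -> (v < m)%N.
Proof.
have [_ _ co _] := run_final.
rewrite /isrup; case EE : (preds E v) => [//|i [//|i' r]] _.
have iv : (i, v) \in E by rewrite -predsP EE inE eqxx.
have iv' : (i', v) \in E by rewrite -predsP EE !inE eqxx orbT.
have /andP[_] := edge_lt co iv; rewrite ltnS leq_eqVlt => /orP[/eqP vm|//].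
subst v; have := last_edge iv; have := last_edge iv'; move=> i'A iA.
by have [+ _] := preds_le2 co m; rewrite EE iA i'A /= inE eqxx.
Qed.

(** A rupture curve v gives the witness {v, s} with s its younger neighbour.  For a
    witness whose curve w of smallest quotient is not a rupture curve, [dominated]
    provides an edge at w which contradicts its minimality. *)
Lemma remarkable_cells (a : rat) :
  (exists i k, [/\ cell i k, Num.min (alpha i) (alpha k) = a &
    forall j l, cell j l -> Num.min (alpha j) (alpha l) < a ->
      ~~ (gcdn (N j) (N l) %| gcdn (N i) (N k))%N]) <->
  exists2 v, isrup E v & alpha v = a.
Proof.
have [_ gE co al] := run_final; split=> [[i [k [ik mn H]]]|[v rv <-{a}]]; last first.
  have vm := rup_lt rv; have [s vs] := succ_ex vm.
  have := gE _ _ vs; rewrite /edge_ok rv => -[e [ec He]].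
  have alvs : alpha v <= alpha s.
    case: (He _ _ vs) => [/andP[ev es]|[] //].
    by rewrite dvdn_gcd ev es in ec.
  exists v, s; split; [exact: cell_edge|exact/min_idPl|].
  move=> j l [jm jl] lt; apply: contra ec; apply: dvdn_trans.
  rewrite dvdn_gcd; case: jl => [jl|jl]; last first.
    case: (He _ _ jl) => // -[vj vl].
    by move: lt; rewrite gt_min !ltNge vj vl.
  subst l; rewrite minxx andbb in lt *.
  move: jm; rewrite leq_eqVlt => /orP[/eqP jm|jm].
    have AE : (A, m) \in E by rewrite inE eqxx.
    case: (He _ _ AE) => [/andP[_]|[_]]; first by rewrite jm.
    by rewrite -jm leNgt lt.
  have [s' js] := succ_ex jm; case: (He _ _ js) => [/andP[]//|[]].
  by rewrite leNgt lt.
apply: contrapT => nr.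
have {}nr v : alpha v = a -> ~~ isrup E v by move=> va; apply/negP => rv; apply: nr; exists v.
have [im ike] := ik.
have le_i : a <= alpha i by rewrite -mn ge_min lexx.
have le_k : a <= alpha k by rewrite -mn ge_min lexx orbT.
have [w wa wik] : exists2 w, alpha w = a & w = i \/ w = k.
  by case: (leP (alpha i) (alpha k)) mn => _ E1; [exists i|exists k]; auto.
have wm : (w <= m)%N.
  case: wik => [->//|->]; case: ike => [<-//|/(edge_lt co)]; lia.
move: wm; rewrite leq_eqVlt => /orP[/eqP wm|wm].
  have AE : (A, m) \in E by rewrite inE eqxx.
  have := H _ _ (cell_edge AE); rewrite gt_min -wa wm al Nm gcdn1 dvd1n => /(_ isT).
  by [].
have rw := nr _ wa; have [s ws] := succ_ex wm.
have := gE _ _ ws; rewrite /edge_ok (negbTE rw) => -[[sw hom_part]|[[i0 iw] hom_part]].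
  have := H _ _ (cell_edge ws); rewrite gt_min -wa sw orbT => /(_ isT) /negP; apply.
  rewrite dvdn_gcd; case: ike => [ike|ike].
    by subst k; have -> : i = w by [case: wik]; rewrite andbb dvdn_gcdl.
  case: wik => wik.
    have ks : k = s by apply: (edge_fun co ike); rewrite -wik.
    by move: le_k; rewrite ks leNgt -wa sw.
  by rewrite -wik dvdn_gcdl andbT; apply: hom_part; rewrite wik.
have [lt0 d0] := hom_part _ iw.
have := H _ _ (cell_edge iw); rewrite gt_min -wa lt0 => /(_ isT) /negP; apply.
rewrite dvdn_gcd; case: ike => [ike|ike].
  by subst k; have -> : i = w by [case: wik]; rewrite andbb dvdn_gcdr.
case: wik => wik.
  have ks : k = s by apply: (edge_fun co ike); rewrite -wik.
  by rewrite -wik dvdn_gcdr ks d0.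
by have [] := hom_part i; rewrite ?wik // -?wik wa ltNge le_i.
Qed.

Lemma neighbour_list v : (v <= m)%N -> exists L : seq nat,
  [/\ uniq L, forall j, (j \in L) = ((j, v) \in E) || ((v, j) \in E) &
      (size L == 3) = isrup E v].
Proof.
have [_ _ co _] := run_final; rewrite leq_eqVlt => /orP[/eqP->|vm].
  exists (preds E m); have [u s2] := preds_le2 co m; split=> //.
    by move=> j; rewrite predsP (negbTE (no_succ _)) orbF.
  have : ~~ isrup E m by apply/negP => /rup_lt; rewrite ltnn.
  rewrite /isrup; move: s2; case: (size _) => [|[|[|]]] //.
have [s vs] := succ_ex vm; have [u s2] := preds_le2 co v.
exists (s :: preds E v); split.
- rewrite /= u andbT predsP; apply/negP => /(edge_lt co).
  by have := edge_lt co vs; lia.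
- move=> j; rewrite inE predsP orbC; congr orb; apply/eqP/idP => [->//|vj].
  exact: (edge_fun co vj vs).
- by rewrite /isrup /=; move: s2; case: (size _) => [|[|[|]]].
Qed.

End Final.

(** * Exceptional curves and multiplicities along a sequence of blow-ups *)

Section Shuffles.
(** The products met when total transforms and Jacobian determinants are pulled
    back in a chart. *)
Variable T : comNzRingType.
Implicit Types u v x y z s : T.
Lemma total_chart u v x x' y z s :
  u * (v * (x * x') * y) * (z * s) = x * x' * z * (u * v * y * s).
Proof. ring. Qed.
Lemma total_Some u v x x' y z s :
  u * (v * (x * x') * y) * (z * s) = u * v * (x * x' * z * y) * s.
Proof. ring. Qed.
Lemma total_None u x y y' z s :
  u * (x * (y * y')) * (z * s) = u * (x * (y * y' * z)) * s.
Proof. ring. Qed.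
Lemma jacobian_chart u v x y z : u * (v * x * y) * z = z * x * (u * v * y).
Proof. ring. Qed.
Lemma jacobian_Some u v x y z : u * (v * x * y) * z = u * v * (z * x * y).
Proof. ring. Qed.
Lemma jacobian_None u x y z : u * (x * y) * z = u * (x * (z * y)).
Proof. ring. Qed.
End Shuffles.

Section Axes.
Variable R : realType.
Local Notation C := R[i].
Local Notation S := (series R).
Implicit Types (g h : S) (t : direction R) (p q : near_point R).

Lemma strict_rcons g p t : strict_transform g (rcons p t) = strict1 t (strict_transform g p).
Proof. exact: foldl_rcons. Qed.
Lemma total_rcons g p t : total_transform g (rcons p t) = pullback t (total_transform g p).
Proof. exact: foldl_rcons. Qed.
Lemma jacobian_rcons p t : jacobian (rcons p t) = pullback t (jacobian p) * exc_eq t.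
Proof. by rewrite /jacobian foldl_rcons ps_mulE. Qed.

Lemma strict_neq0 g p : g <> 0 -> strict_transform g p <> 0.
Proof.
elim/last_ind: p => [//|p t IH] /IH g0; rewrite strict_rcons.
have [m mu] := has_mult_ex g0; rewrite (strict1_dir _ mu) => E.
have := excfree_strict_dir t mu; rewrite E; case: t {E} => [c|]; [|rewrite /=/yfree]; exact.
Qed.

Lemma exc_local_nil q : exc_local q [::] = 1.
Proof. by case: q => *; exact: ps_oneE. Qed.

Lemma exc_local_rcons q p t :
  exc_local q (rcons p t) = if q == p then exc_eq t else strict1 t (exc_local q p).
Proof.
elim: q p => [|s q IH] [|u p] //=.
- by rewrite strict_rcons.
- by rewrite exc_local_nil ps_oneE strict11; case: ifP.
- rewrite eqseq_cons; case: eqP => _ /=; first exact: IH.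
  by rewrite ps_oneE strict11.
Qed.

(** The exceptional curve that is the axis x = 0 (resp. y = 0) at the point whose
    reversed sequence of directions is r. *)
Fixpoint xaxis_rev (r : near_point R) : option (near_point R) :=
  match r with
  | Some _ :: r' => Some (rev r') | None :: r' => xaxis_rev r' | [::] => None end.
Fixpoint yaxis_rev (r : near_point R) : option (near_point R) :=
  match r with
  | Some c :: r' => if c == 0 then yaxis_rev r' else None
  | None :: r' => Some (rev r') | [::] => None end.
Definition xaxis p := xaxis_rev (rev p).
Definition yaxis p := yaxis_rev (rev p).

Lemma xaxis_rcons p t : xaxis (rcons p t) = if t is Some _ then Some p else xaxis p.
Proof. by rewrite /xaxis rev_rcons; case: t => [c|] //=; rewrite revK. Qed.
Lemma yaxis_rcons p t : yaxis (rcons p t) =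
  if t is Some c then if c == 0 then yaxis p else None else Some p.
Proof. by rewrite /yaxis rev_rcons; case: t => [c|] //=; rewrite revK. Qed.

Lemma axis_size p q : xaxis p = Some q \/ yaxis p = Some q -> (size q < size p)%N.
Proof.
elim/last_ind: p => [|p t IH]; first by case.
rewrite xaxis_rcons yaxis_rcons size_rcons; case: t => [c|] [].
- by move=> [->].
- by case: eqP => // _ H; apply: ltnW; apply: IH; right.
- by move=> H; apply: ltnW; apply: IH; left.
- by move=> [->].
Qed.

Lemma strict1_x_Some c : strict1 (Some c) (sx R) = 1.
Proof.
apply: (@strict1E _ _ _ _ 1); last by rewrite pullback_x_Some mulr1.
exact: sunit_xfree (sunit1 R).
Qed.
Lemma strict1_x_None : strict1 None (sx R) = sx R.
Proof.
apply: (@strict1E _ _ _ _ 1); first by rewrite -[sx R]expr1; exact: yfree_x.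
by rewrite pullback_x_None mulrC.
Qed.
Lemma strict1_y_Some c : if c == 0 then strict1 (Some c) (sy R) = sy R
  else sunit (strict1 (Some c) (sy R)).
Proof.
have [w [E]] := pullback_y_Some c; case: ifP => _ wE.
  apply: (@strict1E _ _ _ _ 1); last by rewrite E wE.
  by rewrite -[sy R]expr1; exact: xfree_y.
by rewrite (@strict1E _ (Some c) _ w 1) //=; exact: sunit_xfree.
Qed.
Lemma strict1_y_None : strict1 None (sy R) = 1.
Proof.
apply: (@strict1E _ _ _ _ 1); last by rewrite pullback_y_None mulr1.
exact: sunit_yfree (sunit1 R).
Qed.

Lemma sx_neq_sy : sx R <> sy R.
Proof. by move/(congr1 (fun g : S => g 1%N 0%N)) => /= /eqP; rewrite oner_eq0. Qed.

Lemma sunit_strict1 t g : sunit g -> sunit (strict1 t g).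
Proof. by move=> ug; rewrite strict1_sunit // sunit_pullback. Qed.

(** An exceptional curve is an axis as long as the blown up points stay on it, and
    its local equation becomes a unit as soon as they leave it. *)
Lemma exc_local_axes p q : [/\ xaxis p = Some q -> exc_local q p = sx R,
  yaxis p = Some q -> exc_local q p = sy R &
  xaxis p <> Some q -> yaxis p <> Some q -> sunit (exc_local q p)].
Proof.
elim/last_ind: p => [|p t [IHx IHy IHu]]; first by split=> // _ _; rewrite exc_local_nil sunit1.
rewrite xaxis_rcons yaxis_rcons exc_local_rcons.
have nx : xaxis p = Some p -> False by move=> H; have := axis_size (or_introl H); rewrite ltnn.
have ny : yaxis p = Some p -> False by move=> H; have := axis_size (or_intror H); rewrite ltnn.
case: (q =P p) => [->|qp].
  case: t => [c|].
    by split=> [//||[]//]; case: ifP => // _ /ny.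
  by split=> [/nx||_ []].
case: t => [c|]; split=> //.
- by move=> [pq]; case: qp.
- case: eqP => // c0 /IHy ->.
  by have := strict1_y_Some c; rewrite c0 eqxx.
- move=> _ yq; case: (pselect (xaxis p = Some q)) => [/IHx->|nxq].
    by rewrite strict1_x_Some sunit1.
  case: (pselect (yaxis p = Some q)) => [yp|nyq]; last exact/sunit_strict1/IHu.
  have := strict1_y_Some c; rewrite IHy //; case: ifP => // c0.
  by rewrite c0 in yq.
- by move=> /IHx ->; exact: strict1_x_None.
- by move=> [pq]; case: qp.
- move=> xq _; case: (pselect (yaxis p = Some q)) => [/IHy->|nyq].
    by rewrite strict1_y_None sunit1.
  by apply/sunit_strict1/IHu.
Qed.

Lemma axes_disjoint p q : xaxis p = Some q -> yaxis p = Some q -> False.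
Proof.
have [H1 H2 _] := exc_local_axes p q => /H1 Ex /H2 Ey.
by apply: sx_neq_sy; rewrite -Ex -Ey.
Qed.

Lemma vanishP g : ps_vanishes g <-> ~~ sunit g.
Proof. by rewrite /sunit negbK; split=> [->|/eqP]. Qed.

Lemma passes_exc f p q : passes f (Some q) p <-> xaxis p = Some q \/ yaxis p = Some q.
Proof.
have [H1 H2 H3] := exc_local_axes p q; rewrite /passes vanishP /=; split.
  move=> nu; case: (pselect (xaxis p = Some q)) => [|nx]; first by left.
  case: (pselect (yaxis p = Some q)) => [|ny]; first by right.
  by rewrite H3 in nu.
by case=> [/H1|/H2] ->; rewrite /sunit negbK; apply/eqP.
Qed.

Lemma ps_ord_x k h : xfree h -> ps_ord (sx R) (sx R ^+ k * h) = k.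
Proof.
move=> xh; apply: xget_unique.
  split; rewrite ps_expE ps_dvdE; first by exists h.
  move=> [u]; rewrite exprSr -mulrA => /sxn_inj hE.
  by apply: (proj1 (xdvdP h)) xh; exists u.
move=> n []; rewrite !ps_expE !ps_dvdE => -[u uE] nd.
case: (ltngtP n k) => // nk.
  by case: nd; exists (sx R ^+ (k - n.+1) * h); rewrite mulrA -exprD subnKC.
have [j nE] : exists j, n = (k + j.+1)%N by exists (n - k.+1)%N; lia.
move: uE; rewrite nE exprD -mulrA => /sxn_inj hE.
by case: (proj1 (xdvdP h)) => //; exists (sx R ^+ j * u); rewrite mulrA -exprS.
Qed.

Section Multiplicity.
Variable f : S.
Hypothesis f0 : f <> 0.

(** An axis which is not exceptional counts with N = 0 and, below, nu = 1. *)
Definition Nax o := if o is Some q then N_comp f (Some q) else 0%N.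
Definition nuax o := if o is Some q then nu_comp f (Some q) else 1%N.

Lemma nuax_gt0 o : (0 < nuax o)%N. Proof. by case: o. Qed.

Lemma local_eq_chart q : local_eq f (Some q) (chart_on (Some q)) = sx R.
Proof. by rewrite /= exc_local_rcons eqxx. Qed.

Lemma monomial_pullback_Some c a b : exists u, sunit u /\
  pullback (Some c) (sx R ^+ a * sy R ^+ b) = u * sx R ^+ (a + b) * sy R ^+ (if c == 0 then b else 0).
Proof.
have [w [wE]] := pullback_y_Some c; rewrite pullbackM !pullbackX pullback_x_Some wE.
rewrite exprMn mulrA -exprD; case: ifP => _ wc.
  by exists 1; rewrite sunit1 mul1r wc.
by exists (w ^+ b); rewrite sunitX // mulr1 mulrC.
Qed.
Lemma monomial_pullback_None a b :
  pullback None (sx R ^+ a * sy R ^+ b) = sx R ^+ a * sy R ^+ (a + b).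
Proof. by rewrite pullbackM !pullbackX pullback_x_None pullback_y_None exprMn exprD mulrA. Qed.

Lemma N_comp_of_total p m u a b : has_mult (strict_transform f p) m -> sunit u ->
  total_transform f p = u * (sx R ^+ a * sy R ^+ b) * strict_transform f p ->
  N_comp f (Some p) = (a + b + m)%N.
Proof.
move=> mu uu E; rewrite /N_comp local_eq_chart total_rcons E pullbackM pullbackM.
have [v [uv ->]] := monomial_pullback_Some 0 a b; rewrite eqxx (pullback_strict_at _ mu).
rewrite -[RHS](@ps_ord_x _ (pullback (Some 0) u * v * sy R ^+ b * strict_at 0 m (strict_transform f p))).
  by congr ps_ord; rewrite !exprD; exact: total_chart.
apply: xfreeM; last exact: xfree_strict_at.
apply: xfreeM; last exact: xfree_y.
by apply: sunit_xfree; rewrite sunitM sunit_pullback uu.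
Qed.

(** The total transform is monomial in the axes times the strict transform; the
    exponents are the multiplicities of the axes. *)
Lemma total_decomp p : exists u, sunit u /\ total_transform f p =
  u * (sx R ^+ Nax (xaxis p) * sy R ^+ Nax (yaxis p)) * strict_transform f p.
Proof.
elim/last_ind: p => [|p t [u [uu E]]].
  by exists 1; rewrite sunit1 !expr0 mulr1 !mul1r.
have [m mu] := has_mult_ex (@strict_neq0 f p f0).
have NE := N_comp_of_total mu uu E.
rewrite total_rcons E pullbackM pullbackM strict_rcons (strict1_dir _ mu) (pullback_strict_dir _ mu).
rewrite xaxis_rcons yaxis_rcons; case: t => [c|].
  have [v [uv ->]] := monomial_pullback_Some c (Nax (xaxis p)) (Nax (yaxis p)).
  exists (pullback (Some c) u * v); rewrite sunitM sunit_pullback uu; split=> //.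
  have -> : Nax (if c == 0 then yaxis p else None) = if c == 0 then Nax (yaxis p) else 0%N
    by case: ifP.
  by rewrite [Nax (Some p)]NE !exprD; exact: total_Some.
rewrite monomial_pullback_None; exists (pullback None u); rewrite sunit_pullback uu; split=> //.
by rewrite [Nax (Some p)]NE !exprD; exact: total_None.
Qed.

Lemma N_compE p m : has_mult (strict_transform f p) m ->
  N_comp f (Some p) = (Nax (xaxis p) + Nax (yaxis p) + m)%N.
Proof. by move=> mu; have [u [uu E]] := total_decomp p; exact: N_comp_of_total E. Qed.

Lemma nu_comp_of_jacobian p u a b : sunit u -> jacobian p = u * (sx R ^+ a * sy R ^+ b) ->
  nu_comp f (Some p) = (a + b).+2.
Proof.
move=> uu E; rewrite /nu_comp local_eq_chart jacobian_rcons E pullbackM.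
have [v [uv ->]] := monomial_pullback_Some 0 a b; rewrite eqxx /= -/(sx R).
congr _.+1; rewrite -[RHS](@ps_ord_x _ (pullback (Some 0) u * v * sy R ^+ b)).
  by congr ps_ord; rewrite exprS; exact: jacobian_chart.
apply: xfreeM; last exact: xfree_y.
by apply: sunit_xfree; rewrite sunitM sunit_pullback uu.
Qed.

Lemma jacobian_decomp p : exists u, sunit u /\
  jacobian p = u * (sx R ^+ (nuax (xaxis p)).-1 * sy R ^+ (nuax (yaxis p)).-1).
Proof.
elim/last_ind: p => [|p t [u [uu E]]].
  by exists 1; rewrite sunit1 !expr0 !mulr1 /jacobian /= ps_oneE.
have NE := nu_comp_of_jacobian uu E.
rewrite jacobian_rcons E pullbackM xaxis_rcons yaxis_rcons; case: t => [c|].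
  have [v [uv ->]] := monomial_pullback_Some c (nuax (xaxis p)).-1 (nuax (yaxis p)).-1.
  exists (pullback (Some c) u * v); rewrite sunitM sunit_pullback uu; split=> //.
  have -> : (nuax (if c == 0 then yaxis p
    else None)).-1 = if c == 0 then (nuax (yaxis p)).-1 else 0%N by case: ifP.
  by rewrite [nuax (Some p)]NE exprS; exact: jacobian_Some.
rewrite monomial_pullback_None; exists (pullback None u); rewrite sunit_pullback uu; split=> //.
by rewrite [nuax (Some p)]NE exprS; exact: jacobian_None.
Qed.

Lemma nu_compE p : nu_comp f (Some p) = (nuax (xaxis p) + nuax (yaxis p))%N.
Proof.
have [u [uu E]] := jacobian_decomp p; rewrite (nu_comp_of_jacobian uu E).
by have := nuax_gt0 (xaxis p); have := nuax_gt0 (yaxis p); lia.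
Qed.

End Multiplicity.

(** These are the N and nu - 1 of the strict transform. *)
Lemma ps_ord_irr (f : S) : irr f -> ps_ord f f = 1%N /\ ps_ord f 1 = 0%N.
Proof.
move=> ir; have f0 := irr_neq0 ir; have [nu _] := ir.
have nd n : ps_dvd (ps_exp f n.+2) f -> False.
  rewrite ps_expE ps_dvdE => -[v]; rewrite !exprS -!mulrA => E.
  have : f * (1 - f * (f ^+ n * v)) = 0 by rewrite mulrBr mulr1 -E subrr.
  case/ser_nozerodiv => // /eqP; rewrite subr_eq0 => /eqP /esym E1.
  by move: nu; have := sunit1 R; rewrite -E1 sunitM => /andP[->].
have nd1 n : ps_dvd (ps_exp f n.+1) 1 -> False.
  rewrite ps_expE ps_dvdE => -[v]; rewrite exprS -mulrA => E1.
  by move: nu; have := sunit1 R; rewrite E1 sunitM => /andP[->].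
split; apply: xget_unique.
- split; last exact: nd.
  by rewrite ps_expE ps_dvdE; exists 1; rewrite expr1 mulr1.
- move=> [|[|n]] [] //; last by move/nd.
  by move=> _ []; rewrite ps_expE ps_dvdE; exists 1; rewrite expr1 mulr1.
- split; last exact: nd1.
  by rewrite ps_expE ps_dvdE; exists 1; rewrite expr0 mulr1.
- by move=> [|n] [] // /nd1.
Qed.

End Axes.

(** * The infinitely near points of the curve *)

Section CurvePoints.
Variable R : realType.
Local Notation C := R[i].
Local Notation S := (series R).
Variable f : S.
Hypothesis irf : irr f.
Implicit Types (t : direction R) (p q : near_point R).

Definition vanishing_dir (g : S) : direction R := xget None [set t | strict1 t g 0%N 0%N = 0]%classic.

(** The n-th infinitely near point of the curve, and below the germ of its strict
    transform there. *)
Fixpoint curve_pt n : near_point R :=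
  if n is n'.+1 then rcons (curve_pt n') (vanishing_dir (strict_transform f (curve_pt n'))) else [::].
Definition germ_at n := strict_transform f (curve_pt n).
Definition tangent n := vanishing_dir (germ_at n).

Lemma curve_ptS n : curve_pt n.+1 = rcons (curve_pt n) (tangent n). Proof. by []. Qed.
Lemma size_curve_pt n : size (curve_pt n) = n.
Proof. by elim: n => // n IH; rewrite curve_ptS size_rcons IH. Qed.
Lemma curve_pt_inj : injective curve_pt.
Proof. by move=> i j /(congr1 size); rewrite !size_curve_pt. Qed.
Lemma germ_atS n : germ_at n.+1 = strict1 (tangent n) (germ_at n).
Proof. by rewrite /germ_at curve_ptS strict_rcons. Qed.

Lemma vanishing_dirE g t : (forall t', strict1 t' g 0%N 0%N = 0 <-> t' = t) ->
  vanishing_dir g = t.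
Proof. by move=> H; apply: xget_unique; [exact/H|move=> t' /H]. Qed.

Lemma irr_germ_at n : irr (germ_at n).
Proof.
elim: n => // n IH; rewrite germ_atS; have [m mu] := has_mult_ex (irr_neq0 IH).
by have [t [ir _ H]] := tangent_ex IH mu; rewrite /tangent (vanishing_dirE H).
Qed.

Lemma tangent_germ_at n : exists m, [/\ has_mult (germ_at n) m, tangent_data (germ_at n) m (tangent n) &
  forall t, strict1 t (germ_at n) 0%N 0%N = 0 <-> t = tangent n].
Proof.
have [m mu] := has_mult_ex (irr_neq0 (irr_germ_at n)); exists m.
by have [t [ir td H]] := tangent_ex (irr_germ_at n) mu; rewrite /tangent (vanishing_dirE H).
Qed.

Lemma germ_at00 n : germ_at n 0%N 0%N = 0.
Proof. by apply/eqP; have [+ _] := irr_germ_at n; rewrite /sunit negbK. Qed.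

(** A strict transform that does not vanish at a point does not vanish above it, and
    over p_n the only point where it vanishes is in the direction of the tangent. *)
Lemma passes_curve p : passes f None p <-> p = curve_pt (size p).
Proof.
rewrite /passes vanishP /=; elim/last_ind: p => [|p t IH].
  by split=> // _; have [] := irf.
rewrite strict_rcons size_rcons; split=> [nu|].
  have /IH pE : ~~ sunit (strict_transform f p).
    by apply: contra nu => /sunit_strict1.
  rewrite curve_ptS -pE; congr rcons; have [m [_ _ H]] := tangent_germ_at (size p); apply/H.
  by apply/eqP; move: nu; rewrite /sunit negbK /germ_at -pE.
rewrite curve_ptS => /rcons_inj[pE tE].
have [m [_ _ H]] := tangent_germ_at (size p); have /H := tE.
by rewrite /germ_at -pE /sunit negbK => /eqP.
Qed.

Lemma free_sub (T : eqType) (D : T -> 'rV[C]_2) (s L : seq T) : uniq s -> {subset s <= L} ->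
  uniq L ->
  free [seq D i | i <- L] -> free [seq D i | i <- s].
Proof.
move=> us sL uL; have : perm_eq (s ++ [seq i <- L | i \notin s]) L.
  apply: uniq_perm => //.
    rewrite cat_uniq us filter_uniq // andbT; apply/hasPn => i.
    by rewrite mem_filter => /andP[].
  move=> i; rewrite mem_cat mem_filter; case: (boolP (i \in s)) => //= /sL ->.
  by [].
move=> /(perm_map D) /perm_free <-; rewrite map_cat => /catl_free.
by [].
Qed.

Lemma snc_atP p (L : seq (divisor R)) : uniq L -> (forall i, i \in L <-> passes f i p) ->
  snc_at f p <-> free [seq ps_diff (local_eq f i p) | i <- L].
Proof.
move=> uL HL; split=> [|fr s us Hs]; first by apply=> // i /HL.
by apply: (@free_sub _ (fun i => ps_diff (local_eq f i p)) s L) => // i /Hs /HL.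
Qed.

Lemma free1 (v : 'rV[C]_2) : free [:: v] = (v != 0).
Proof. exact: seq1_free. Qed.

Lemma diffE (g : S) : ps_diff g 0 0 = g 1%N 0%N /\ ps_diff g 0 (lift 0 0) = g 0%N 1%N.
Proof. by rewrite !mxE. Qed.

Lemma free_xg (g : S) : free [:: ps_diff g; ps_diff (sx R)] = (g 0%N 1%N != 0).
Proof.
have [g0 g1] := diffE g; have [x0 x1] := diffE (sx R).
have nx : ps_diff (sx R) != 0.
  by apply/eqP => E; move: x0; rewrite E mxE => /esym/eqP; rewrite oner_eq0.
rewrite free_cons free1 nx andbT span_seq1; congr negb; apply/vlineP/eqP.
  by case=> k E; rewrite -g1 E mxE x1 /sx /ps_x /ps_monom mulr0.
move=> g01; exists (g 1%N 0%N); apply/rowP => j; rewrite [in RHS]mxE.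
case: (unliftP 0 j) => [j'|] ->; rewrite ?g0 ?x0 ?mulr1 //.
by rewrite (ord1 j') g1 x1 g01 mulr0.
Qed.

Lemma free_yg (g : S) : free [:: ps_diff g; ps_diff (sy R)] = (g 1%N 0%N != 0).
Proof.
have [g0 g1] := diffE g; have [x0 x1] := diffE (sy R).
have nx : ps_diff (sy R) != 0.
  by apply/eqP => E; move: x1; rewrite E mxE => /esym/eqP; rewrite oner_eq0.
rewrite free_cons free1 nx andbT span_seq1; congr negb; apply/vlineP/eqP.
  by case=> k E; rewrite -g0 E mxE x0 mulr0.
move=> g01; exists (g 0%N 1%N); apply/rowP => j; rewrite [in RHS]mxE.
case: (unliftP 0 j) => [j'|] ->; rewrite ?g0 ?x0 ?g01 ?mulr0 //.
by rewrite (ord1 j') g1 x1 mulr1.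
Qed.

Lemma free_xy : free [:: ps_diff (sy R); ps_diff (sx R)].
Proof. by rewrite free_xg oner_neq0. Qed.

Lemma not_free3 (u v w : 'rV[C]_2) : free [:: u; v; w] = false.
Proof.
apply/negP => /eqP fr; have := dimvS (subvf <<[:: u; v; w]>>).
by rewrite fr dimvf.
Qed.

Definition axes p : seq (divisor R) :=
  (if yaxis p is Some q then [:: Some q] else [::]) ++
  (if xaxis p is Some q then [:: Some q] else [::]).

Lemma axes_mem p i : i \in axes p <-> exists2 q, i = Some q & passes f (Some q) p.
Proof.
rewrite /axes mem_cat; split.
  case/orP; [case E : (yaxis p) => [q|//]|case E : (xaxis p) => [q|//]];
  rewrite inE => /eqP->; exists q => //; apply/passes_exc; by [right|left].
case=> q -> /passes_exc[] ->; rewrite inE eqxx ?orbT //.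
Qed.

Lemma axes_uniq p : uniq (axes p).
Proof.
rewrite /axes; case Ex : (xaxis p) => [q|]; case Ey : (yaxis p) => [q'|] //=.
rewrite inE andbT; apply/eqP => -[qq]; subst q'; exact: axes_disjoint Ex Ey.
Qed.

(** Away from the curve only the axes can be present, and they cross normally. *)
Lemma snc_off p : p <> curve_pt (size p) -> snc_at f p.
Proof.
move=> np; apply/(@snc_atP p (axes p)); first exact: axes_uniq.
  move=> i; rewrite axes_mem; split=> [[q -> //]|]; case: i => [q|]; first by exists q.
  by move/passes_curve.
rewrite /axes; case Ex : (xaxis p) => [q|]; case Ey : (yaxis p) => [q'|] /=.
- have [_ + _] := exc_local_axes p q' => /(_ Ey) ->.
  by have [+ _ _] := exc_local_axes p q => /(_ Ex) ->; exact: free_xy.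
- have [+ _ _] := exc_local_axes p q => /(_ Ex) ->.
  by have := free_xy; rewrite free_cons => /andP[].
- have [_ + _] := exc_local_axes p q' => /(_ Ey) ->.
  by have := free_xy; rewrite -(@perm_free _ _ [:: ps_diff (sx R);
    ps_diff (sy R)]) ?free_cons => [/andP[]//|];
      rewrite -[X in perm_eq X _]/(rcons [:: ps_diff (sx R)] _) perm_rcons.
- exact: nil_free.
Qed.

Lemma snc_onE n : snc_at f (curve_pt n) <->
  free [seq ps_diff (local_eq f i (curve_pt n)) | i <- None :: axes (curve_pt n)].
Proof.
apply: snc_atP.
  rewrite /= axes_uniq andbT; apply/negP => /axes_mem[q] //.
move=> i; rewrite inE; split=> [/orP[/eqP->|/axes_mem[q ->//]]|].
  by apply/passes_curve; rewrite size_curve_pt.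
by case: i => [q pq|//]; apply/orP; right; apply/axes_mem; exists q.
Qed.

Lemma snc_on_sat n q q' : xaxis (curve_pt n) = Some q -> yaxis (curve_pt n) = Some q' ->
  ~ snc_at f (curve_pt n).
Proof. by move=> xq yq' /snc_onE; rewrite /axes xq yq' /= not_free3. Qed.

(** The germ is transversal to the axis x = 0, and in particular smooth, exactly when
    their intersection number is 1. *)
Lemma snc_on_x n q a : xaxis (curve_pt n) = Some q -> yaxis (curve_pt n) = None ->
  meets_x (germ_at n) a ->
  snc_at f (curve_pt n) <-> a = 1%N.
Proof.
move=> xq yq [la na]; rewrite snc_onE /axes xq yq /=.
have [-> // _ _] := exc_local_axes (curve_pt n) q; rewrite free_xg -/(germ_at n).
split=> [n1|a1]; last by rewrite a1 in na.
case: a la na => [|[|a]] // la; first by rewrite germ_at00 eqxx.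
by rewrite la ?eqxx in n1.
Qed.

Lemma snc_on_y n q a : xaxis (curve_pt n) = None -> yaxis (curve_pt n) = Some q ->
  meets_y (germ_at n) a ->
  snc_at f (curve_pt n) <-> a = 1%N.
Proof.
move=> xq yq [la na]; rewrite snc_onE /axes xq yq /=.
have [_ -> // _] := exc_local_axes (curve_pt n) q; rewrite free_yg -/(germ_at n).
split=> [n1|a1]; last by rewrite a1 in na.
case: a la na => [|[|a]] // la; first by rewrite /swap germ_at00 eqxx.
by have := la 1%N isT; rewrite /swap => z; rewrite z eqxx in n1.
Qed.

End CurvePoints.

(** * The resolution as a Euclidean process *)

Section GeometricRun.
Variable R : realType.
Local Notation C := R[i].
Local Notation S := (series R).
Variable f : S.
Hypothesis irf : irr f.
Local Notation curve_pt := (curve_pt f).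
Local Notation germ_at := (germ_at f).
Local Notation tangent := (tangent f).

Definition N_curve k := N_comp f (Some (curve_pt k)).
Definition nu_curve k := nu_comp f (Some (curve_pt k)).
Definition through i k := xaxis (curve_pt k) = Some (curve_pt i) \/
  yaxis (curve_pt k) = Some (curve_pt i).
(** The indices of the curves that are the axes at p_n. *)
Definition axes_are n x y := xaxis (curve_pt n) = omap curve_pt x /\
  yaxis (curve_pt n) = omap curve_pt y.

Lemma axes_are_through n x y i : axes_are n x y -> through i n <-> x = Some i \/ y = Some i.
Proof.
have H o : omap curve_pt o = Some (curve_pt i) <-> o = Some i.
  by case: o => [j|] //=; split=> [[/curve_pt_inj->]|[->]].
by move=> [E1 E2]; rewrite /through E1 E2 !H.
Qed.

Lemma axes_are_next n x y : axes_are n x y ->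
  if tangent n is Some c then axes_are n.+1 (Some n) (if c == 0 then y else None)
    else axes_are n.+1 x (Some n).
Proof.
move=> [E1 E2]; rewrite /axes_are curve_ptS xaxis_rcons yaxis_rcons.
by case: (tangent n) => [c|]; split=> //; case: ifP.
Qed.

Lemma axes_are_N n x y m : axes_are n x y -> has_mult (germ_at n) m ->
  N_curve n = (oapp N_curve 0 x + oapp N_curve 0 y + m)%N.
Proof.
move=> [E1 E2] mu; rewrite /N_curve (N_compE (irr_neq0 irf) mu) E1 E2.
by case: x {E1} => [?|]; case: y {E2} => [?|].
Qed.
Lemma axes_are_nu n x y : axes_are n x y ->
  nu_curve n = (oapp nu_curve 1 x + oapp nu_curve 1 y)%N.
Proof.
move=> [E1 E2]; rewrite /nu_curve nu_compE E1 E2.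
by case: x {E1} => [?|]; case: y {E2} => [?|].
Qed.

Definition history n (E : seq (nat * nat)) :=
  (forall i k, (i, k) \in E <-> [/\ (k < n)%N, through i k & ~ through i k.+1]) /\
  (forall k, (k < n)%N -> ~ snc_at f (curve_pt k)).

(** Which of the two axes is the older curve A depends on the point, hence the
    alternatives. *)
Definition geo n st := match st with
  | Free A a => (axes_are n (Some A) None /\ meets_x (germ_at n) a) \/
    (axes_are n None (Some A) /\ meets_y (germ_at n) a)
  | Sat A B a b =>
    [/\ axes_are n (Some A) (Some B), meets_x (germ_at n) a & meets_y (germ_at n) b] \/
                   [/\ axes_are n (Some B) (Some A), meets_x (germ_at n) b & meets_y (germ_at n) a] end.

Definition geom_run n st E := [/\ run N_curve nu_curve n st E, history n E & geo n st].

Lemma edges_step n E E' : history n E -> ~ snc_at f (curve_pt n) ->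
  (forall i k, (i, k) \in E' <-> (i, k) \in E \/ k = n /\ (through i n /\ ~ through i n.+1)) ->
  history n.+1 E'.
Proof.
move=> [HE Hs] ns HE'; split; last exact: ltnS_case.
move=> i k; rewrite HE' HE; split.
  case=> [[kn a1 a2]|[-> [a1 a2]]]; split=> //; lia.
move=> [+ a1 a2]; rewrite ltnS leq_eqVlt => /orP[/eqP kn|kn]; last by left.
by right; rewrite -kn.
Qed.

Lemma edges0 n x y x' y' E : history n E -> ~ snc_at f (curve_pt n) -> axes_are n x y ->
  axes_are n.+1 x' y' ->
  (forall i, ~ ((x = Some i \/ y = Some i) /\ ~ (x' = Some i \/ y' = Some i))) ->
    history n.+1 E.
Proof.
move=> HE ns a1 a2 H; apply: edges_step HE ns _ => i k;
  rewrite (axes_are_through _ a1) (axes_are_through _ a2).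
by split=> [|[//|[_ /H]]]; first by left.
Qed.

Lemma edges1 n x y x' y' A E : history n E -> ~ snc_at f (curve_pt n) -> axes_are n x y ->
  axes_are n.+1 x' y' ->
  (forall i, (x = Some i \/ y = Some i) /\ ~ (x' = Some i \/ y' = Some i) <-> i = A) ->
  history n.+1 ((A, n) :: E).
Proof.
move=> HE ns a1 a2 H; apply: edges_step HE ns _ => i k;
  rewrite (axes_are_through _ a1) (axes_are_through _ a2) H inE.
split=> [/orP[/eqP[-> ->]|->]|[->|[-> ->]]]; rewrite ?eqxx ?orbT //; auto.
Qed.

Lemma edges2 n x y x' y' A B E : history n E -> ~ snc_at f (curve_pt n) -> axes_are n x y ->
  axes_are n.+1 x' y' ->
  (forall i, (x = Some i \/ y = Some i) /\ ~ (x' = Some i \/ y' = Some i) <-> i = A \/ i = B) ->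
  history n.+1 ((A, n) :: (B, n) :: E).
Proof.
move=> HE ns a1 a2 H; apply: edges_step HE ns _ => i k;
  rewrite (axes_are_through _ a1) (axes_are_through _ a2) H !inE.
split=> [/or3P[/eqP[-> ->]|/eqP[-> ->]|->]|[->|[-> [->|->]]]]; rewrite ?eqxx ?orbT //; auto.
Qed.

(** With a the intersection number with A and m the multiplicity: the tangent is
    transversal to A when a = m, and then the next point is free; otherwise it is
    tangent to A and the next point lies on A and on the new curve. *)
Lemma free_step n A a E : geom_run n (Free A a) E -> (1 < a)%N ->
  (exists E', geom_run n.+1 (Free n a) E') \/
  exists x y E', a = (x + y)%N /\ geom_run n.+1 (Sat A n x y) E'.
Proof.
move=> [ru HE ge] a1; have [co [nA _]] := run_shape ru.
have An : A <> n by lia.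
have [m [mu td _]] := tangent_germ_at irf n.
have m0 : (0 < m)%N by apply: has_mult_gt0 mu _; have [] := irr_germ_at irf n.
have ns : ~ snc_at f (curve_pt n).
  case: ge => [[[xq yq] o] sn|[[xq yq] o] sn].
    by have := proj1 (snc_on_x irf xq yq o) sn; lia.
  by have := proj1 (snc_on_y irf xq yq o) sn; lia.
case: ge => [[ax oxa]|[ax oya]].
- have := axes_are_next ax; have Nn := axes_are_N ax mu; have nun := axes_are_nu ax.
  rewrite /= in Nn nun; move: td; rewrite /tangent_data.
  case Et : (tangent n) => [c|].
  + move=> [om o1 _]; rewrite if_same => ax'.
    have am : a = m by apply: meets_x_uniq oxa om.
    left; exists ((A, n) :: E); split.
    * by apply: RunFree ru _ _ _ => //; lia.
    * by apply: (edges1 HE ns ax ax') => i; clear -An; intuition congruence.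
    * by left; rewrite am germ_atS Et; split.
  + move=> [om o1 /(_ _ oxa)[ma oa]] ax'.
    right; exists (a - m)%N, m, E; split; first lia.
    split.
    * by apply: RunTangent => //; [rewrite subnK //; lia|lia|lia].
    * by apply: (edges0 HE ns ax ax') => i; clear -An; intuition congruence.
    * by left; rewrite germ_atS Et; split.
- have := axes_are_next ax; have Nn := axes_are_N ax mu; have nun := axes_are_nu ax.
  rewrite /= in Nn nun; move: td; rewrite /tangent_data.
  case Et : (tangent n) => [c|].
  + case: eqP => c0 [om o1].
      move=> /(_ _ oya)[ma oa] ax'.
      right; exists (a - m)%N, m, E; split; first lia.
      split.
      * by apply: RunTangent => //; [rewrite subnK //; lia|lia|lia].
      * by apply: (edges0 HE ns ax ax') => i; clear -An; intuition congruence.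
      * by right; rewrite germ_atS Et; split.
    move=> omy ax'; have am : a = m by apply: meets_y_uniq oya omy.
    left; exists ((A, n) :: E); split.
    * by apply: RunFree ru _ _ _ => //; lia.
    * by apply: (edges1 HE ns ax ax') => i; clear -An; intuition congruence.
    * by left; rewrite am germ_atS Et; split.
  + move=> [om o1 _] ax'; have am : a = m by apply: meets_y_uniq oya om.
    left; exists ((A, n) :: E); split.
    * by apply: RunFree ru _ _ _ => //; lia.
    * by apply: (edges1 HE ns ax ax') => i; clear -An; intuition congruence.
    * by right; rewrite am germ_atS Et; split.
Qed.

(** The tangent is along the axis with the larger intersection number, and transversal
    to both when they are equal. *)
Lemma sat_step n A B a b E : geom_run n (Sat A B a b) E ->
  [\/ exists E', a = b /\ geom_run n.+1 (Free n a) E',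
      exists E', (a < b)%N /\ geom_run n.+1 (Sat n B a (b - a)) E' |
      exists E', (b < a)%N /\ geom_run n.+1 (Sat A n (a - b) b) E'].
Proof.
move=> [ru HE ge]; have [co [AB a0 b0]] := run_shape ru.
have [An _] := active_open co (or_introl erefl);
  have [Bn _] := active_open co (or_intror erefl).
have ns : ~ snc_at f (curve_pt n).
  by case: ge => [[[xq yq] _ _]|[[xq yq] _ _]]; exact: (snc_on_sat irf xq yq).
have {}An : A <> n by lia. have {}Bn : B <> n by lia.
have [m [mu td _]] := tangent_germ_at irf n.
have RL : (a < b)%N -> m = a -> N_curve n = (N_curve A + N_curve B + m)%N ->
  nu_curve n = (nu_curve A + nu_curve B)%N ->
    run N_curve nu_curve n.+1 (Sat n B a (b - a)) ((A, n) :: E).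
  by move=> ab -> *; apply: RunSatL => //; [rewrite subnKC // ltnW|lia].
have RR : (b < a)%N -> m = b -> N_curve n = (N_curve A + N_curve B + m)%N ->
  nu_curve n = (nu_curve A + nu_curve B)%N ->
    run N_curve nu_curve n.+1 (Sat A n (a - b) b) ((B, n) :: E).
  by move=> ab -> *; apply: RunSatR => //; [rewrite subnK // ltnW|lia].
have RF : a = b -> m = b -> N_curve n = (N_curve A + N_curve B + m)%N ->
  nu_curve n = (nu_curve A + nu_curve B)%N ->
    run N_curve nu_curve n.+1 (Free n b) ((A, n) :: (B, n) :: E).
  by move=> ab mb *; apply: RunRup => //; [rewrite ab in ru; exact: ru|lia].
case: ge => [[ax oxa oyb]|[ax oxb oya]].
- have := axes_are_next ax; have Nn := axes_are_N ax mu; have nun := axes_are_nu ax.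
  rewrite /= in Nn nun; move: td; rewrite /tangent_data.
  case Et : (tangent n) => [c|].
  + move=> [om o1]; have am : m = a by apply: meets_x_uniq om oxa.
    case: eqP => c0.
      move=> /(_ _ oyb)[mb ob] ax'; apply: Or32; exists ((A, n) :: E); rewrite -am.
      split=> //; split; [by rewrite am; apply: RL; lia | |by left; rewrite germ_atS Et; split].
      by apply: (edges1 HE ns ax ax') => i; clear -An Bn AB; intuition congruence.
    move=> omy ax'; have bm : m = b by apply: meets_y_uniq omy oyb.
    apply: Or31; exists ((A, n) :: (B, n) :: E); split; first by rewrite -am.
    split; [by rewrite -am bm; apply: RF; lia | |by left; rewrite germ_atS Et -am; split].
    by apply: (edges2 HE ns ax ax') => i; clear -An Bn AB; intuition congruence.
  + move=> [om o1 /(_ _ oxa)[ma oa]] ax'; have bm : m = b by apply: meets_y_uniq om oyb.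
    apply: Or33; exists ((B, n) :: E); rewrite -bm.
    split=> //; split; [by rewrite bm; apply: RR; lia | |by left; rewrite germ_atS Et; split].
    by apply: (edges1 HE ns ax ax') => i; clear -An Bn AB; intuition congruence.
- have := axes_are_next ax; have Nn := axes_are_N ax mu; have nun := axes_are_nu ax.
  rewrite /= in Nn nun; move: td; rewrite /tangent_data.
  rewrite [(N_curve B + _)%N]addnC in Nn; rewrite [(nu_curve B + _)%N]addnC in nun.
  case Et : (tangent n) => [c|].
  + move=> [om o1]; have bm : m = b by apply: meets_x_uniq om oxb.
    case: eqP => c0.
      move=> /(_ _ oya)[mb ob] ax'; apply: Or33; exists ((B, n) :: E); rewrite -bm.
      split=> //; split; [by rewrite bm; apply: RR; lia | |by right; rewrite germ_atS Et;
        split].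
      by apply: (edges1 HE ns ax ax') => i; clear -An Bn AB; intuition congruence.
    move=> omy ax'; have am : m = a by apply: meets_y_uniq omy oya.
    apply: Or31; exists ((A, n) :: (B, n) :: E); split; first by rewrite -am.
    split; [by rewrite -am bm; apply: RF; lia | |by left; rewrite germ_atS Et -am; split].
    by apply: (edges2 HE ns ax ax') => i; clear -An Bn AB; intuition congruence.
  + move=> [om o1 /(_ _ oxb)[ma oa]] ax'; have am : m = a by apply: meets_y_uniq om oya.
    apply: Or32; exists ((A, n) :: E); rewrite -am.
    split=> //; split; [by rewrite am; apply: RL; lia | |by right; rewrite germ_atS Et; split].
    by apply: (edges1 HE ns ax ax') => i; clear -An Bn AB; intuition congruence.
Qed.

Lemma sat_leads_to_free n A B a b E : geom_run n (Sat A B a b) E ->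
  exists n' A' d E', [/\ (d <= a)%N, (d <= b)%N & geom_run n' (Free A' d) E'].
Proof.
have [s] := ubnP (a + b)%N; elim: s n A B a b E => // s IH n A B a b E abs grun.
have [ru _ _] := grun; have [_ [_ a0 b0]] := run_shape ru.
case: (sat_step grun) => [[E' [ab gr']]|[E' [ab gr']]|[E' [ab gr']]].
- by exists n.+1, n, a, E'; rewrite -ab.
- have [|n' [A' [d [E1 [da db g1]]]]] := IH _ _ _ _ _ _ _ gr'; first lia.
  by exists n', A', d, E1; split=> //; lia.
- have [|n' [A' [d [E1 [da db g1]]]]] := IH _ _ _ _ _ _ _ gr'; first lia.
  by exists n', A', d, E1; split=> //; lia.
Qed.

Definition free_on_x n a := exists A, axes_are n (Some A) None /\ meets_x (germ_at n) a.
Definition free_on_y n a := exists A, axes_are n None (Some A) /\ meets_y (germ_at n) a.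

Lemma axes_are_uniq n x y x' y' : axes_are n x y -> axes_are n x' y' -> x = x' /\ y = y'.
Proof.
move=> [E1 E2] [E3 E4]; rewrite E1 in E3; rewrite E2 in E4.
have pi := @curve_pt_inj R f.
by split; [case: x x' E1 E3 => [?|] [?|] //= _ [/pi->]|case: y y' E2 E4 =>
  [?|] [?|] //= _ [/pi->]].
Qed.

Lemma free_on_x_next n a : free_on_x n a -> free_on_x n.+1 a \/ free_on_y n.+1 a ->
  free_on_x n.+1 a /\ exists c, pullback (Some c) (germ_at n) = sx R ^+ a * germ_at n.+1.
Proof.
move=> [A [ax oa]] fr; have [m [mu td _]] := tangent_germ_at irf n.
have := axes_are_next ax; rewrite germ_atS (strict1_dir _ mu); move: td; rewrite /tangent_data.
case: (tangent n) => [c|].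
  move=> [om o1 _]; rewrite if_same => ax'.
  have am : a = m by apply: meets_x_uniq oa om.
  split; last by exists c; rewrite am (pullback_strict_dir _ mu).
  by exists n; split=> //; case: fr => [[A' [_ //]]|[A' [/(axes_are_uniq ax')[]//]]].
by move=> _ ax'; case: fr => [[A' []]|[A' []]] /(axes_are_uniq ax')[].
Qed.

Lemma free_on_y_next n a : free_on_y n a -> free_on_x n.+1 a \/ free_on_y n.+1 a ->
  free_on_x n.+1 a \/ free_on_y n.+1 a /\ pullback None (germ_at n) = sy R ^+ a * germ_at n.+1.
Proof.
move=> [A [ax oa]] [fx|fy]; [by left|right; split=> //].
have [m [mu td _]] := tangent_germ_at irf n.
have := axes_are_next ax; rewrite germ_atS (strict1_dir _ mu); move: td; rewrite /tangent_data.
case: (tangent n) => [c _ ax'|[om _ _] _].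
  by case: fy => [A' [/(axes_are_uniq ax')[]]].
by rewrite (meets_y_uniq oa om) (pullback_strict_dir _ mu).
Qed.

(** As a is constant, if a point is free on the axis x = 0 so are the following ones;
    otherwise all are
    free on y = 0, and exchanging x and y gives the same situation. *)
Lemma not_always_free n a : (1 < a)%N ->
  (forall k, free_on_x (n + k) a \/ free_on_y (n + k) a) -> False.
Proof.
move=> a1 all; case: (pselect (exists k, free_on_x (n + k) a)) => [[k fx]|nx].
  have fxj j : free_on_x (n + k + j) a.
    elim: j => [|j IH]; first by rewrite addn0.
    by have [|+ _] := free_on_x_next IH; [rewrite -addnS -addnA|rewrite -addnS].
  have ex j : exists c, pullback (Some c) (germ_at (n + k + j)) = sx R ^+ a * germ_at (n + k + j.+1).
    have := fxj j.+1; rewrite addnS => fx'.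
    by have [_] := free_on_x_next (fxj j) (or_introl fx').
  have [t tE] := choice ex.
  apply: (@no_free_chain _ (fun j => germ_at (n + k + j)) t a) => //; first exact: irr_germ_at.
  by have [A' []] := fxj 0%N.
have fy k : free_on_y (n + k) a by case: (all k) => // fx; case: nx; exists k.
apply: (@no_free_chain _ (fun j => swap (germ_at (n + j))) (fun=> 0) a) => //.
- exact/irr_swap/irr_germ_at.
- by have [A' []] := fy 0%N.
- move=> j; have := free_on_y_next (fy j); rewrite -addnS => /(_ (or_intror (fy _)))[fx|[_]].
    by case: nx; exists j.+1.
  by rewrite pullbackN => /(congr1 (@swap R)); rewrite swapK swapM swapX swap_sy.
Qed.

(** By induction on the intersection number a, which decreases strictly whenever a
    satellite point occurs. *)
Lemma free_ends n A a E : geom_run n (Free A a) E -> exists m A' E', geom_run m (Free A' 1) E'.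
Proof.
elim/ltn_ind: a n A E => a IH n A E grun.
have [ru _ _] := grun; have [_ [_ a0]] := run_shape ru.
case: (ltngtP a 1) => [|a1|a1]; [lia| |by exists n, A, E; rewrite -a1].
apply: contrapT => no; apply: (@not_always_free n a a1) => k.
suff [A' [E' [_ _ []]]] : exists A' E', geom_run (n + k) (Free A' a) E'.
  by move=> fx; left; exists A'.
  by move=> fx; right; exists A'.
elim: k => [|k [A' [E' gr']]]; first by exists A, E; rewrite addn0.
case: (free_step gr' a1) => [[E1 g1]|[x [y [E1 [axy g1]]]]].
  by exists (n + k)%N, E1; rewrite addnS.
case: no; have [ru1 _ _] := g1; have [_ [_ x0 y0]] := run_shape ru1.
have [n' [A1 [d [E2 [dx dy g2]]]]] := sat_leads_to_free g1.
by apply: IH g2; lia.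
Qed.

Hypothesis fsing : ps_diff f = 0.

Lemma resolution_run : exists m A E, geom_run m (Free A 1) E.
Proof.
have [m [mu td _]] := tangent_germ_at irf 0.
have [f10 f01] := diffE f; rewrite fsing !mxE in f10 f01.
have m2 : (1 < m)%N.
  case: m mu {td} => [|[|m]] // [_ /eqP H]; case: H.
    by apply/polyP => -[|j]; rewrite coef_hom_part coef0 //=; exact: (germ_at00 irf 0).
  by apply/polyP => -[|[|j]]; rewrite coef_hom_part coef0 //=.
have ax : axes_are 0 None None by [].
have Nn := axes_are_N ax mu; have nun := axes_are_nu ax.
rewrite /= in Nn nun; have := axes_are_next ax; move: td; rewrite /tangent_data.
have ru : run N_curve nu_curve 1 (Free 0 m) [::] by rewrite -[m]Nn; apply: RunStart => //;
  rewrite Nn.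
have ed : history 1 [::].
  split; first by move=> i k; split=> // -[]; rewrite ltnS leqn0 => /eqP->;
    rewrite (axes_are_through _ ax) => -[].
  move=> k; rewrite ltnS leqn0 => /eqP->; rewrite (snc_onE irf 0) /= free1.
  by rewrite fsing eqxx.
case Et : (tangent 0) => [c|] [om o1 _]; rewrite ?if_same => ax'.
  by apply: (@free_ends 1 0 m [::]); split=> //; left; rewrite germ_atS Et.
by apply: (@free_ends 1 0 m [::]); split=> //; right; rewrite germ_atS Et.
Qed.

End GeometricRun.

(** * The dual graph of the minimal resolution *)

Lemma run_ext N nu N' nu' n st E : run N nu n st E ->
  (forall k, (k < n)%N -> N k = N' k /\ nu k = nu' k) -> run N' nu' n st E.
Proof.
elim=> {n st E}.
- move=> N0 nu0 H; have [NE nuE] := H 0%N isT; rewrite NE.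
  by apply: RunStart; rewrite -?NE -?nuE.
- move=> n A a E ru IH a1 Nn nun H; have [co _] := run_shape ru.
  have [An _] := active_open co (erefl A).
  have [NA nA] := H A (ltnW An); have [Nn' nn'] := H n (ltnSn n).
  by apply: RunFree; rewrite -?NA -?nA -?Nn' -?nn' //; apply: IH => k /ltnW /H.
- move=> n A a b E ru IH a0 b0 Nn nun H; have [co _] := run_shape ru.
  have [An _] := active_open co (erefl A).
  have [NA nA] := H A (ltnW An); have [Nn' nn'] := H n (ltnSn n).
  by apply: RunTangent; rewrite -?NA -?nA -?Nn' -?nn' //; apply: IH => k /ltnW /H.
- move=> n A B a b E ru IH b0 Nn nun H; have [co _] := run_shape ru.
  have [An _] := active_open co (or_introl erefl);
    have [Bn _] := active_open co (or_intror erefl).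
  have [NA nA] := H A (ltnW An); have [NB nB] := H B (ltnW Bn).
  have [Nn' nn'] := H n (ltnSn n).
  by apply: RunSatL; rewrite -?NA -?nA -?NB -?nB -?Nn' -?nn' //; apply: IH => k /ltnW /H.
- move=> n A B a b E ru IH b0 Nn nun H; have [co _] := run_shape ru.
  have [An _] := active_open co (or_introl erefl);
    have [Bn _] := active_open co (or_intror erefl).
  have [NA nA] := H A (ltnW An); have [NB nB] := H B (ltnW Bn).
  have [Nn' nn'] := H n (ltnSn n).
  by apply: RunSatR; rewrite -?NA -?nA -?NB -?nB -?Nn' -?nn' //; apply: IH => k /ltnW /H.
- move=> n A B d E ru IH Nn nun H; have [co _] := run_shape ru.
  have [An _] := active_open co (or_introl erefl);
    have [Bn _] := active_open co (or_intror erefl).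
  have [NA nA] := H A (ltnW An); have [NB nB] := H B (ltnW Bn).
  have [Nn' nn'] := H n (ltnSn n).
  by apply: RunRup; rewrite -?NA -?nA -?NB -?nB -?Nn' -?nn' //; apply: IH => k /ltnW /H.
Qed.

Section Assembly.
Variable R : realType.
Local Notation C := R[i].
Local Notation S := (series R).
Variable f : S.
Hypothesis irf : irr f.
Hypothesis fsing : ps_diff f = 0.
Local Notation curve_pt := (curve_pt f).
Local Notation germ_at := (germ_at f).
Local Notation tangent := (tangent f).
Local Notation through := (through f).

Variables (m A : nat) (E0 : seq (nat * nat)).
Hypothesis grun : geom_run f m (Free A 1) E0.

(** The vertices of the final graph: the exceptional curves, and the strict transform
    in position m. *)
Definition comp_at k : divisor R := if (k < m)%N then Some (curve_pt k) else None.
Definition N_at k := N_comp f (comp_at k).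
Definition nu_at k := nu_comp f (comp_at k).

Lemma comp_at_last : comp_at m = None. Proof. by rewrite /comp_at ltnn. Qed.
Lemma comp_at_lt k : (k < m)%N -> comp_at k = Some (curve_pt k). Proof.
  by rewrite /comp_at => ->. Qed.
Lemma comp_at_inj i k : (i <= m)%N -> (k <= m)%N -> comp_at i = comp_at k -> i = k.
Proof.
rewrite /comp_at; case: ltnP => im; case: ltnP => km //.
- by move=> _ _ [/curve_pt_inj].
- by move=> *; lia.
Qed.

Lemma run_at : run N_at nu_at m (Free A 1) E0.
Proof.
have [ru _ _] := grun; apply: run_ext ru _ => k km.
by rewrite /N_at /nu_at comp_at_lt.
Qed.
Lemma N_at_last : N_at m = 1%N.
Proof. by rewrite /N_at comp_at_last; have [+ _] := ps_ord_irr irf. Qed.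
Lemma nu_at_last : nu_at m = 1%N.
Proof.
have [_ H] := ps_ord_irr irf; rewrite /nu_at comp_at_last /nu_comp.
have -> : jacobian (chart_on (None : divisor R)) = 1 :> S by exact: ps_oneE.
by rewrite [ps_ord _ _]H.
Qed.
Lemma m_A : m = A.+1.
Proof. by have [_ []] := run_shape run_at. Qed.

Local Notation E := ((A, m) :: E0).
Local Notation cellE := (cell m A E0).

Lemma edgeE i k : (i, k) \in E <-> (k = m /\ i = A) \/
  [/\ (k < m)%N, through i k & ~ through i k.+1].
Proof.
have [_ [H _] _] := grun; rewrite inE -H; split=> [/orP[/eqP[-> ->]|]|[[-> ->]|->]]; auto.
  by rewrite eqxx.
by rewrite orbT.
Qed.

Lemma axis_curve_pt k q : xaxis (curve_pt k) = Some q \/ yaxis (curve_pt k) = Some q ->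
  exists2 i, (i < k)%N & q = curve_pt i.
Proof.
move=> ax; have [x [y [E1 E2]]] : exists x y, axes_are f k x y.
  elim: k {ax} => [|k [x [y axk]]]; first by exists None, None.
  by have := axes_are_next axk; case: (tangent k) => [c|] ax'; eexists; eexists; exact: ax'.
have [i qi] : exists i, q = curve_pt i.
  move: ax; rewrite E1 E2; case: x {E1} => [i|]; case: y {E2} => [j|] [] //= [<-];
  by [exists i|exists j].
by exists i => //; have := axis_size ax; rewrite qi !size_curve_pt.
Qed.

Lemma snc_m : snc_at f (curve_pt m).
Proof.
have [_ _ [[[xq yq] o]|[[xq yq] o]]] := grun; first exact/(snc_on_x irf xq yq o).
exact/(snc_on_y irf xq yq o).
Qed.
Lemma nsnc k : (k < m)%N -> ~ snc_at f (curve_pt k).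
Proof. by have [_ [_ H] _] := grun; apply: H. Qed.

Lemma prefix_rconsE (T : eqType) (q p : seq T) t : prefix q (rcons p t) = (q == rcons p t) || prefix q p.
Proof.
apply/idP/orP => [/prefixP[s]|[/eqP->|qp]]; [|exact: prefix_refl|].
  elim/last_ind: s => [|s u _]; first by rewrite cats0 => ->; left.
  by rewrite -rcons_cat => /rcons_inj[-> _]; right; exact: prefix_prefix.
by apply: prefix_trans qp _; exact: prefix_rcons.
Qed.

Lemma prefix_curve_pt q n : prefix q (curve_pt n) <-> exists2 k, (k <= n)%N & q = curve_pt k.
Proof.
elim: n => [|n IH].
  rewrite prefixs0; split=> [/eqP->|[k]]; first by exists 0%N.
  by rewrite leqn0 => /eqP-> ->.
rewrite curve_ptS prefix_rconsE; split=> [/orP[/eqP->|/IH[k kn ->]]|[k]].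
- by exists n.+1.
- by exists k => //; exact: leqW.
- rewrite leq_eqVlt => /orP[/eqP-> ->|kn qk]; first by rewrite eqxx.
  by apply/orP; right; apply/IH; exists k.
Qed.

Lemma centerP p : center f p <-> exists2 k, (k < m)%N & p = curve_pt k.
Proof.
split=> [ce|[k km ->] q /prefix_curve_pt[j jk ->]]; last by apply: nsnc;
  apply: leq_ltn_trans km.
have pE : p = curve_pt (size p).
  by apply: contrapT => np; apply: (ce p (prefix_refl p)); exact: (snc_off irf).
exists (size p) => //; rewrite ltnNge; apply/negP => mp.
by apply: (ce (curve_pt m)); [rewrite pE; apply/prefix_curve_pt; exists m|exact: snc_m].
Qed.

Lemma resolution_pointP p : resolution_point f p <->
  p = curve_pt m \/ exists k t, [/\ (k < m)%N, t <> tangent k & p = rcons (curve_pt k) t].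
Proof.
split=> [[sn ce]|[->|[k [t [km tk ->]]]]].
- elim/last_ind: p sn ce => [|p t _] sn ce.
    have m0 : (0 < m)%N by rewrite m_A.
    by case: (nsnc m0 sn).
  have : center f p.
    by apply: ce; [exact: prefix_rcons|apply/eqP => /(congr1 size); rewrite size_rcons; lia].
  move=> /centerP[k km pk]; subst p; case: (pselect (t = tangent k)) => [tk|tk]; last
    by right; exists k, t.
  left; rewrite tk -curve_ptS in sn *; case: (ltngtP k.+1 m) => [km'|mk|->//]; last by lia.
  by case: (nsnc km' sn).
- split; first exact: snc_m.
  move=> q /prefix_curve_pt[k km ->]; rewrite leq_eqVlt in km; case/orP: km => [/eqP->|km].
    by rewrite eqxx.
  by move=> _; apply/centerP; exists k.
- split.
    apply: (snc_off irf); rewrite size_rcons size_curve_pt curve_ptS => /rcons_inj[tt].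
    by apply: tk.
  move=> q; rewrite prefix_rconsE => /orP[/eqP->|/prefix_curve_pt[j jk ->] _]; first
    by rewrite eqxx.
  by apply/centerP; exists j => //; apply: leq_ltn_trans km.
Qed.

Lemma componentsP i : components f i <-> exists2 k, (k <= m)%N & i = comp_at k.
Proof.
rewrite /components /=; case: i => [q|].
  rewrite centerP; split=> [[k km ->]|[k]]; first by exists k; [exact: ltnW|rewrite comp_at_lt].
  by rewrite /comp_at; case: ltnP => // km _ [->]; exists k.
by split=> // _; exists m => //; rewrite comp_at_last.
Qed.

Lemma cell_le i k : cellE i k -> (i <= m)%N /\ (k <= m)%N.
Proof.
have [_ _ co _] := run_final run_at N_at_last nu_at_last.
move=> [im [<-//|ik]]; split=> //; have := edge_lt co ik; lia.
Qed.

(** Over p_k, in a direction t which is not tangent to the curve, there is the new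
    curve and at most one axis of p_k; that axis does not pass through p_(k+1), so
    the two are joined by an edge. *)
Lemma resolution_point_cell p : resolution_point f p ->
  exists i k, cellE i k /\ forall j, passes f j p <-> j = comp_at i \/ j = comp_at k.
Proof.
have Am : (A < m)%N by rewrite m_A.
move=> /resolution_pointP[->|[k [t [km tk ->]]]].
  exists A, m; split.
    by split; [exact: ltnW|right; rewrite inE eqxx].
  move=> [q|]; last first.
    rewrite comp_at_last; split=> [_|_]; first by right.
    by apply/(passes_curve irf); rewrite size_curve_pt.
  rewrite passes_exc comp_at_lt // comp_at_last.
  have [_ _ [[[-> ->] _]|[[-> ->] _]]] := grun => /=; split.
  - by case=> [[->]|//]; left.
  - by case=> [[->]|//]; left.
  - by case=> [//|[->]]; left.
  - by case=> [[->]|//]; right.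
have off : ~ passes f None (rcons (curve_pt k) t).
  by move/(passes_curve irf); rewrite size_rcons size_curve_pt curve_ptS => /rcons_inj[/tk].
pose o := if t is Some c then if c == 0 then yaxis (curve_pt k) else None
  else xaxis (curve_pt k).
have pass q : passes f (Some q) (rcons (curve_pt k) t) <-> q = curve_pt k \/ o = Some q.
  rewrite passes_exc xaxis_rcons yaxis_rcons /o; case: t {tk off o} => [c|]; split.
  - by case=> [[->]|->]; auto.
  - by case=> [->|->]; auto.
  - by case=> [->|[->]]; auto.
  - by case=> [->|->]; auto.
have [oN|[q oq]] : o = None \/ exists q, o = Some q by case: (o) => [q|]; [right;
  exists q|left].
  exists k, k; split; first by split; [exact: ltnW|left].
  rewrite comp_at_lt // => -[q|]; last by split=> // -[].
  by rewrite pass oN; split=> [[->|//]|[[->]|[->]]]; left.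
have ax : xaxis (curve_pt k) = Some q \/ yaxis (curve_pt k) = Some q.
  by move: oq; rewrite /o; case: (t) => [c|]; [case: ifP => // _|]; auto.
have [i ik qi] := axis_curve_pt ax; subst q.
have nik : curve_pt k <> curve_pt i by move/curve_pt_inj => ki; rewrite ki ltnn in ik.
exists i, k; split.
  split; first lia.
  right; apply/edgeE; right; split=> //.
  rewrite /through curve_ptS xaxis_rcons yaxis_rcons -/(tangent k).
  move: oq tk; rewrite /o; case: (t) => [c|]; case: (tangent k) => [c'|].
  - case: eqP => // -> yi tk [[/nik//]|]; case: eqP => // c0.
    by case: tk; rewrite c0.
  - case: eqP => // _ yi _ [xi|[/nik//]]; exact: axes_disjoint xi yi.
  - move=> xi _ [[/nik//]|]; case: eqP => // _ yi; exact: axes_disjoint xi yi.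
  - by move=> _ [].
have im : (i < m)%N by lia.
rewrite !comp_at_lt // => -[q|]; last by split=> // -[].
by rewrite pass oq; split=> [[->|[->]]|[[->]|[->]]]; auto.
Qed.

(** An edge (i, k) is realized at the point over p_k in the direction of the axis i. *)
Lemma cell_resolution_point i k : cellE i k ->
  exists2 p, resolution_point f p & passes f (comp_at i) p /\ passes f (comp_at k) p.
Proof.
have Am : (A < m)%N by rewrite m_A.
have cur : passes f None (curve_pt m) by apply/(passes_curve irf); rewrite size_curve_pt.
have resm : resolution_point f (curve_pt m) by apply/resolution_pointP; left.
move=> [im [ki|]].
  subst k; move: im; rewrite leq_eqVlt => /orP[/eqP->|im].
    by exists (curve_pt m); rewrite // comp_at_last.
  pose t : direction R := if tangent i is None then Some 0 else None.
  exists (rcons (curve_pt i) t).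
    apply/resolution_pointP; right; exists i, t; split=> //.
    by rewrite /t; case: (tangent i).
  rewrite comp_at_lt // passes_exc xaxis_rcons yaxis_rcons.
  by case: (t) => [c|]; auto.
move=> /edgeE[[-> ->]|[km ai nai]].
  exists (curve_pt m) => //; rewrite comp_at_last; split=> //; rewrite comp_at_lt // passes_exc.
  by have [_ _ [[[-> ->] _]|[[-> ->] _]]] := grun; auto.
have ik : (i < k)%N by have := axis_size ai; rewrite !size_curve_pt.
have im' : (i < m)%N by lia.
rewrite !comp_at_lt //; case: ai => [xi|yi].
  exists (rcons (curve_pt k) None).
    apply/resolution_pointP; right; exists k, None; split=> // tk.
    by apply: nai; left; rewrite curve_ptS -/(tangent k) -tk xaxis_rcons.
  by rewrite !passes_exc xaxis_rcons yaxis_rcons; auto.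
exists (rcons (curve_pt k) (Some 0)).
  apply/resolution_pointP; right; exists k, (Some 0); split=> // tk.
  by apply: nai; right; rewrite curve_ptS -/(tangent k) -tk yaxis_rcons eqxx.
by rewrite !passes_exc xaxis_rcons yaxis_rcons eqxx; auto.
Qed.

Lemma stratumP (I : {fset divisor R}) : stratum f I <->
  exists i k, cellE i k /\ forall j, (j \in I) = (j == comp_at i) || (j == comp_at k).
Proof.
split=> [[I0 _ [p rp pI]]|[i [k [ce IE]]]]; last first.
  have [im km] := cell_le ce; have [p rp [pi pk]] := cell_resolution_point ce.
  split.
  - by apply/fset0Pn; exists (comp_at i); rewrite IE eqxx.
  - by move=> j; rewrite IE => /orP[/eqP->|/eqP->]; apply/componentsP; [exists i|exists k].
  - by exists p => // j; rewrite IE => /orP[/eqP->|/eqP->].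
have [i [k [ce H]]] := resolution_point_cell rp.
have IE j : j \in I -> (j == comp_at i) || (j == comp_at k).
  by move/pI/H => [->|->]; rewrite eqxx ?orbT.
have [im km] := cell_le ce.
case: (boolP (comp_at i \in I)) => iI; case: (boolP (comp_at k \in I)) => kI.
- exists i, k; split=> // j; apply/idP/orP => [/IE/orP//|[/eqP->|/eqP->]//].
- exists i, i; split; first by split=> //; left.
  move=> j; rewrite orbb; apply/idP/eqP => [jI|->//].
  by case/orP: (IE _ jI) => /eqP // jk; rewrite jk (negbTE kI) in jI.
- exists k, k; split; first by split=> //; left.
  move=> j; rewrite orbb; apply/idP/eqP => [jI|->//].
  by case/orP: (IE _ jI) => /eqP // jk; rewrite jk (negbTE iI) in jI.
- case/fset0Pn: I0 => j jI; case/orP: (IE _ jI) => /eqP jE.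
    by rewrite jE (negbTE iI) in jI.
  by rewrite jE (negbTE kI) in jI.
Qed.

Lemma dvd_big_gcd (T : eqType) (s : seq T) (F : T -> nat) d :
  (d %| \big[gcdn/0%N]_(j <- s) F j)%N = all (fun j => d %| F j)%N s.
Proof. by elim: s => [|j s IH]; rewrite ?big_nil ?dvdn0 // big_cons dvdn_gcd IH. Qed.

Lemma N_setE (I : {fset divisor R}) i k : (forall j, (j \in I) = (j == comp_at i) || (j == comp_at k)) ->
  N_set f I = gcdn (N_at i) (N_at k).
Proof.
move=> IE; have H d : (d %| N_set f I)%N = (d %| gcdn (N_at i) (N_at k))%N.
  rewrite dvd_big_gcd dvdn_gcd; apply/allP/andP => [H|[di dk] j].
    by split; apply: H; rewrite IE eqxx ?orbT.
  by rewrite IE => /orP[/eqP->|/eqP->].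
by apply/eqP; rewrite eqn_dvd H dvdnn -H dvdnn.
Qed.

Lemma big_min_seq (s : seq rat) x0 : let v := \big[Num.min/x0]_(a <- s) a in
  [/\ v \in x0 :: s, v <= x0 & forall a, a \in s -> v <= a].
Proof.
elim: s => [|a s [IH1 IH2 IH3]] /=; first by rewrite big_nil mem_head.
rewrite big_cons; split.
- case: leP => _; first by rewrite !inE eqxx orbT.
  by move: IH1; rewrite !inE => /orP[->|->]; rewrite ?orbT.
- by rewrite ge_min IH2 orbT.
- by move=> b; rewrite inE ge_min => /orP[/eqP->|/IH3->]; rewrite ?lexx ?orbT.
Qed.

Local Notation al := (alpha N_at nu_at).

Lemma alpha_setE (I : {fset divisor R}) i k : (forall j, (j \in I) = (j == comp_at i) || (j == comp_at k)) ->
  alpha_set f I = Num.min (al i) (al k).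
Proof.
move=> IE; rewrite /alpha_set; set s := map _ _.
have mem_s a : a \in s -> a = al i \/ a = al k.
  by move=> /mapP[j + ->]; rewrite IE => /orP[/eqP->|/eqP->]; auto.
have si : al i \in s by apply/mapP; exists (comp_at i) => //; rewrite IE eqxx.
have sk : al k \in s by apply/mapP; exists (comp_at k) => //; rewrite IE eqxx orbT.
have hs : head 0 s \in s by move: si; case: (s) => //= a r _; rewrite mem_head.
have [] := big_min_seq s (head 0 s); set v := \big[_/_]_(_ <- _) _ => vs _ le.
apply/le_anti/andP; split; first by rewrite le_min !le.
have {}vs : v \in s by move: vs; rewrite inE => /orP[/eqP->|].
by rewrite ge_min; case: (mem_s _ vs) => ->; rewrite lexx ?orbT.
Qed.

Lemma stratum_of_cell i k : cellE i k -> exists2 I, stratum f I &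
  forall j, (j \in I) = (j == comp_at i) || (j == comp_at k).
Proof.
move=> ce; have IE j : (j \in [fset comp_at i;
  comp_at k]%fset) = (j == comp_at i) || (j == comp_at k).
  by rewrite !inE.
by exists [fset comp_at i; comp_at k]%fset => //; apply/stratumP; exists i, k.
Qed.

Lemma remarkableE a : remarkable f a <-> exists2 v, isrup E v & al v = a.
Proof.
rewrite -(remarkable_cells run_at N_at_last nu_at_last); split.
  move=> [I [/stratumP[i [k [ce IE]]] aI H]]; exists i, k; split=> //.
    by rewrite -(alpha_setE IE).
  move=> j l ce' lt; have [J sJ JE] := stratum_of_cell ce'.
  rewrite -(N_setE IE) -(N_setE JE); apply: H => //.
  by rewrite (alpha_setE JE) aI.
move=> [i [k [ce aE H]]]; have [I sI IE] := stratum_of_cell ce.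
exists I; split=> //; first by rewrite (alpha_setE IE).
move=> J /stratumP[j [l [ce' JE]]]; rewrite (alpha_setE IE) (alpha_setE JE) aE => lt.
by rewrite (N_setE IE) (N_setE JE); apply: H.
Qed.

Lemma neighboursE v L : (v <= m)%N ->
  (forall j, (j \in L) = ((j, v) \in E) || ((v, j) \in E)) ->
  neighbours f (comp_at v) = [set` seq_fset tt [seq comp_at j | j <- L]]%classic.
Proof.
have [_ _ co _] := run_final run_at N_at_last nu_at_last.
move=> vm LE;
  have memE j : [set` seq_fset tt [seq comp_at j | j <- L]]%classic j <-> j \in [seq comp_at j | j <- L].
  by rewrite -(seq_fsetE tt).
apply/seteqP; split=> j; rewrite memE.
  move=> [_ /eqP jv [p rp pj]]; have [i [k [ce H]]] := resolution_point_cell rp.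
  have [im km] := cell_le ce.
  have /H vik : passes f (comp_at v) p by apply: pj; rewrite !inE eqxx.
  have /H jik : passes f j p by apply: pj; rewrite !inE eqxx orbT.
  have [_ [ike|ike]] := ce.
    by subst k; case: jv; case: vik jik => -> [->|->].
  case: vik => /comp_at_inj vE; case: jik => jE.
  - by case: jv; rewrite jE (vE vm im).
  - by rewrite jE map_f // LE (vE vm im) ike orbT.
  - by rewrite jE map_f // LE (vE vm km) ike.
  - by case: jv; rewrite jE (vE vm km).
move=> /mapP[u + ->]; rewrite LE => uv.
have [ce ne] : (cellE u v \/ cellE v u) /\ u <> v.
  case/orP: uv => e; (split; [|by have := edge_lt co e; lia]).
    by left; apply: (cell_edge run_at N_at_last nu_at_last).
  by right; apply: (cell_edge run_at N_at_last nu_at_last).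
have um : (u <= m)%N by case: ce => /cell_le[].
split.
- by apply/componentsP; exists u.
- by apply/eqP => /(comp_at_inj um vm).
- case: ce => /cell_resolution_point[p rp [p1 p2]]; exists p => // l;
  by rewrite !inE => /orP[/eqP->|/eqP->].
Qed.

Lemma three_neighbours v : (v <= m)%N -> (neighbours f (comp_at v) #= `I_3)%card <-> isrup E v.
Proof.
move=> vm; have [L [uL LE sL]] := neighbour_list run_at N_at_last nu_at_last vm.
have Lm j : j \in L -> (j <= m)%N.
  rewrite LE => /orP[] e.
    by have [] := cell_le (cell_edge run_at N_at_last nu_at_last e).
  by have [] := cell_le (cell_edge run_at N_at_last nu_at_last e).
rewrite (neighboursE vm LE) -sL.
have cE : #|` seq_fset tt [seq comp_at j | j <- L]| = size L.
  rewrite cardfE -cardfE size_seq_fset undup_id ?size_map //.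
  by rewrite map_inj_in_uniq // => i j /Lm im /Lm jm; apply: comp_at_inj.
rewrite -cE; split=> [/card_eq_fsetP->//|/eqP H].
by apply/card_eq_fsetP.
Qed.

Lemma remarkable_set : ([set a : rat | remarkable f a] =
  [set alpha_comp f i | i in [set i | components f i /\
    (neighbours f i #= `I_3)%card]])%classic.
Proof.
apply/seteqP; split=> a /=.
  move=> /remarkableE[v rv va].
  have vm : (v < m)%N := rup_lt run_at N_at_last nu_at_last rv.
  exists (comp_at v) => //; split; first by apply/componentsP; exists v; first exact: ltnW.
  by apply/three_neighbours; first exact: ltnW.
move=> [i [/componentsP[v vm ->] /(three_neighbours vm) rv] <-].
by apply/remarkableE; exists v.
Qed.

End Assembly.

(** * The remarkable numbers of a unibranch germ *)

Local Open Scope classical_set_scope.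
Local Open Scope ring_scope.

Theorem theorem1p11 (R : realType) (f : series R)
  (f_germ : holomorphic_germ f) (f_unibranch : unibranch f)
  (f_singular : ~ smooth_germ f) :
  [set a : rat | remarkable f a] =
  [set alpha_comp f i | i in [set i | components f i /\
                                 (neighbours f i #= `I_3)%card]].
Proof.
have irf : irr f by apply/irrP.
have sing : ps_diff f = 0.
  by apply/eqP; move/negP: f_singular; rewrite negbK.
have [m [A [E grun]]] := resolution_run irf sing.
exact: remarkable_set grun.
Qed.
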